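(* For $n\in\mathbb{N}=\{1,2,3,\dots\}$ let $$\varphi_1(n) := 2^{n}\cdot (n+1)!\cdot \left((n+2)!\right)^{(n+2)^{n-2}\cdot (n+1)}\cdot (2\pi n)^{(n+2)\cdot (n+1)^{n+1}}.$$ If $(\tilde q_n)_{n\in\mathbb{N}}$ is a sequence of natural numbers satisfying $$\tilde q_{n+1}\ \geq\ \varphi_1(n)\cdot \tilde q_n^{\,2\cdot\left((n+2)\cdot (n+1)^{n+1}+1\right)}\qquad\text{for all } n\in\mathbb{N},$$ then there exists a weak mixing $C^\infty$-diffeomorphism of $\mathbb{T}^2$ that is uniformly rigid with respect to $(\tilde q_n)_{n\in\mathbb{N}}$.
   Context: Natural numbers are positive integers. $\mathbb{T}^2=\mathbb{R}^2/\mathbb{Z}^2$ with Lebesgue (Haar) probability measure $\mu$ and its standard metric $d$. Diffeomorphisms called weak mixing or uniformly rigid are measure-preserving for $\mu$. Weak mixing: $T$ preserves $\mu$ and for all measurable $A,B$, $\frac1N\sum_{n=1}^N|\mu(T^nA\cap B)-\mu(A)\mu(B)|\to 0$ as $N\to\infty$. Uniformly rigid with respect to an increasing sequence $(n_m)_{m\in\mathbb{N}}$ of natural numbers: $d_u(T^{n_m},\mathrm{id})\to 0$ as $m\to\infty$, where $d_u(S,T)=\sup_x d(S(x),T(x))+\sup_x d(S^{-1}(x),T^{-1}(x))$. *)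

(* Defs.v *)
From HB Require Import structures.
From mathcomp Require Import all_boot all_order all_algebra.
From mathcomp Require Import ring_quotient.
From mathcomp Require Import all_classical all_reals all_analysis.

Set Implicit Arguments.
Unset Strict Implicit.
Unset Printing Implicit Defensive.

Import Order.TTheory GRing.Theory Num.Theory.
Import numFieldNormedType.Exports.

Local Open Scope classical_set_scope.
Local Open Scope ring_scope.
Local Open Scope quotient_scope.

Definition int_lattice (R : realType) : {pred R * R} :=
  fun v => (v.1 \is a Num.int) && (v.2 \is a Num.int).

Lemma int_lattice_zmod_closed (R : realType) :
  zmod_closed (@int_lattice R).
Proof.
split=> [|u v]; first by apply/andP; split; exact: rpred0.
by move=> /andP[u1 u2] /andP[v1 v2]; apply/andP; split; exact: rpredB.
Qed.

HB.instance Definition _ (R : realType) :=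
  GRing.isZmodClosed.Build (R * R)%type (@int_lattice R)
    (@int_lattice_zmod_closed R).

Definition torus (R : realType) : Type := Quotient.quot (@int_lattice R).

HB.instance Definition _ (R : realType) :=
  EqQuotient.copy (torus R) (Quotient.quot (@int_lattice R)).
HB.instance Definition _ (R : realType) :=
  GRing.Zmodule.copy (torus R) (Quotient.quot (@int_lattice R)).
HB.instance Definition _ (R : realType) := isPointed.Build (torus R) 0.

Definition torus_proj (R : realType) (a : R * R) : torus R := \pi_(torus R) a.

(* The sigma-algebra below is the finest one making [torus_proj] measurable;
   it is the Borel sigma-algebra of the quotient topology. *)
Section torus_measurable.
Context {R : realType}.
Local Notation R2 := (measurableTypeR R * measurableTypeR R)%type.

Definition torus_measurable : set (set (torus R)) :=
  [set A | measurable ((@torus_proj R : R2 -> torus R) @^-1` A)].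

Lemma torus_measurable0 : torus_measurable set0.
Proof. by rewrite /torus_measurable /= preimage_set0. Qed.

Lemma torus_measurableC A : torus_measurable A -> torus_measurable (~` A).
Proof. by rewrite /torus_measurable /= preimage_setC; exact: measurableC. Qed.

Lemma torus_measurable_bigcup (F : (set (torus R))^nat) :
  (forall i, torus_measurable (F i)) -> torus_measurable (\bigcup_i F i).
Proof.
move=> mF; rewrite /torus_measurable /= preimage_bigcup.
by apply: bigcup_measurable => i _; exact: mF.
Qed.

HB.instance Definition _ := @isMeasurable.Build default_measure_display
  (torus R) torus_measurable torus_measurable0 torus_measurableC
  torus_measurable_bigcup.

Definition unit_square : set R2 := `[0, 1[%classic `*` `[0, 1[%classic.

Lemma measurable_unit_square : measurable unit_square.
Proof. by apply: measurableX; exact: measurable_itv. Qed.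

Definition torus_measure : set (torus R) -> \bar R :=
  pushforward (mrestr (@lebesgue_measure R \x @lebesgue_measure R)%E
                      measurable_unit_square)
              (@torus_proj R : R2 -> torus R).

Let torus_measure0 : torus_measure set0 = 0%E.
Proof. by rewrite /torus_measure /pushforward preimage_set0 measure0. Qed.

Let torus_measure_ge0 A : (0 <= torus_measure A)%E.
Proof. by rewrite /torus_measure /pushforward. Qed.

Let torus_measure_semi_sigma_additive : semi_sigma_additive torus_measure.
Proof.
move=> F mF tF mUF; rewrite /torus_measure /pushforward preimage_bigcup.
apply: measure_semi_sigma_additive => //.
apply/trivIsetP => i j _ _ ij; rewrite -preimage_setI.
by move/trivIsetP : tF => /(_ _ _ _ _ ij) ->//; rewrite preimage_set0.
Qed.

HB.instance Definition _ := isMeasure.Build _ _ _ torus_measure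
  torus_measure0 torus_measure_ge0 torus_measure_semi_sigma_additive.

Lemma torus_measure_setT : torus_measure setT = 1%E.
Proof.
rewrite /torus_measure /pushforward /mrestr preimage_setT setTI.
rewrite /unit_square product_measure1E; [|exact: measurable_itv..].
have leb01 : lebesgue_measure (`[0, 1[%classic : set R) = 1%E.
  by rewrite lebesgue_measure_itv/= lte_fin ltr01 oppr0 adde0.
by rewrite [X in (X * _)%E]leb01 [X in (_ * X)%E]leb01 mule1.
Qed.

HB.instance Definition _ := Measure_isProbability.Build _ _ _
  torus_measure torus_measure_setT.

End torus_measurable.

Definition torus_dist (R : realType) (x y : torus R) : R :=
  inf [set r | exists a b : R * R,
    [/\ torus_proj a = x, torus_proj b = y &
        r = Num.sqrt ((a.1 - b.1) ^+ 2 + (a.2 - b.2) ^+ 2)]].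

Fixpoint continuously_differentiable (R : realType) (k : nat)
    (U : set (R * R)) (F : R * R -> R * R) : Prop :=
  match k with
  | 0 => forall x, U x -> {for x, continuous F}
  | k'.+1 => forall v : R * R, v = (1, 0) \/ v = (0, 1) ->
      (forall x, U x -> derivable F x v) /\
      continuously_differentiable k' U ('D_v F)
  end.

(* The charts of the torus are the local inverses of [torus_proj]. *)
Definition torus_smooth (R : realType) (f : torus R -> torus R) : Prop :=
  forall a : R * R, exists (U : set (R * R)) (F : R * R -> R * R),
    [/\ open U, U a, forall k, continuously_differentiable k U F &
        forall x, U x -> torus_proj (F x) = f (torus_proj x)].

Definition torus_Cinfty_diffeomorphism (R : realType)
    (f : {splitbij [set: torus R] >-> [set: torus R]}) : Prop :=
  torus_smooth f /\ torus_smooth f^-1%FUN.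

Definition measure_preserving d (X : measurableType d) (R : realType)
    (P : probability X R) (f : X -> X) : Prop :=
  measurable_fun [set: X] f /\
  forall A, measurable A -> P (f @^-1` A) = P A.

Definition weak_mixing d (X : measurableType d) (R : realType)
    (P : probability X R) (f : X -> X) : Prop :=
  measure_preserving P f /\
  forall A B, measurable A -> measurable B ->
    N%:R^-1 * \sum_(1 <= n < N.+1)
       `|fine (P ((iter n f @` A) `&` B)) - fine (P A) * fine (P B)|
    @[N --> \oo] --> (0 : R).

Definition uniform_dist (R : realType)
    (f g : {splitbij [set: torus R] >-> [set: torus R]}) : R :=
  sup (range (fun x => torus_dist (f x) (g x))) +
  sup (range (fun x => torus_dist (f^-1%FUN x) (g^-1%FUN x))).

(* Sequences are indexed by positive integers: the value at 0 is ignored. *)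
Definition uniformly_rigid (R : realType) (q : nat -> nat)
    (f : {splitbij [set: torus R] >-> [set: torus R]}) : Prop :=
  [/\ measure_preserving (@torus_measure R) f,
      forall m n, (0 < m)%N -> (m < n)%N -> (q m < q n)%N &
      uniform_dist (iter (q m) f) idfun @[m --> \oo] --> (0 : R)].

(* For n = 1 the exponent (n + 2) ^ (n - 2) is 1 / 3, hence the real power. *)
Definition phi1 (R : realType) (n : nat) : R :=
  2 ^+ n * (n.+1)`!%:R *
  ((n.+2)`!%:R `^ ((n.+2)%:R ^ (n%:Z - 2) * (n.+1)%:R)) *
  (2 * pi * n%:R) ^+ (n.+2 * n.+1 ^ n.+1).

(* Main.v *)
Require Import Defs.
From HB Require Import structures.
From mathcomp Require Import all_boot all_order all_algebra.
From mathcomp Require Import all_classical all_reals all_analysis measurable_realfun.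
From mathcomp Require Import ring lra zify.

(** Anosov-Katok construction with explicit conjugations. The growth condition
    only enters through [2 ^ n * q n ^ n <= q n.+1]: it provides a number alpha
    whose products [q n * alpha] exceed an integer by an amount eps_n of order
    [q n / q n.+1], which beats every negative power of [q n]. Put
    [h z = z + b cos (2 pi q xi) w] with [w = (k, 1)] and [xi = z.1 - k z.2]; as xi
    is constant along w, h preserves area, and its inverse is given by [- b]. The
    diffeomorphism is the limit of the conjugates [H_j \o rot alpha \o H_j^-1],
    where [H_(j+1) = H_j \o h] for suitable [k], [b] and [q = q n]. Since h commutes
    with the rotation by [1 / q], one step changes the conjugates of [rot alpha] in
    the C^j topology by at most a constant times [q ^ K * eps_n], so the scheme
    converges, and the rotations by [eps_n] stay close to the identity after
    conjugation, which is the uniform rigidity along the whole sequence.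

    For an iterate m with [m * eps_n] close to [1 / 2], the conjugated rotation
    moves z by [- 2 b cos (2 pi q xi)] along w. Integrating over a period of the
    cosine, a periodic observable is averaged over the segments parallel to w, which
    equidistribute as k grows: the limit mixes along a sequence of times. This
    already forces weak mixing: along sparse times the translates of an observable
    are almost orthogonal, so Bessel's inequality bounds the mean square of the
    correlations. *)

Set Implicit Arguments.
Unset Strict Implicit.
Unset Printing Implicit Defensive.

Import Order.TTheory GRing.Theory Num.Theory.
Import numFieldNormedType.Exports.

Local Open Scope classical_set_scope.
Local Open Scope ring_scope.

(** * Uniform bounds on partial derivatives *)

(** The usual scheme builds the rotation number along with the conjugacies. Here rigidity is asked
    along a prescribed sequence, every term included, so [alpha] is fixed beforehand with
    [q n * alpha] close to an integer for all n, and only a sparse set of indices, the levels,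
    serves for new conjugacies. Between two levels the conjugacy is frozen, and the rotations by
    [eps n] stay small under it because it is Lipschitz. The order of choices makes this possible:
    [k] and [b] depend on the previous conjugacy and on the accuracy wanted, not on [q], so all
    constants are known before the level is chosen, and the decay of [eps n] then absorbs any
    constant and any power of [q n]. The error must also be bounded below: some multiple of [eps n]
    has to come near 1/2 before time [q n.+1], while the next approximation still follows the limit.
    The scale [b] is large because the values of a cosine are not equidistributed: only after
    stretching does a shift of size at most 1 become invisible on average. *)

Section bounded_derivatives.
Context {R : realType}.
Implicit Types (F G : R * R -> R) (k : nat) (M N : R).
Notation e1 := ((1 : R), (0 : R)).
Notation e2 := ((0 : R), (1 : R)).

(** Frechet differentiability, rather than existence of the two partials, is built in so that the
    chain rule is available at every order; a single constant for all orders keeps the inductions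
    short. *)
Fixpoint Ck_bounded k F M : Prop :=
  (forall x, `|F x| <= M) /\
  match k with
  | 0 => True
  | k'.+1 => [/\ forall x, differentiable F x,
                 Ck_bounded k' ('D_e1 F) M & Ck_bounded k' ('D_e2 F) M]
  end.

Lemma diff_partialE F x v : differentiable F x ->
  'D_v F x = v.1 * 'D_e1 F x + v.2 * 'D_e2 F x.
Proof.
move=> dF; rewrite !deriveE//.
have {1}-> : v = v.1 *: e1 + v.2 *: e2.
  case: v => a b; apply: injective_projections => /=.
    by rewrite /GRing.scale/= mulr0 mulr1 addr0.
  by rewrite /GRing.scale/= mulr0 mulr1 add0r.
by rewrite linearD !linearZ.
Qed.

Lemma derive_comp_pair F (G1 G2 : R * R -> R) x v :
  differentiable G1 x -> differentiable G2 x ->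
  differentiable F (G1 x, G2 x) ->
  'D_v (fun z => F (G1 z, G2 z)) x =
  'D_v G1 x * 'D_e1 F (G1 x, G2 x) + 'D_v G2 x * 'D_e2 F (G1 x, G2 x).
Proof.
move=> d1 d2 dF.
have dG : differentiable (fun z => (G1 z, G2 z)) x by exact: differentiable_pair.
rewrite deriveE; last exact: differentiable_comp.
rewrite (_ : (fun z => _) = F \o (fun z => (G1 z, G2 z)))//.
rewrite diff_comp//= diff_pair//=.
by rewrite -deriveE// diff_partialE//= -!deriveE.
Qed.

Lemma Ck_bounded_sup k F M x : Ck_bounded k F M -> `|F x| <= M.
Proof. by case: k => [|k] [FM _]; exact: FM. Qed.

Lemma Ck_bounded_ge0 k F M : Ck_bounded k F M -> 0 <= M.
Proof. by move=> /Ck_bounded_sup -/(_ 0); exact: le_trans. Qed.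

Lemma Ck_bounded_le k F M N : M <= N -> Ck_bounded k F M -> Ck_bounded k F N.
Proof.
move=> MN; elim: k F => [|k IH] F [FM]; first by split=> // x; exact: le_trans MN.
move=> [dF /IH F1 /IH F2]; split; first by move=> x; exact: le_trans MN.
by split.
Qed.

Lemma Ck_boundedW k F M : Ck_bounded k.+1 F M -> Ck_bounded k F M.
Proof.
elim: k F => [|k IH] F [FM [dF F1 F2]]; first exact: conj FM I.
exact: conj FM (And3 dF (IH _ F1) (IH _ F2)).
Qed.

Lemma Ck_bounded_leq k l F M : (k <= l)%N -> Ck_bounded l F M -> Ck_bounded k F M.
Proof.
elim: l => [|l IH]; first by rewrite leqn0 => /eqP ->.
rewrite leq_eqVlt => /predU1P[->//|]; rewrite ltnS => kl /Ck_boundedW.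
exact: IH.
Qed.

Lemma Ck_boundedD k F G M N : Ck_bounded k F M -> Ck_bounded k G N ->
  Ck_bounded k (fun x => F x + G x) (M + N).
Proof.
elim: k F G => [|k IH] F G.
  by move=> [FM _] [GN _]; split=> // x; exact: le_trans (ler_normD _ _) (lerD _ _).
move=> [FM [dF F1 F2]] [GN [dG G1 G2]]; split.
  by move=> x; exact: le_trans (ler_normD _ _) (lerD _ _).
have DE v : 'D_v (fun x => F x + G x) = fun x => 'D_v F x + 'D_v G x.
  by apply/funext => x; rewrite -deriveD//; exact: diff_derivable.
split; first by move=> x; exact: differentiableD.
- by rewrite DE; exact: IH.
- by rewrite DE; exact: IH.
Qed.

(** The factor [2 ^+ k] counts the terms of the Leibniz rule: each derivative doubles their
    number. *)
Lemma Ck_boundedM k F G M N : Ck_bounded k F M -> Ck_bounded k G N ->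
  Ck_bounded k (fun x => F x * G x) (2 ^+ k * (M * N)).
Proof.
elim: k F G => [|k IH] F G.
  move=> [FM _] [GN _]; split=> // x.
  by rewrite expr0 mul1r normrM ler_pM.
move=> HF HG; have M0 := Ck_bounded_ge0 HF; have N0 := Ck_bounded_ge0 HG.
have HF' := Ck_boundedW HF; have HG' := Ck_boundedW HG.
move: HF HG => [FM [dF F1 F2]] [GN [dG G1 G2]]; split.
  move=> x; rewrite normrM (@le_trans _ _ (M * N))//; first by rewrite ler_pM.
  by rewrite ler_peMl ?mulr_ge0// exprn_ege1// ler1n.
have DE v : 'D_v (fun x => F x * G x) =
    fun x => F x * 'D_v G x + 'D_v F x * G x.
  apply/funext => x; rewrite (_ : (fun x => _) = F * G)// deriveM//;
    [|exact: diff_derivable..].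
  by rewrite /GRing.scale/= [G x * _]mulrC.
have e : 2 ^+ k.+1 * (M * N) = 2 ^+ k * (M * N) + 2 ^+ k * (M * N).
  by rewrite exprS; ring.
split; first by move=> x; exact: differentiableM.
- by rewrite DE e; apply: Ck_boundedD; apply: IH.
- by rewrite DE e; apply: Ck_boundedD; apply: IH.
Qed.

Lemma Ck_bounded_cst k (c : R) : Ck_bounded k (fun=> c) `|c|.
Proof.
elim: k c => [|k IH] c; first by split.
split=> //.
have DE v : 'D_v (fun _ : R * R => c) = fun=> 0.
  by apply/funext => x; exact: derive_cst.
split; first by move=> x; exact: differentiable_cst.
- by rewrite DE; apply: Ck_bounded_le (IH 0); rewrite normr0.
- by rewrite DE; apply: Ck_bounded_le (IH 0); rewrite normr0.
Qed.

Lemma differentiable_fst (x : R * R) : differentiable (fun z : R * R => z.1) x.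
Proof.
by apply: (@linear_differentiable R (R * R)%type R fst) => y; exact: cvg_fst.
Qed.

Lemma differentiable_snd (x : R * R) : differentiable (fun z : R * R => z.2) x.
Proof.
by apply: (@linear_differentiable R (R * R)%type R snd) => y; exact: cvg_snd.
Qed.

Lemma derive_fst v (x : R * R) : 'D_v (fun z : R * R => z.1) x = v.1.
Proof.
rewrite deriveE; last exact: differentiable_fst.
by rewrite (@diff_lin R (R * R)%type R fst)// => y; exact: cvg_fst.
Qed.

Lemma derive_snd v (x : R * R) : 'D_v (fun z : R * R => z.2) x = v.2.
Proof.
rewrite deriveE; last exact: differentiable_snd.
by rewrite (@diff_lin R (R * R)%type R snd)// => y; exact: cvg_snd.
Qed.

(** By the chain rule a derivative of the composite is a sum of two products of a lower-order
    composite with a bounded factor, so the constant depends only on the order and on [N]. Linearity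
    in [M] lets a small [F] stay small after composition with a fixed conjugacy. *)
Lemma Ck_bounded_comp k N : exists C : R, 1 <= C /\
  forall F M (g1 g2 : R * R -> R),
  Ck_bounded k F M -> Ck_bounded k g1 N -> Ck_bounded k g2 N ->
  Ck_bounded k (fun z => F (z.1 + g1 z, z.2 + g2 z)) (C * M).
Proof.
elim: k => [|k [C [C1 IH]]].
  by exists 1; split=> // F M g1 g2 [FM _] _ _; split=> // x; rewrite mul1r.
exists (C * (1 + 2 ^+ k * (1 + `|N|) * 2)).
have p0 : 0 <= 2 ^+ k * (1 + `|N|) * 2.
  by rewrite mulr_ge0// mulr_ge0// ?exprn_ge0// addr_ge0.
split; first by rewrite mulr_ege1// lerDl.
move=> F M g1 g2 HF Hg1 Hg2.
have M0 := Ck_bounded_ge0 HF; have N0 := Ck_bounded_ge0 Hg1.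
have Hg1' := Ck_boundedW Hg1; have Hg2' := Ck_boundedW Hg2.
move: HF Hg1 Hg2 => [FM [dF F1 F2]] [_ [dg1 g11 g12]] [_ [dg2 g21 g22]].
have CM0 : 0 <= C * M by rewrite mulr_ge0// (le_trans _ C1).
split.
  move=> x; rewrite (le_trans (FM _))//.
  by rewrite ler_peMl// mulr_ege1// lerDl.
have d1 x : differentiable (fun z : R * R => z.1 + g1 z) x.
  exact: differentiableD (@differentiable_fst _) (dg1 _).
have d2 x : differentiable (fun z : R * R => z.2 + g2 z) x.
  exact: differentiableD (@differentiable_snd _) (dg2 _).
have E v : 'D_v (fun z => F (z.1 + g1 z, z.2 + g2 z)) = fun x =>
   (v.1 + 'D_v g1 x) * ('D_e1 F) (x.1 + g1 x, x.2 + g2 x) +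
   (v.2 + 'D_v g2 x) * ('D_e2 F) (x.1 + g1 x, x.2 + g2 x).
  apply/funext => x.
  rewrite (@derive_comp_pair F (fun z : R * R => z.1 + g1 z) (fun z : R * R => z.2 + g2 z) x v)//.
  rewrite (@deriveD _ _ _ (fun z : R * R => z.1) g1)//;
    [|exact: diff_derivable (@differentiable_fst _)|exact: diff_derivable].
  rewrite (@deriveD _ _ _ (fun z : R * R => z.2) g2)//;
    [|exact: diff_derivable (@differentiable_snd _)|exact: diff_derivable].
  by rewrite derive_fst derive_snd.
have key v : `|v.1| <= 1 -> `|v.2| <= 1 -> Ck_bounded k ('D_v g1) N -> Ck_bounded k ('D_v g2) N ->
    Ck_bounded k ('D_v (fun z => F (z.1 + g1 z, z.2 + g2 z)))
      (C * (1 + 2 ^+ k * (1 + `|N|) * 2) * M).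
  move=> v1 v2 Hv1 Hv2; rewrite E.
  apply: (@Ck_bounded_le _ _ (2 ^+ k * ((1 + `|N|) * (C * M)) + 2 ^+ k * ((1 + `|N|) * (C * M)))).
    rewrite -subr_ge0 [X in 0 <= X](_ : _ = C * M)//; ring.
  have H c g : `|c| <= 1 -> Ck_bounded k g N -> Ck_bounded k (fun x => c + g x) (1 + `|N|).
    move=> c1 Hg; apply: Ck_boundedD.
      exact: Ck_bounded_le (Ck_bounded_cst _ _).
    by apply: Ck_bounded_le Hg; exact: ler_norm.
  by apply: Ck_boundedD; apply: Ck_boundedM;
    [exact: (H v.1 ('D_v g1))|exact: (IH ('D_e1 F) M g1 g2)|
     exact: (H v.2 ('D_v g2))|exact: (IH ('D_e2 F) M g1 g2)].
split.
- move=> x; apply: (@differentiable_comp _ _ _ _ (fun z => (z.1 + g1 z, z.2 + g2 z)) F) => //.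
  exact: differentiable_pair.
- by apply: key; rewrite ?normr1 ?normr0.
- by apply: key; rewrite ?normr1 ?normr0.
Qed.

End bounded_derivatives.

(** * Mean value inequalities and limits of derivatives *)

Section mean_value.
Context {R : realType}.
Implicit Types (F G : R * R -> R) (k : nat) (M N : R).
Notation e1 := ((1 : R), (0 : R)).
Notation e2 := ((0 : R), (1 : R)).

Lemma derivable_lipschitz (f df : R -> R) (M a b : R) :
  (forall t : R, is_derive t 1 f (df t)) -> (forall t : R, `|df t| <= M) ->
  `|f b - f a| <= M * `|b - a|.
Proof.
move=> fd dM; wlog ab : a b / a <= b.
  move=> H; have [/H//|/ltW/H] := leP a b.
  by rewrite distrC [X in _ <= _ * X]distrC.
have cf : {within `[a, b], continuous f}.
  apply: continuous_subspaceT => x; apply: differentiable_continuous.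
  by apply/derivable1_diffP; have [] := fd x.
have [c _ ->] := MVT_segment ab (fun x _ => fd x) cf.
by rewrite normrM ler_wpM2r.
Qed.

Lemma is_derive_line F (x v : R * R) (t : R) : derivable F (x + t *: v) v ->
  is_derive t 1 (fun s : R => F (x + s *: v)) ('D_v F (x + t *: v)).
Proof.
move=> dF.
have E : (fun h : R => h^-1 *: (((fun s : R => F (x + s *: v)) \o shift t) (h *: 1) - F (x + t *: v))) =
  (fun h => h^-1 *: ((F \o shift (x + t *: v)) (h *: v) - F (x + t *: v))).
  apply/funext => h /=; have -> : h *: (1 : R) = h by rewrite /GRing.scale/= mulr1.
  by rewrite scalerDl addrCA.
apply: DeriveDef; first by rewrite /derivable E.
by rewrite /derive E.
Qed.

Lemma directional_lipschitz F v M x (h : R) : (forall y, derivable F y v) ->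
  (forall y, `|'D_v F y| <= M) -> `|F (h *: v + x) - F x| <= M * `|h|.
Proof.
move=> dF FM.
have := @derivable_lipschitz (fun s => F (x + s *: v)) (fun t => 'D_v F (x + t *: v)) M 0 h
  (fun t => is_derive_line (dF _)) (fun t => FM _).
by rewrite scale0r addr0 subr0 [h *: v + x]addrC.
Qed.

(** The factor 2 comes from the two partial derivatives; the norm on pairs is the maximum. *)
Lemma Ck_bounded_lipschitz k F M x y : Ck_bounded k.+1 F M ->
  `|F x - F y| <= 2 * M * `|x - y|.
Proof.
move=> HF; have M0 := Ck_bounded_ge0 HF; move: HF => [FM [dF F1 F2]].
have d v z : derivable F z v by exact: diff_derivable.
have := @directional_lipschitz F (x - y) (2 * M * `|x - y|) y 1 (d _).
rewrite scale1r subrK normr1 mulr1; apply => z.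
rewrite diff_partialE//.
have h1 : `|(x - y).1| <= `|x - y| by rewrite [leRHS]/Num.norm/= le_max lexx.
have h2 : `|(x - y).2| <= `|x - y| by rewrite [leRHS]/Num.norm/= le_max lexx orbT.
rewrite (le_trans (ler_normD _ _))// !normrM.
rewrite (_ : 2 * M * `|x - y| = `|x - y| * M + `|x - y| * M); last by ring.
by apply: lerD; apply: ler_pM => //;
  [exact: (Ck_bounded_sup z F1)|exact: (Ck_bounded_sup z F2)].
Qed.

(* The mean value inequality applied to [F m - F n] makes the difference quotients
   converge uniformly in the increment. *)
Lemma is_derive_limit (F : nat -> R * R -> R) (S S1 : R * R -> R) v (tau : nat -> R) :
  tau n @[n --> \oo] --> 0 ->
  (forall n x, derivable (F n) x v) ->
  (forall n m x, (n <= m)%N -> `|'D_v (F m) x - 'D_v (F n) x| <= tau n) ->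
  (forall x, F n x @[n --> \oo] --> S x) ->
  (forall x, 'D_v (F n) x @[n --> \oo] --> S1 x) ->
  forall x, is_derive x v S (S1 x).
Proof.
move=> tau0 dF dFt FS DS x.
have S1t n y : `|S1 y - 'D_v (F n) y| <= tau n.
  apply: (@cvgr_to_le _ \oo _ _ (fun m => `|'D_v (F m) y - 'D_v (F n) y|)).
    by apply: cvg_norm; apply: cvgB => //; exact: cvg_cst.
  by exists n => // m /= nm; exact: dFt nm.
have St n h : `|(S (h *: v + x) - F n (h *: v + x)) - (S x - F n x)| <= tau n * `|h|.
  apply: (@cvgr_to_le _ \oo _ _ (fun m => `|(F m (h *: v + x) - F n (h *: v + x)) - (F m x - F n x)|)).
    by apply: cvg_norm; apply: cvgB => //; (apply: cvgB; [exact: FS|exact: cvg_cst]).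
  exists n => // m /= nm.
  apply: (@directional_lipschitz (fun y => F m y - F n y)) => y.
    exact: derivableB.
  by rewrite deriveB//; exact: dFt.
have key : (fun h => h^-1 *: ((S \o shift x) (h *: v) - S x)) @ 0^' --> S1 x.
  apply/cvgrPdist_le => /= e e0.
  have e3 : 0 < e / 3 by rewrite divr_gt0.
  have [n tn] : exists n, tau n <= e / 3.
    have /cvgrPdist_le /(_ _ e3) [n _ /(_ n (leqnn n))] := tau0.
    rewrite sub0r normrN => /= H; exists n.
    exact: le_trans (ler_norm _) H.
  have := dF n x; rewrite /derivable => /cvg_ex[l hl].
  have El : l = 'D_v (F n) x by apply/esym/cvg_lim.
  have /cvgrPdist_le /(_ _ e3) H := hl.
  near=> h.
  have h0 : h != 0 by near: h; exact: nbhs_dnbhs_neq.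
  have Hh : `|l - h^-1 *: ((F n \o shift x) (h *: v) - F n x)| <= e / 3.
    by near: h.
  set A := h^-1 *: _.
  have -> : S1 x - A = (S1 x - 'D_v (F n) x) +
     (l - h^-1 *: ((F n \o shift x) (h *: v) - F n x)) -
     h^-1 * ((S (h *: v + x) - F n (h *: v + x)) - (S x - F n x)).
    by rewrite /A /= /GRing.scale/= El; ring.
  rewrite [leRHS](_ : _ = e / 3 + e / 3 + e / 3); last by field.
  rewrite (le_trans (ler_normB _ _))// lerD//.
    rewrite (le_trans (ler_normD _ _))// lerD//.
    exact: le_trans (S1t n x) tn.
  rewrite normrM normfV mulrC ler_pdivrMr ?normr_gt0//.
  by rewrite (le_trans (St n h))// ler_wpM2r.
apply: DeriveDef; first by apply/cvg_ex; exists (S1 x).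
by apply: cvg_lim.
Unshelve. all: by end_near. Qed.

End mean_value.

(** * Smoothness of uniform limits *)

Section smooth_limits.
Context {R : realType}.
Implicit Types (F G : R * R -> R) (k : nat) (M N : R).
Notation e1 := ((1 : R), (0 : R)).
Notation e2 := ((0 : R), (1 : R)).
Notation half := (2^-1 : R).

Lemma geometric_tail (u : nat -> R) : (forall j, `|u j.+1 - u j| <= half ^+ j) ->
  forall n m, (n <= m)%N -> `|u m - u n| <= 2 * half ^+ n.
Proof.
move=> hu n m nm.
(* Subtracting the tail at [m] makes the induction on [m] close. *)
suff : `|u m - u n| <= 2 * half ^+ n - 2 * half ^+ m.
  move=> /le_trans; apply; rewrite lerBlDr lerDl mulr_ge0// exprn_ge0//.
elim: m nm => [|m IH].
  by rewrite leqn0 => /eqP ->; rewrite !subrr normr0.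
rewrite leq_eqVlt => /predU1P[->|]; first by rewrite !subrr normr0.
rewrite ltnS => /IH {}IH.
rewrite (_ : u m.+1 - u n = (u m.+1 - u m) + (u m - u n)); last by ring.
rewrite (le_trans (ler_normD _ _))// (le_trans (lerD (hu m) IH))//.
by rewrite exprS -subr_ge0 [X in 0 <= X](_ : _ = 0)//; field.
Qed.

Lemma half_cvg0 : (2 * half ^+ n) @[n --> \oo] --> (0 : R).
Proof.
rewrite -[X in _ --> X](mulr0 2); apply: cvgM; first exact: cvg_cst.
by apply: cvg_expr; rewrite ger0_norm ?invr_ge0// invf_lt1// ltr1n.
Qed.

Lemma geometric_cvg (u : nat -> R) : (forall j, `|u j.+1 - u j| <= half ^+ j) ->
  cvg (u n @[n --> \oo]).
Proof.
move=> hu; apply: cauchy_cvg; apply: cauchy_exP => e e0.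
have /cvgrPdist_lt /(_ _ e0) [n _ /(_ n (leqnn n))] := half_cvg0.
rewrite sub0r normrN => /= ne; exists (u n), n => // m /= nm.
rewrite /ball/= distrC; apply: le_lt_trans ne.
exact: le_trans (geometric_tail hu nm) (ler_norm _).
Qed.

Lemma geometric_tail_lim (u : nat -> R) (l : R) :
  (forall j, `|u j.+1 - u j| <= half ^+ j) -> u n @[n --> \oo] --> l ->
  forall n, `|l - u n| <= 2 * half ^+ n.
Proof.
move=> hu ul n; apply: (@cvgr_to_le _ \oo _ _ (fun m => `|u m - u n|)).
  by apply: cvg_norm; apply: cvgB => //; exact: cvg_cst.
by exists n => // m /= nm; exact: geometric_tail.
Qed.

Lemma geometric_continuous (T : topologicalType) (F : nat -> T -> R) (S : T -> R) :
  (forall j x, `|F j.+1 x - F j x| <= half ^+ j) ->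
  (forall j, continuous (F j)) -> (forall x, F n x @[n --> \oo] --> S x) ->
  continuous S.
Proof.
move=> hF cF FS x; apply/cvgrPdist_le => /= e e0.
have e3 : 0 < e / 3 by rewrite divr_gt0.
have /cvgrPdist_le /(_ _ e3) [n _ /(_ n (leqnn n))] := half_cvg0.
rewrite sub0r normrN => /= ne.
have tn y : `|S y - F n y| <= e / 3.
  apply: le_trans (geometric_tail_lim (fun j => hF j y) (FS y) n) _.
  exact: le_trans (ler_norm _) ne.
have /cvgrPdist_le /(_ _ e3) := cF n x; apply: filterS => y Hy.
rewrite (_ : S x - S y = (S x - F n x) + (F n x - F n y) - (S y - F n y)); last by ring.
rewrite [leRHS](_ : _ = e / 3 + e / 3 + e / 3); last by field.
rewrite (le_trans (ler_normB _ _))// lerD//.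
by rewrite (le_trans (ler_normD _ _))// lerD.
Qed.

(** Shaped after [continuously_differentiable], so that the two coordinates of a map can be treated
    separately. *)
Fixpoint Ck k F : Prop :=
  match k with
  | 0 => continuous F
  | k'.+1 => forall v, v = e1 \/ v = e2 ->
     (forall x, derivable F x v) /\ Ck k' ('D_v F)
  end.

(** One order more is assumed than is obtained: at order 0 it makes every [F j] differentiable,
    hence continuous, and at higher orders the uniform convergence of the derivatives allows limit
    and derivative to be exchanged. *)
Lemma Ck_limit k (F : nat -> R * R -> R) (S : R * R -> R) M :
  (forall j, Ck_bounded k.+1 (fun x => F j.+1 x - F j x) (half ^+ j)) ->
  Ck_bounded k.+1 (F 0%N) M -> (forall x, F n x @[n --> \oo] --> S x) -> Ck k S.
Proof.
elim: k F S => [|k IH] F S hF F0 FS.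
  apply: (@geometric_continuous _ F) => // [j x|j x].
    exact: Ck_bounded_sup (hF j).
  apply: differentiable_continuous; elim: j => [|j IHj].
    by case: F0 => _ [+ _ _]; exact.
  rewrite (_ : F j.+1 = (fun x => F j.+1 x - F j x) + F j); last first.
    by apply/funext => y /=; rewrite [RHS]subrK.
  by apply: differentiableD => //; case: (hF j) => _ [+ _ _]; exact.
have dF j x : differentiable (F j) x.
  elim: j => [|j IHj]; first by case: F0 => _ [+ _ _]; exact.
  rewrite (_ : F j.+1 = (fun x => F j.+1 x - F j x) + F j); last first.
    by apply/funext => y /=; rewrite [RHS]subrK.
  by apply: differentiableD => //; case: (hF j) => _ [+ _ _]; exact.
move=> v ev.
have hD j : Ck_bounded k.+1 (fun x => 'D_v (F j.+1) x - 'D_v (F j) x) (half ^+ j).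
  have -> : (fun x => 'D_v (F j.+1) x - 'D_v (F j) x) = 'D_v (fun x => F j.+1 x - F j x).
    by apply/funext => x; rewrite -deriveB//; exact: diff_derivable.
  by case: (hF j) => _ [_ H1 H2]; case: ev => ->; [exact: H1|exact: H2].
have hD0 : Ck_bounded k.+1 ('D_v (F 0%N)) M.
  by case: F0 => _ [_ H1 H2]; case: ev => ->; [exact: H1|exact: H2].
have hDx x j : `|'D_v (F j.+1) x - 'D_v (F j) x| <= half ^+ j.
  exact: (Ck_bounded_sup x (hD j)).
pose S1 x := lim ('D_v (F n) x @[n --> \oo]).
have DS x : 'D_v (F n) x @[n --> \oo] --> S1 x by exact: geometric_cvg (hDx x).
have isD := @is_derive_limit R F S S1 v (fun n => 2 * half ^+ n) half_cvg0
  (fun n x => diff_derivable (dF n x)) (fun n m x => geometric_tail (hDx x) (m := m) (n := n)) FS DS.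
split; first by move=> x; have [] := isD x.
have -> : 'D_v S = S1 by apply/funext => x; have [_] := isD x.
exact: IH (fun n => 'D_v (F n)) S1 hD hD0 DS.
Qed.

Lemma CkD k F G : Ck k F -> Ck k G -> Ck k (fun x => F x + G x).
Proof.
elim: k F G => [|k IH] F G; first by move=> cF cG x; exact: cvgD (cF x) (cG x).
move=> HF HG v ev; have [dF F1] := HF v ev; have [dG G1] := HG v ev.
split; first by move=> x; exact: derivableD.
have -> : 'D_v (fun x => F x + G x) = fun x => 'D_v F x + 'D_v G x.
  by apply/funext => x; rewrite -deriveD.
exact: IH.
Qed.

Lemma Ck_cst k (c : R) : Ck k (fun=> c).
Proof.
elim: k c => [|k IH] c; first by move=> x; exact: cvg_cst.
move=> v _; split; first by move=> x; exact: derivable_cst.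
by have -> : 'D_v (fun _ : R * R => c) = (fun=> 0) by apply/funext => x; exact: derive_cst.
Qed.

Lemma Ck_fst k : Ck k (fun z : R * R => z.1).
Proof.
case: k => [|k]; first by move=> x; exact: cvg_fst.
move=> v _; split; first by move=> x; exact: diff_derivable (differentiable_fst _).
have -> : 'D_v (fun z : R * R => z.1) = (fun=> v.1).
  by apply/funext => x; exact: derive_fst.
exact: Ck_cst.
Qed.

Lemma Ck_snd k : Ck k (fun z : R * R => z.2).
Proof.
case: k => [|k]; first by move=> x; exact: cvg_snd.
move=> v _; split; first by move=> x; exact: diff_derivable (differentiable_snd _).
have -> : 'D_v (fun z : R * R => z.2) = (fun=> v.2).
  by apply/funext => x; exact: derive_snd.
exact: Ck_cst.
Qed.

End smooth_limits.

(** * Perturbed translations and cosine waves *)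

Section waves.
Context {R : realType}.
Implicit Types (F G : R * R -> R) (k : nat) (M N : R).
Notation e1 := ((1 : R), (0 : R)).
Notation e2 := ((0 : R), (1 : R)).

(** A derivative of the difference splits into differences of the same form for ['D_w F], to which
    the induction applies, and products of a derivative of the displacement, of size [d], with a
    bounded composite. A difference costs one derivative of [F], hence the order [k.+1]. The bound
    [d <= 1] keeps the composition constant independent of [d]. *)
Lemma Ck_bounded_translate k (t : R) : exists C : R, 1 <= C /\
  forall F M (u1 u2 : R * R -> R) (d : R),
  Ck_bounded k.+1 F M -> Ck_bounded k u1 d -> Ck_bounded k u2 d -> d <= 1 ->
  Ck_bounded k (fun z => F (z.1 + (t + u1 z), z.2 + u2 z) - F (z.1 + t, z.2))
    (C * M * d).
Proof.
elim: k => [|k [C [C1 IH]]].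
  exists 2; split; first by rewrite ler1n.
  move=> F M u1 u2 d HF [u1d _] [u2d _] _; split=> // z.
  rewrite (le_trans (Ck_bounded_lipschitz _ _ HF))//.
  have M0 := Ck_bounded_ge0 HF.
  rewrite ler_wpM2l ?mulr_ge0//.
  have -> : (z.1 + (t + u1 z), z.2 + u2 z) - (z.1 + t, z.2) = (u1 z, u2 z).
    by apply: injective_projections => /=; ring.
  by rewrite [leLHS]/Num.norm/= ge_max u1d u2d.
have [C' [C'1 HC']] := @Ck_bounded_comp R k (`|t| + 1).
exists (2 * C + 2 * 2 ^+ k * C').
have CC : 0 <= C by apply: le_trans C1.
have CC' : 0 <= C' by apply: le_trans C'1.
have p0 : 0 <= 2 * 2 ^+ k * C' by rewrite !mulr_ge0// exprn_ge0.
split; first by nra.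
move=> F M u1 u2 d HF Hu1 Hu2 d1.
have M0 := Ck_bounded_ge0 HF; have d0 := Ck_bounded_ge0 Hu1.
have Hu1' := Ck_boundedW Hu1; have Hu2' := Ck_boundedW Hu2.
have HF2 := Ck_bounded_leq (leqW (leqnSn k)) HF.
have sF z : `|F (z.1 + (t + u1 z), z.2 + u2 z) - F (z.1 + t, z.2)| <= C * M * d.
  exact: (Ck_bounded_sup z (IH F M u1 u2 d (Ck_boundedW HF) Hu1' Hu2' d1)).
move: HF Hu1 Hu2 => [FM [dF F1 F2]] [_ [du1 u11 u12]] [_ [du2 u21 u22]].
have dfst (x : R * R) := differentiable_fst x.
have dsnd (x : R * R) := differentiable_snd x.
have dg1 x : differentiable (fun z : R * R => z.1 + (t + u1 z)) x.
  apply: (@differentiableD _ _ _ (fun z : R * R => z.1) (fun z => t + u1 z)) => //.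
  apply: (@differentiableD _ _ _ (fun=> t) u1) => //.
have dg2 x : differentiable (fun z : R * R => z.2 + u2 z) x.
  exact: (@differentiableD _ _ _ (fun z : R * R => z.2) u2).
have dh1 x : differentiable (fun z : R * R => z.1 + t) x.
  apply: (@differentiableD _ _ _ (fun z : R * R => z.1) (fun=> t)) => //.
have dA x : differentiable (fun z => F (z.1 + (t + u1 z), z.2 + u2 z)) x.
  apply: (@differentiable_comp _ _ _ _ (fun z => (z.1 + (t + u1 z), z.2 + u2 z)) F) => //.
  exact: differentiable_pair.
have dB x : differentiable (fun z => F (z.1 + t, z.2)) x.
  apply: (@differentiable_comp _ _ _ _ (fun z => (z.1 + t, z.2)) F) => //.
  exact: differentiable_pair.
have E1 v x : 'D_v (fun z => F (z.1 + (t + u1 z), z.2 + u2 z)) x =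
   (v.1 + 'D_v u1 x) * ('D_e1 F) (x.1 + (t + u1 x), x.2 + u2 x) +
   (v.2 + 'D_v u2 x) * ('D_e2 F) (x.1 + (t + u1 x), x.2 + u2 x).
  rewrite (@derive_comp_pair _ F (fun z : R * R => z.1 + (t + u1 z)) (fun z : R * R => z.2 + u2 z) x v)//.
  rewrite (@deriveD _ _ _ (fun z : R * R => z.2) u2)//;
    [|exact: diff_derivable|exact: diff_derivable].
  have -> : (fun z : R * R => z.1 + (t + u1 z)) = (fun z => (z.1 + u1 z) + t).
    by apply/funext => z; rewrite addrCA addrC.
  rewrite (@deriveD _ _ _ (fun z : R * R => z.1 + u1 z) (fun=> t));
    [|apply: diff_derivable; exact: (@differentiableD _ _ _ (fun z : R * R => z.1) u1)|exact: derivable_cst].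
  rewrite (@deriveD _ _ _ (fun z : R * R => z.1) u1)//;
    [|exact: diff_derivable|exact: diff_derivable].
  by rewrite derive_fst derive_snd derive_cst addr0.
have E2 v x : 'D_v (fun z => F (z.1 + t, z.2)) x =
   v.1 * ('D_e1 F) (x.1 + t, x.2) + v.2 * ('D_e2 F) (x.1 + t, x.2).
  rewrite (@derive_comp_pair _ F (fun z : R * R => z.1 + t) (fun z : R * R => z.2) x v)//.
  rewrite (@deriveD _ _ _ (fun z : R * R => z.1) (fun=> t));
    [|exact: diff_derivable|exact: derivable_cst].
  by rewrite derive_fst derive_snd derive_cst addr0.
pose P (w : R * R) (x : R * R) := ('D_w F) (x.1 + (t + u1 x), x.2 + u2 x) - ('D_w F) (x.1 + t, x.2).
pose Q (w : R * R) (x : R * R) := ('D_w F) (x.1 + (t + u1 x), x.2 + u2 x).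
have HP w : Ck_bounded k.+1 ('D_w F) M -> Ck_bounded k (P w) (C * M * d).
  by move=> Hw; exact: (IH ('D_w F)).
have HQ w : Ck_bounded k.+1 ('D_w F) M -> Ck_bounded k (Q w) (C' * M).
  move=> /Ck_boundedW Hw; apply: (HC' ('D_w F) M (fun x => t + u1 x) u2) => //.
    apply: Ck_boundedD; first exact: Ck_bounded_cst.
    exact: Ck_bounded_le Hu1'.
  by apply: Ck_bounded_le Hu2'; rewrite (le_trans d1)// lerDr.
have E v : 'D_v (fun z => F (z.1 + (t + u1 z), z.2 + u2 z) - F (z.1 + t, z.2)) = fun x =>
   (v.1 * P e1 x + v.2 * P e2 x) + ('D_v u1 x * Q e1 x + 'D_v u2 x * Q e2 x).
  apply/funext => x.
  rewrite (@deriveB _ _ _ (fun z => F (z.1 + (t + u1 z), z.2 + u2 z)) (fun z => F (z.1 + t, z.2)));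
    [|exact: diff_derivable|exact: diff_derivable].
  rewrite E1 E2 /P /Q; move: ('D_v u1 x) ('D_v u2 x) => a b.
  move: (derive F _ e1) (derive F _ e2) (derive F _ e1) (derive F _ e2) => p q r s.
  by ring.
have fin : C * M * d <= (2 * C + 2 * 2 ^+ k * C') * M * d.
  rewrite ler_wpM2r// ler_wpM2r//; lra.
have key v : Ck_bounded k (fun x => v.1 * P e1 x + v.2 * P e2 x) (C * M * d) ->
    Ck_bounded k ('D_v u1) d -> Ck_bounded k ('D_v u2) d ->
    Ck_bounded k ('D_v (fun z => F (z.1 + (t + u1 z), z.2 + u2 z) - F (z.1 + t, z.2)))
      ((2 * C + 2 * 2 ^+ k * C') * M * d).
  move=> HPv Hv1 Hv2; rewrite E.
  apply: (@Ck_bounded_le _ _ _ (C * M * d + (2 ^+ k * (d * (C' * M)) + 2 ^+ k * (d * (C' * M))))).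
    rewrite -subr_ge0 (_ : _ - _ = C * M * d); last by ring.
    by rewrite !mulr_ge0.
  apply: Ck_boundedD => //; apply: Ck_boundedD.
    exact: (@Ck_boundedM _ k ('D_v u1) (Q e1) _ _ Hv1 (HQ _ F1)).
  exact: (@Ck_boundedM _ k ('D_v u2) (Q e2) _ _ Hv2 (HQ _ F2)).
split; first by move=> z; exact: le_trans (sF z) fin.
split.
- by move=> x; apply: (@differentiableB _ _ _ (fun z => F (z.1 + (t + u1 z), z.2 + u2 z)) (fun z => F (z.1 + t, z.2))).
- apply: key => //=.
  have -> : (fun x => 1 * P e1 x + 0 * P e2 x) = P e1.
    by apply/funext => x; rewrite mul1r mul0r addr0.
  exact: (HP _ F1).
- apply: key => //=.
  have -> : (fun x => 0 * P e1 x + 1 * P e2 x) = P e2.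
    by apply/funext => x; rewrite mul1r mul0r add0r.
  exact: (HP _ F2).
Qed.

(** Differentiation multiplies the amplitude and shifts the phase by [pi / 2], so the class is
    closed under partial derivatives and bounds of all orders follow by induction. *)
Definition wave (A c1 c2 phi : R) (z : R * R) := A * cos (c1 * z.1 + c2 * z.2 + phi).

Lemma wave_phase_diff (c1 c2 phi : R) (x : R * R) : differentiable (fun z : R * R => c1 * z.1 + c2 * z.2 + phi) x.
Proof.
apply: (@differentiableD _ _ _ (fun z : R * R => c1 * z.1 + c2 * z.2) (fun=> phi)).
  apply: (@differentiableD _ _ _ (fun z : R * R => c1 * z.1) (fun z : R * R => c2 * z.2)).
    exact: differentiableZ (differentiable_fst _).
  exact: differentiableZ (differentiable_snd _).
exact: differentiable_cst.
Qed.

Lemma differentiable_wave A c1 c2 phi x : differentiable (wave A c1 c2 phi) x.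
Proof.
apply: (@differentiableZ _ _ _ (fun z : R * R => cos (c1 * z.1 + c2 * z.2 + phi)) A).
apply: (@differentiable_comp _ _ _ _ (fun z : R * R => c1 * z.1 + c2 * z.2 + phi) cos).
  exact: wave_phase_diff.
by apply/derivable1_diffP; exact: derivable_cos.
Qed.

Lemma derive_wave A c1 c2 phi v : 'D_v (wave A c1 c2 phi) =
  wave (A * (v.1 * c1 + v.2 * c2)) c1 c2 (phi + pi / 2).
Proof.
apply/funext => x; pose L (z : R * R) := c1 * z.1 + c2 * z.2 + phi.
have dL : differentiable L x by exact: wave_phase_diff.
have dc : differentiable (@cos R) (L x) by apply/derivable1_diffP; exact: derivable_cos.
have DL : 'D_v L x = v.1 * c1 + v.2 * c2.
  rewrite (@deriveD _ _ _ (fun z : R * R => c1 * z.1 + c2 * z.2) (fun=> phi)).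
  - rewrite derive_cst addr0.
    rewrite (@deriveD _ _ _ (fun z : R * R => c1 * z.1) (fun z : R * R => c2 * z.2)).
    + rewrite (@deriveZ _ _ _ (fun z : R * R => z.1)); last exact: diff_derivable (differentiable_fst _).
      rewrite (@deriveZ _ _ _ (fun z : R * R => z.2)); last exact: diff_derivable (differentiable_snd _).
      by rewrite derive_fst derive_snd /GRing.scale/=; ring.
    + apply: diff_derivable; exact: differentiableZ (differentiable_fst _).
    + apply: diff_derivable; exact: differentiableZ (differentiable_snd _).
  - apply: diff_derivable.
    apply: (@differentiableD _ _ _ (fun z : R * R => c1 * z.1) (fun z : R * R => c2 * z.2)).
      exact: differentiableZ (differentiable_fst _).
    exact: differentiableZ (differentiable_snd _).
  - exact: derivable_cst.
rewrite (@deriveZ _ _ _ (cos \o L) A); last exact: diff_derivable (differentiable_comp dL dc).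
rewrite deriveE; last exact: differentiable_comp.
rewrite diff_comp//= -(@deriveE _ _ _ L)// DL.
have [_ Dc] := is_derive_cos (L x).
rewrite deriv1E; last exact: derivable_cos.
rewrite derive1E Dc /wave addrA cosDpihalf -/(L x) /GRing.scale/=; ring.
Qed.

Lemma derive_waveE A c1 c2 phi v x : 'D_v (wave A c1 c2 phi) x =
  wave (A * (v.1 * c1 + v.2 * c2)) c1 c2 (phi + pi / 2) x.
Proof. exact: (congr1 (fun f => f x) (derive_wave A c1 c2 phi v)). Qed.

Lemma Ck_bounded_wave k (A c1 c2 phi C : R) : 1 <= C -> `|c1| <= C -> `|c2| <= C ->
  Ck_bounded k (wave A c1 c2 phi) (`|A| * C ^+ k).
Proof.
move=> C1 h1 h2; elim: k A phi => [|k IH] A phi.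
  by split=> // x; rewrite expr0 mulr1 /wave normrM ler_piMr// cos_max.
split.
  move=> x; rewrite /wave normrM ler_wpM2l//.
  by rewrite (le_trans (cos_max _))// exprn_ege1.
split; first by move=> x; exact: differentiable_wave.
- rewrite derive_wave; apply: Ck_bounded_le (IH _ _).
  rewrite exprS mulrA ler_wpM2r ?exprn_ge0 ?(le_trans _ C1)//.
  by rewrite normrM ler_wpM2l//= mul1r mul0r addr0.
- rewrite derive_wave; apply: Ck_bounded_le (IH _ _).
  rewrite exprS mulrA ler_wpM2r ?exprn_ge0 ?(le_trans _ C1)//.
  by rewrite normrM ler_wpM2l//= mul1r mul0r add0r.
Qed.

Lemma cos_lipschitz (a b : R) : `|cos b - cos a| <= `|b - a|.
Proof.
rewrite -[leRHS]mul1r.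
apply: (@derivable_lipschitz _ cos (fun x => - sin x)) => t.
by rewrite normrN sin_max.
Qed.

(** Differences of phase-shifted waves reproduce themselves under differentiation: the phase gap
    stays [e], and each order costs a factor [C]. *)
Lemma Ck_bounded_wave_shift k (A c1 c2 phi e C : R) : 1 <= C -> `|c1| <= C -> `|c2| <= C ->
  Ck_bounded k (fun z => wave A c1 c2 (phi + e) z - wave A c1 c2 phi z) (`|A| * C ^+ k * `|e|).
Proof.
move=> C1 h1 h2; elim: k A phi => [|k IH] A phi.
  split=> // x; rewrite expr0 mulr1 /wave -mulrBr normrM ler_wpM2l//.
  rewrite (le_trans (cos_lipschitz _ _))// le_eqVlt; apply/orP; left; apply/eqP.
  by congr (`| _ |); ring.
have DE v : 'D_v (fun z => wave A c1 c2 (phi + e) z - wave A c1 c2 phi z) = fun z =>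
  wave (A * (v.1 * c1 + v.2 * c2)) c1 c2 (phi + pi / 2 + e) z -
  wave (A * (v.1 * c1 + v.2 * c2)) c1 c2 (phi + pi / 2) z.
  apply/funext => x.
  rewrite (@deriveB _ _ _ (wave A c1 c2 (phi + e)) (wave A c1 c2 phi));
    [|exact: diff_derivable (differentiable_wave _ _ _ _ _)..].
  by rewrite !derive_waveE addrAC.
split.
  move=> x; rewrite /wave -mulrBr normrM ler_pM ?normr_ge0//.
    by rewrite ler_peMr// exprn_ege1.
  rewrite (le_trans (cos_lipschitz _ _))// le_eqVlt; apply/orP; left; apply/eqP.
  by congr (`| _ |); ring.
have key v : `|v.1 * c1 + v.2 * c2| <= C -> Ck_bounded k ('D_v (fun z => wave A c1 c2 (phi + e) z - wave A c1 c2 phi z))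
   (`|A| * C ^+ k.+1 * `|e|).
  move=> hv; rewrite DE; apply: Ck_bounded_le (IH _ _).
  rewrite ler_wpM2r// exprS mulrA ler_wpM2r ?exprn_ge0 ?(le_trans _ C1)//.
  by rewrite normrM ler_wpM2l.
split.
- move=> x; apply: (@differentiableB _ _ _ (wave A c1 c2 (phi + e)) (wave A c1 c2 phi));
  exact: differentiable_wave.
- by apply: key; rewrite /= mul1r mul0r addr0.
- by apply: key; rewrite /= mul1r mul0r add0r.
Qed.

End waves.

(** * Expectation of bounded measurable functions *)

(** A class closed under the operations used and integrable for every probability, which keeps
    integrability conditions out of the estimates. *)
Definition bounded_mfun d (X : measurableType d) (R : realType) (f : X -> R) : Prop :=
  measurable_fun [set: X] f /\ exists M : R, forall x, `|f x| <= M.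

Section bounded_mfun.
Context d (X : measurableType d) (R : realType).
Implicit Types (f g : X -> R).

Lemma bounded_mfun_cst (c : R) : bounded_mfun (fun _ : X => c).
Proof. by split; [exact: measurable_cst|exists `|c|]. Qed.

Lemma bounded_mfunD f g : bounded_mfun f -> bounded_mfun g ->
  bounded_mfun (fun x => f x + g x).
Proof.
move=> [mf [M fM]] [mg [N gN]]; split; first exact: measurable_funD.
by exists (M + N) => x; rewrite (le_trans (ler_normD _ _))// lerD.
Qed.

Lemma bounded_mfunN f : bounded_mfun f -> bounded_mfun (fun x => - f x).
Proof.
move=> [mf [M fM]]; split; first exact: measurableT_comp.
by exists M => x; rewrite normrN.
Qed.

Lemma bounded_mfunB f g : bounded_mfun f -> bounded_mfun g ->
  bounded_mfun (fun x => f x - g x).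
Proof. by move=> bf bg; apply: bounded_mfunD => //; exact: bounded_mfunN. Qed.

Lemma bounded_mfunM f g : bounded_mfun f -> bounded_mfun g ->
  bounded_mfun (fun x => f x * g x).
Proof.
move=> [mf [M fM]] [mg [N gN]]; split; first exact: measurable_funM.
by exists (M * N) => x; rewrite normrM ler_pM.
Qed.

Lemma bounded_mfunZ (c : R) f : bounded_mfun f -> bounded_mfun (fun x => c * f x).
Proof. by move=> bf; apply: bounded_mfunM => //; exact: bounded_mfun_cst. Qed.

Lemma bounded_mfun_norm f : bounded_mfun f -> bounded_mfun (fun x => `|f x|).
Proof.
move=> [mf [M fM]]; split; first exact: measurableT_comp.
by exists M => x; rewrite normr_id.
Qed.

Lemma bounded_mfun_sum n (f : nat -> X -> R) : (forall i, bounded_mfun (f i)) ->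
  bounded_mfun (fun x => \sum_(i < n) f i x).
Proof.
move=> bf; elim: n => [|n IH].
  by under eq_fun do rewrite big_ord0; exact: bounded_mfun_cst.
by under eq_fun do rewrite big_ord_recr/=; exact: bounded_mfunD.
Qed.

Lemma bounded_mfun_indic (A : set X) : measurable A -> bounded_mfun (\1_A : X -> R).
Proof.
move=> mA; split; first exact: measurable_indic.
by exists 1 => x; rewrite indicE; case: (x \in A); rewrite ?normr1 ?normr0.
Qed.

End bounded_mfun.

Lemma bounded_mfun_comp d d' (X : measurableType d) (Y : measurableType d')
    (R : realType) (f : Y -> R) (T : X -> Y) :
  bounded_mfun f -> measurable_fun [set: X] T -> bounded_mfun (fun x => f (T x)).
Proof.
move=> [mf [M fM]] mT; split; first exact: (measurableT_comp mf mT).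
by exists M => x.
Qed.

Section expect.
Context d (X : measurableType d) (R : realType) (P : probability X R).
Implicit Types (f g : X -> R).

Definition expect f : R := (\int[P]_x f x)%R.

Lemma bounded_mfun_integrable f : bounded_mfun f -> P.-integrable setT (EFin \o f).
Proof.
move=> [mf [M fM]]; apply: measurable_bounded_integrable => //.
  by rewrite /= probability_setT ltry.
exists M; split; first by rewrite num_real.
by move=> N MN x _ /=; rewrite (le_trans (fM x))// ltW.
Qed.

Lemma expect_cst (c : R) : expect (fun=> c) = c.
Proof. by rewrite /expect Rintegral_cst//= probability_setT mulr1. Qed.

Lemma expectD f g : bounded_mfun f -> bounded_mfun g ->
  expect (fun x => f x + g x) = expect f + expect g.
Proof. by move=> bf bg; apply: RintegralD => //; exact: bounded_mfun_integrable. Qed.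

Lemma expectB f g : bounded_mfun f -> bounded_mfun g ->
  expect (fun x => f x - g x) = expect f - expect g.
Proof. by move=> bf bg; apply: RintegralB => //; exact: bounded_mfun_integrable. Qed.

Lemma expectZ (c : R) f : bounded_mfun f -> expect (fun x => c * f x) = c * expect f.
Proof. by move=> bf; apply: RintegralZl => //; exact: bounded_mfun_integrable. Qed.

Lemma expect_sum n (f : nat -> X -> R) : (forall i, bounded_mfun (f i)) ->
  expect (fun x => \sum_(i < n) f i x) = \sum_(i < n) expect (f i).
Proof.
move=> bf; elim: n => [|n IH].
  by under eq_fun do rewrite big_ord0; rewrite expect_cst big_ord0.
under eq_fun do rewrite big_ord_recr/=; rewrite big_ord_recr/= -IH.
by apply: expectD => //; exact: bounded_mfun_sum.
Qed.

Lemma expect_le f g : bounded_mfun f -> bounded_mfun g ->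
  (forall x, f x <= g x) -> expect f <= expect g.
Proof. by move=> bf bg fg; apply: le_Rintegral => //; exact: bounded_mfun_integrable. Qed.

Lemma expect_ge0 f : (forall x, 0 <= f x) -> 0 <= expect f.
Proof. by move=> f0; exact: Rintegral_ge0. Qed.

Lemma expect_norm f : bounded_mfun f -> `|expect f| <= expect (fun x => `|f x|).
Proof. by move=> bf; apply: le_normr_Rintegral => //; exact: bounded_mfun_integrable. Qed.

Lemma expect_bound f (c : R) : bounded_mfun f -> (forall x, `|f x| <= c) ->
  `|expect f| <= c.
Proof.
move=> bf fc; rewrite (le_trans (expect_norm bf))// -[leRHS]expect_cst.
apply: expect_le => //; first exact: bounded_mfun_norm.
exact: bounded_mfun_cst.
Qed.

Lemma expect_dist f g (c : R) : bounded_mfun f -> bounded_mfun g ->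
  (forall x, `|f x - g x| <= c) -> `|expect f - expect g| <= c.
Proof.
by move=> bf bg fg; rewrite -expectB//; apply: expect_bound => //; exact: bounded_mfunB.
Qed.

Lemma expect_indic (A : set X) : measurable A -> expect \1_A = fine (P A).
Proof.
by move=> mA; rewrite /expect /Rintegral integral_indic// setIT.
Qed.

End expect.

Lemma expect_comp d d' (X : measurableType d) (Y : measurableType d')
    (R : realType) (P : probability X R) (Q : probability Y R) (T : X -> Y) (f : Y -> R) :
  measurable_fun [set: X] T ->
  (forall A, measurable A -> P (T @^-1` A) = Q A) -> bounded_mfun f ->
  expect P (fun x => f (T x)) = expect Q f.
Proof.
move=> mT PQ bf; rewrite /expect /Rintegral; congr fine.
transitivity (\int[pushforward P T]_y (f y)%:E)%E.
  rewrite integral_pushforward//=.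
    by case: bf => mf _; exact/measurable_EFinP.
  exact: (@bounded_mfun_integrable _ _ _ P (fun x => f (T x)) (bounded_mfun_comp bf mT)).
by apply: eq_measure_integral => A mA _; exact: PQ.
Qed.

Section expect_fubini.
Context d d' (X : measurableType d) (Y : measurableType d') (R : realType).
Variables (P : probability X R) (Q : probability Y R) (f : X * Y -> R).
Hypothesis bf : bounded_mfun f.

Let mf : measurable_fun setT f := bf.1.

Lemma bounded_mfun_pair1 x : bounded_mfun (fun y => f (x, y)).
Proof.
split; first exact: measurable_fun_pair2.
by case: bf => _ [M fM]; exists M => y.
Qed.

Lemma bounded_mfun_pair2 y : bounded_mfun (fun x => f (x, y)).
Proof.
split; first exact: measurable_fun_pair1.
by case: bf => _ [M fM]; exists M => x.
Qed.

Let PQ := (P \x Q)%E.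

Let intf : PQ.-integrable setT (EFin \o f).
Proof.
have [_ [M fM]] := bf.
apply: measurable_bounded_integrable => //.
  have := @product_measure1E _ _ _ _ _ P Q _ _ (@measurableT _ X) (@measurableT _ Y).
  by rewrite setXTT /PQ /= => ->; rewrite !probability_setT mule1 ltry.
exists M; split; first by rewrite num_real.
by move=> N MN x _ /=; rewrite (le_trans (fM x))// ltW.
Qed.

Lemma expect_EFin1 x : (expect Q (fun y => f (x, y)))%:E = (\int[Q]_y (f (x, y))%:E)%E.
Proof.
rewrite /expect /Rintegral fineK//; apply: integrable_fin_num => //.
exact: bounded_mfun_integrable (bounded_mfun_pair1 x).
Qed.

Lemma expect_EFin2 y : (expect P (fun x => f (x, y)))%:E = (\int[P]_x (f (x, y))%:E)%E.
Proof.
rewrite /expect /Rintegral fineK//; apply: integrable_fin_num => //.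
exact: bounded_mfun_integrable (bounded_mfun_pair2 y).
Qed.

Lemma bounded_mfun_expect1 : bounded_mfun (fun x => expect Q (fun y => f (x, y))).
Proof.
split; last first.
  case: bf => _ [M fM]; exists M => x; apply: expect_bound => //.
  exact: bounded_mfun_pair1.
apply/measurable_EFinP; have := @measurable_fubini_F _ _ _ _ _ P Q (EFin \o f) intf.
by apply: eq_measurable_fun => x _; rewrite /= expect_EFin1.
Qed.

Lemma bounded_mfun_expect2 : bounded_mfun (fun y => expect P (fun x => f (x, y))).
Proof.
split; last first.
  case: bf => _ [M fM]; exists M => x; apply: expect_bound => //.
  exact: bounded_mfun_pair2.
apply/measurable_EFinP; have := @measurable_fubini_G _ _ _ _ _ P Q (EFin \o f) intf.
by apply: eq_measurable_fun => x _; rewrite /= expect_EFin2.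
Qed.

Lemma expect_fubini : expect P (fun x => expect Q (fun y => f (x, y))) =
  expect Q (fun y => expect P (fun x => f (x, y))).
Proof.
rewrite {1}/expect {2}/expect /Rintegral; congr fine.
under eq_integral do rewrite expect_EFin1.
under [RHS]eq_integral do rewrite expect_EFin2.
exact: (@Fubini _ _ _ _ _ P Q (EFin \o f) intf).
Qed.

End expect_fubini.

(** * Area-preserving maps of the plane *)

Section shears.
Context {R : realType}.
Notation lambda := (@lebesgue_measure R).
Local Notation R2 := (measurableTypeR R * measurableTypeR R)%type.

Lemma lebesgue_measure_shift (c : R) (A : set R) : measurable A ->
  lambda [set x | A (x + c)] = lambda A.
Proof.
move=> mA.
have mc : measurable_fun setT (fun x : measurableTypeR R => (x + c : measurableTypeR R)).
  by apply: measurable_funD => //; exact: measurable_cst.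
apply/esym; apply: (@lebesgue_measure_unique R
  (pushforward lambda (fun x : measurableTypeR R => (x + c : measurableTypeR R)))) => //.
move=> _ [[a b]] _ <-.
rewrite /pushforward /=.
rewrite [X in _ = lambda X](_ : _ = `]a - c, b - c]%classic); last first.
  apply/seteqP; split => x /=; rewrite !in_itv/= => /andP[h1 h2]; apply/andP; split; lra.
rewrite !lebesgue_measure_itv/= !lte_fin.
have -> : (a - c < b - c) = (a < b) by rewrite ltrD2r.
by case: ifP => // _; rewrite -!EFinB; congr EFin; ring.
Qed.

Notation I := (`[0, 1[%classic : set R).

Lemma measurable_shift (c : R) (A : set R) : measurable A -> measurable [set x | A (x + c)].
Proof.
move=> mA.
have mc : measurable_fun setT (fun x : measurableTypeR R => (x + c : measurableTypeR R)).
  by apply: measurable_funD => //; exact: measurable_cst.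
by have := mc measurableT _ mA; rewrite setTI.
Qed.

(** Modulo integers the shift is by [c'] in [0, 1): it exchanges the pieces of the unit interval on
    both sides of [c'], each moved by a translation. *)
Lemma periodic_shift_measure (c : R) (E : set R) : measurable E ->
  (forall y m, m \is a Num.int -> E (y + m) = E y) ->
  lambda ([set y | E (y + c)] `&` I) = lambda (E `&` I).
Proof.
move=> mE pE.
pose m : R := (Num.floor c)%:~R; pose c' := c - m.
have mi : m \is a Num.int by exact: intr_int.
have c'0 : 0 <= c' by rewrite subr_ge0; exact: floor_le_tmp.
have c'1 : c' < 1.
  by rewrite ltrBlDl; have := floorD1_gt c; rewrite intrD /m.
have -> : [set y | E (y + c)] = [set y | E (y + c')].
  apply/funext => y /=; rewrite -[in RHS](pE _ _ mi); congr (E _); rewrite /c'; ring.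
pose J1 := (`[c', 1[%classic : set R); pose J2 := (`[0, c'[%classic : set R).
have mJ1 : measurable (E `&` J1) by apply: measurableI => //; exact: measurable_itv.
have mJ2 : measurable (E `&` J2) by apply: measurableI => //; exact: measurable_itv.
have -> : [set y | E (y + c')] `&` I =
    [set y | (E `&` J1) (y + c')] `|` [set y | (E `&` J2) (y + (c' - 1))].
  have pm : forall y, E (y + (c' - 1)) = E (y + c').
    move=> y; rewrite -[in RHS](pE _ (-1)) ?rpredN ?rpred1//; congr (E _); ring.
  apply/seteqP; split => y /=; rewrite /J1 /J2 /=.
    move=> [Ey]; rewrite in_itv/= => /andP[y0 y1].
    have [h|h] := ltP (y + c') 1.
      by left; split => //; rewrite in_itv/=; apply/andP; split => //; lra.
    by right; rewrite pm; split => //; rewrite in_itv/=; apply/andP; split; lra.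
  rewrite pm => -[[Ey]|[Ey]]; rewrite !in_itv/= => /andP[y0 y1]; split => //;
  by apply/andP; split; lra.
rewrite measureU; [|exact: measurable_shift|exact: measurable_shift|]; last first.
  rewrite -subset0 => y /= [[_ +] [_ +]]; rewrite /J1 /J2 /= !in_itv/=.
  move=> /andP[h1 h2] /andP[h3 h4]; lra.
rewrite [X in (X + _)%E](lebesgue_measure_shift c' mJ1).
rewrite [X in (_ + X)%E](lebesgue_measure_shift (c' - 1) mJ2) -measureU//; last first.
  rewrite -subset0 => y /= [[_ +] [_ +]]; rewrite /J1 /J2 /= !in_itv/=.
  move=> /andP[h1 h2] /andP[h3 h4]; lra.
congr (lambda _); rewrite -setIUr; congr (_ `&` _).
apply/seteqP; split => y /=; rewrite /J1 /J2 /= !in_itv/=.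
  by move=> [] /andP[h1 h2]; apply/andP; split; lra.
move=> /andP[h1 h2]; have [h|h] := leP c' y; [left|right]; apply/andP; split; lra.
Qed.

(** A probability on the plane whose image under [torus_proj] is [torus_measure]; integrals over the
    torus are computed on lifts. *)
Definition square_measure : set R2 -> \bar R :=
  mrestr (lambda \x lambda)%E (@measurable_unit_square R).

HB.instance Definition _ := Measure.on square_measure.

Lemma square_measure_setT : square_measure setT = 1%E.
Proof. by rewrite -(@torus_measure_setT R) /torus_measure /pushforward preimage_setT. Qed.

HB.instance Definition _ := Measure_isProbability.Build _ _ _
  square_measure square_measure_setT.

Definition lattice_periodic (T : Type) (f : R * R -> T) :=
  forall z l : R * R, int_lattice l -> f (z + l) = f z.

(** Weaker than commuting with the lattice, so as to include the linear shears that conjugate a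
    twist to a vertical shear. *)
Definition lattice_map (F : R * R -> R * R) :=
  forall z l : R * R, int_lattice l -> int_lattice (F (z + l) - F z).

(** Only lattice-periodic sets are tested, because a lift need not map the unit square to itself. *)
Definition square_preserving (F : R * R -> R * R) :=
  measurable_fun [set: R2] (F : R2 -> R2) /\
  forall E : set R2, measurable E -> lattice_periodic E ->
    square_measure (F @^-1` E) = square_measure E.

Lemma lattice_periodic_comp (T : Type) (f : R * R -> T) F :
  lattice_periodic f -> lattice_map F -> lattice_periodic (fun z => f (F z)).
Proof.
move=> pf lF z l hl; rewrite -[F (z + l)](subrK (F z)) addrC.
by rewrite pf//; exact: lF.
Qed.

Lemma square_preserving_comp F G : lattice_map F ->
  square_preserving F -> square_preserving G -> square_preserving (F \o G).
Proof.
move=> lF [mF hF] [mG hG]; split; first exact: measurableT_comp mF mG.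
move=> E mE pE; rewrite -(hF E)// -(hG (F @^-1` E))//.
  by have := mF measurableT _ mE; rewrite setTI.
exact: lattice_periodic_comp.
Qed.

(** Fubini: each vertical section is translated, and the trace of a periodic set on [0, 1) keeps its
    length. *)
Lemma square_preserving_vshear (g : R -> R) : measurable_fun setT g ->
  square_preserving (fun z => (z.1, z.2 + g z.1)).
Proof.
move=> mg.
have mF : measurable_fun [set: R2] ((fun z => (z.1, z.2 + g z.1)) : R2 -> R2).
  apply: measurable_fun_pair; first exact: measurable_fst.
  apply: measurable_funD; first exact: measurable_snd.
  exact: measurableT_comp mg _.
split => // E mE pE.
rewrite /square_measure /mrestr /product_measure1.
apply: eq_integral => x _ /=.
have sx (A : set R2) : xsection (A `&` @unit_square R) x =
    if x \in I then [set y | A (x, y)] `&` I else set0.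
  apply/seteqP; split => y; rewrite /xsection /= inE.
    move=> [Axy [/= xI yI]]; case: ifPn; first by split.
    by move=> /negP; apply; rewrite inE.
  by case: ifPn => //; rewrite inE/= => xI [Axy yI]; split.
rewrite !sx; case: ifPn => // _ /=.
rewrite (@periodic_shift_measure (g x) [set y | E (x, y)])//.
  have := measurable_xsection x mE; congr measurable.
  by apply/seteqP; split => y; rewrite /xsection/= inE.
move=> y m mi /=; rewrite -(pE (x, y) (0, m)); last by rewrite /int_lattice /= rpred0.
by congr (E _); apply: injective_projections => /=; rewrite ?addr0.
Qed.

Lemma square_preserving_hshear (g : R -> R) : measurable_fun setT g ->
  square_preserving (fun z => (z.1 + g z.2, z.2)).
Proof.
move=> mg.
have mF : measurable_fun [set: R2] ((fun z => (z.1 + g z.2, z.2)) : R2 -> R2).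
  apply: measurable_fun_pair; last exact: measurable_snd.
  apply: measurable_funD; first exact: measurable_fst.
  exact: measurableT_comp mg _.
split => // E mE pE.
have mE' : measurable ((fun z => (z.1 + g z.2, z.2)) @^-1` E : set R2).
  by have := mF measurableT _ mE; rewrite setTI.
(* Horizontal sections are needed here, so the product measure is rewritten with the other order of
   integration. *)
have swap (X : set R2) : measurable X -> (lambda \x lambda)%E X = (lambda \x^ lambda)%E X.
  by apply: product_measure_unique => A B mA mB; exact: product_measure2E.
rewrite /square_measure /mrestr !swap; [|exact: measurableI mE (@measurable_unit_square R)
  |exact: measurableI mE' (@measurable_unit_square R)].
rewrite /product_measure2.
apply: eq_integral => y _ /=.
have sy (A : set R2) : ysection (A `&` @unit_square R) y =
    if y \in I then [set x | A (x, y)] `&` I else set0.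
  apply/seteqP; split => x; rewrite /ysection /= inE.
    move=> [Axy [/= xI yI]]; case: ifPn; first by split.
    by move=> /negP; apply; rewrite inE.
  by case: ifPn => //; rewrite inE/= => xI [Axy yI]; split.
rewrite !sy; case: ifPn => // _ /=.
rewrite (@periodic_shift_measure (g y) [set x | E (x, y)])//.
  have := measurable_ysection y mE; congr measurable.
  by apply/seteqP; split => x; rewrite /ysection/= inE.
move=> x m mi /=; rewrite -(pE (x, y) (m, 0)); last by rewrite /int_lattice /= rpred0 andbT.
by congr (E _); apply: injective_projections => /=; rewrite ?addr0.
Qed.

Lemma torus_projP (a b : R * R) :
  (torus_proj a = torus_proj b) <-> int_lattice (a - b).
Proof.
have E := @Quotient.idealrBE (R * R)%type (@int_lattice R) a b.
rewrite -[int_lattice (a - b)]/(a - b \in @int_lattice R) E.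
by split => [H|/eqP//]; apply/eqP.
Qed.

Lemma torus_repr (x : torus R) : exists z, torus_proj z = x.
Proof. by exists (repr x); exact: reprK. Qed.

(** A periodic [f] factors through the torus, where both [torus_proj] and [torus_proj \o F] have the
    law [torus_measure]; only periodic sets enter. *)
Lemma square_expect_comp (f : R2 -> R) F : square_preserving F -> lattice_periodic f ->
  bounded_mfun f -> expect square_measure (fun z => f (F z)) = expect square_measure f.
Proof.
move=> [mF hF] pf [mf [M fM]].
pose pi2 : R2 -> torus R := @torus_proj R.
have mpi : measurable_fun setT pi2 by move=> _ A mA; rewrite setTI.
pose f' : torus R -> R := fun x => f (repr x).
have ff' z : f' (pi2 z) = f z.
  rewrite /f' -[repr _](subrK z) addrC pf//.
  by apply/torus_projP; exact: reprK.
have bf' : bounded_mfun f'.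
  split; last by exists M => x; exact: fM.
  move=> _ A mA; rewrite setTI; rewrite /measurable/= /torus_measurable/=.
  rewrite (_ : _ @^-1` _ = f @^-1` A).
    by have := mf measurableT _ mA; rewrite setTI.
  by apply/seteqP; split => z /=; rewrite -(ff' z).
rewrite (_ : (fun z => f (F z)) = (fun z => f' (pi2 (F z)))); last first.
  by apply/funext => z; rewrite ff'.
rewrite (_ : f = (fun z => f' (pi2 z))) ; last first.
  by apply/funext => z; rewrite ff'.
rewrite (@expect_comp _ _ _ _ _ square_measure (@torus_measure R) pi2)//.
apply: (@expect_comp _ _ _ _ _ square_measure (@torus_measure R) (fun z => pi2 (F z))) => //.
  exact: measurableT_comp mpi mF.
move=> A mA.
have pA : lattice_periodic (pi2 @^-1` A).
  move=> z l hl /=; congr (A _).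
  by apply/torus_projP; rewrite addrC addKr.
rewrite -[RHS](hF (pi2 @^-1` A))//.
Qed.

End shears.

(** * Averages along a cosine *)

Section oscillation.
Context {R : realType}.

Definition unit_prob := uniform_prob (@ltr01 R).
HB.instance Definition _ := Probability.on unit_prob.

Lemma expect_unitZ (c : R) (f : R -> R) : bounded_mfun f ->
  expect unit_prob (fun x => c * f x) = c * expect unit_prob f.
Proof. by move=> bf; apply: (@expectZ _ (measurableTypeR R) _ unit_prob c f); exact: bf. Qed.

Lemma expect_unitD (f g : R -> R) : bounded_mfun f -> bounded_mfun g ->
  expect unit_prob (fun x => f x + g x) = expect unit_prob f + expect unit_prob g.
Proof.
by move=> bf bg; apply: (@expectD _ (measurableTypeR R) _ unit_prob f g); [exact: bf|exact: bg].
Qed.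

Lemma expect_unitB (f g : R -> R) : bounded_mfun f -> bounded_mfun g ->
  expect unit_prob (fun x => f x - g x) = expect unit_prob f - expect unit_prob g.
Proof.
by move=> bf bg; apply: (@expectB _ (measurableTypeR R) _ unit_prob f g); [exact: bf|exact: bg].
Qed.

Lemma expect_unit_le (f g : R -> R) : bounded_mfun f -> bounded_mfun g ->
  (forall x, f x <= g x) -> expect unit_prob f <= expect unit_prob g.
Proof.
by move=> bf bg; apply: (@expect_le _ (measurableTypeR R) _ unit_prob f g); [exact: bf|exact: bg].
Qed.

Lemma expect_unit_bound (f : R -> R) (c : R) : bounded_mfun f -> (forall x, `|f x| <= c) ->
  `|expect unit_prob f| <= c.
Proof. by move=> bf; apply: (@expect_bound _ (measurableTypeR R) _ unit_prob f c); exact: bf. Qed.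

Lemma expect_unit_norm (f : R -> R) : bounded_mfun f ->
  `|expect unit_prob f| <= expect unit_prob (fun x => `|f x|).
Proof. by move=> bf; apply: (@expect_norm _ (measurableTypeR R) _ unit_prob f); exact: bf. Qed.

Lemma continuous_bounded_mfun (f : R -> R) (M : R) : continuous f -> (forall x, `|f x| <= M) ->
  bounded_mfun f.
Proof. by move=> cf fM; split; [exact: continuous_measurable_fun|exists M]. Qed.

Lemma expect_unit (f : R -> R) : bounded_mfun f ->
  expect unit_prob f = (\int[@lebesgue_measure R]_(x in `[0, 1]) f x)%R.
Proof.
move=> bf; have [mf [M fM]] := bf.
have fi : (@lebesgue_measure R).-integrable `[0, 1] (EFin \o f).
  apply: measurable_bounded_integrable => //.
  - by rewrite /= lebesgue_measure_itv/= lte_fin ltr01 oppr0 adde0 ltry.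
  - exact: measurable_funTS.
  exists M; split; first by rewrite num_real.
  by move=> N MN x _ /=; rewrite (le_trans (fM x))// ltW.
have ci : (@lebesgue_measure R).-integrable `[0, 1] (EFin \o (fun=> M)).
  apply: measurable_bounded_integrable => //.
  - by rewrite /= lebesgue_measure_itv/= lte_fin ltr01 oppr0 adde0 ltry.
  exists `|M|; split; first by rewrite num_real.
  by move=> N MN x _ /=; rewrite ltW.
have cM : expect unit_prob (fun=> M) = M by exact: expect_cst.
(* Adding [M] makes the integrand nonnegative, as [integral_uniform] requires; the constant is
   cancelled on both sides. *)
have E : expect unit_prob (fun x => f x + M) = expect unit_prob f + M.
  by rewrite expect_unitD ?cM//; exact: bounded_mfun_cst.
apply: (@addIr _ M); rewrite -E.
transitivity (\int[@lebesgue_measure R]_(x in `[0, 1]) (f x + M))%R; last first.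
  rewrite RintegralD//; congr (_ + _); rewrite Rintegral_cst//=.
  by rewrite lebesgue_measure_itv/= lte_fin ltr01 oppr0 adde0 mulr1.
rewrite /expect /Rintegral; congr fine.
rewrite integral_uniform.
- by rewrite subr0 invr1 mul1e.
- by apply/measurable_EFinP; apply: measurable_funD => //; exact: measurable_cst.
- by move=> x; rewrite lee_fin -lerBlDr sub0r; have := fM x; rewrite ler_norml => /andP[].
Qed.

Lemma expect_derivative (F f : R -> R) : (forall x : R, is_derive x 1 F (f x)) ->
  continuous f -> bounded_mfun f -> expect unit_prob f = F 1 - F 0.
Proof.
move=> dF cf bf; rewrite expect_unit// /Rintegral.
have cF x : {for x, continuous F}.
  by apply: differentiable_continuous; apply/derivable1_diffP; have [] := dF x.
rewrite (@continuous_FTC2 _ f F 0 1 ltr01)//.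
- exact: continuous_subspaceT.
- split; first by move=> x _; have [] := dF x.
  + by apply: cvg_at_right_filter; exact: cF.
  + by apply: cvg_at_left_filter; exact: cF.
- by move=> x _; rewrite derive1E; have [_] := dF x.
Qed.

Lemma antiderivative (f : R -> R) (a : R) : continuous f ->
  exists F : R -> R, forall x, a < x -> is_derive x 1 F (f x).
Proof.
move=> cf; exists (fun x => (\int[@lebesgue_measure R]_(t in `[a, x]) f t)%R) => x ax.
have fi : (@lebesgue_measure R).-integrable `[a, x + 1] (EFin \o f).
  apply: continuous_compact_integrable; first exact: segment_compact.
  exact: continuous_subspaceT.
have xx : x < x + 1 by rewrite ltrDl.
have [d e] := @continuous_FTC1_closed R f a x (x + 1) xx fi ax (cf x).
by apply: DeriveDef; [exact: d|rewrite -derive1E].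
Qed.

Definition cosp (phi s : R) : R := cos (2 * pi * s + phi).
Definition sinp (phi s : R) : R := sin (2 * pi * s + phi).

Lemma is_derive_affine (a b s : R) : is_derive s 1 (fun s : R => a * s + b) a.
Proof.
have -> : (fun s : R => a * s + b) = (cst a * id + cst b) by apply/funext.
apply: is_derive_eq; rewrite /GRing.scale/= /cst; ring.
Qed.

Lemma is_derive_cosp phi (s : R) : is_derive s 1 (cosp phi) (- (2 * pi) * sinp phi s).
Proof.
apply: (@is_derive_eq _ _ _ (cosp phi) s 1 _ (- sinp phi s * (2 * pi))); last by ring.
exact: (@is_derive1_comp _ cos _ s _ _ _ (is_derive_affine (2 * pi) phi s)).
Qed.

Lemma is_derive_sinp phi (s : R) : is_derive s 1 (sinp phi) (2 * pi * cosp phi s).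
Proof.
apply: (@is_derive_eq _ _ _ (sinp phi) s 1 _ (cosp phi s * (2 * pi))); last by ring.
exact: (@is_derive1_comp _ sin _ s _ _ _ (is_derive_affine (2 * pi) phi s)).
Qed.

Lemma is_derive_continuous (F f : R -> R) : (forall x : R, is_derive x 1 F (f x)) -> continuous F.
Proof.
by move=> dF x; apply: differentiable_continuous; apply/derivable1_diffP; have [] := dF x.
Qed.

Lemma continuous_cosp phi : continuous (cosp phi).
Proof. exact: is_derive_continuous (is_derive_cosp phi). Qed.

Lemma cosp1 phi : cosp phi 1 = cosp phi 0.
Proof.
rewrite /cosp mulr0 add0r mulr1 addrC (_ : 2 * pi = pi *+ 2) ?cosD2pi//.
by rewrite mulr_natl.
Qed.

Lemma sinp1 phi : sinp phi 1 = sinp phi 0.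
Proof.
rewrite /sinp mulr0 add0r mulr1 addrC (_ : 2 * pi = pi *+ 2) ?sinD2pi//.
by rewrite mulr_natl.
Qed.

Lemma sinp2 phi s : sinp phi s * sinp phi s = 1 - cosp phi s ^+ 2.
Proof. by rewrite -expr2 sin2cos2. Qed.

Lemma cosp_norm phi s : `|cosp phi s| <= 1. Proof. exact: cos_max. Qed.
Lemma sinp_norm phi s : `|sinp phi s| <= 1. Proof. exact: sin_max. Qed.

Lemma cospX_norm phi s n : `|cosp phi s ^+ n| <= 1.
Proof. by rewrite normrX exprn_ile1// cosp_norm. Qed.

Lemma continuous_cospX phi n : continuous (fun s => cosp phi s ^+ n).
Proof.
move=> x; apply: (@continuous_comp _ _ _ (cosp phi) (fun y : R => y ^+ n)).
  exact: continuous_cosp.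
exact: exprn_continuous.
Qed.

Lemma is_derive_cospX_sinp phi n (s : R) :
  is_derive s 1 (fun s => cosp phi s ^+ n * sinp phi s)
    (2 * pi * (cosp phi s ^+ n.+1 - n%:R * cosp phi s ^+ n.-1 * (1 - cosp phi s ^+ 2))).
Proof.
have dC := is_derive_cosp phi s; have dS := is_derive_sinp phi s.
have -> : (fun s => cosp phi s ^+ n * sinp phi s) = ((cosp phi) ^+ n * sinp phi).
  by apply/funext => x; rewrite /= exprfctE.
apply: is_derive_eq; rewrite /GRing.scale/= exprfctE -sinp2 exprSr; ring.
Qed.

(** A Wallis bound. Integrating the derivative of [cosp ^+ (2 m + 1) sinp] over a period gives
    [(2 m + 1) W m = (2 m + 2) W m.+1], under which [W n ^+ 2 (2 n + 1)] does not increase. *)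
Lemma cosine_moment phi n : expect unit_prob (fun s => cosp phi s ^+ (2 * n)) ^+ 2 * (2 * n + 1)%:R <= 1.
Proof.
pose W n := expect unit_prob (fun s => cosp phi s ^+ (2 * n)).
have bX m : bounded_mfun (fun s => cosp phi s ^+ m).
  by apply: (@continuous_bounded_mfun _ 1); [exact: continuous_cospX|move=> x; exact: cospX_norm].
have W0 m : 0 <= W m.
  by apply: expect_ge0 => x; rewrite exprM exprn_ge0// sqr_ge0.
have rec m : (2 * m + 1)%:R * W m = (2 * m + 2)%:R * W m.+1.
  have E s : 2 * pi * (cosp phi s ^+ (2 * m + 1).+1 - (2 * m + 1)%:R * cosp phi s ^+ (2 * m + 1).-1 * (1 - cosp phi s ^+ 2))
     = 2 * pi * ((2 * m + 2)%:R * cosp phi s ^+ (2 * m.+1)) - 2 * pi * ((2 * m + 1)%:R * cosp phi s ^+ (2 * m)).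
    rewrite addn1 /= (_ : (2 * m.+1)%N = (2 * m).+2)%N; last by rewrite mulnS.
    rewrite -[(2 * m + 2)%N]addSnnS addn1 -[in X in _ = X - _]natr1 !exprS; ring.
  have := @expect_derivative (fun s => cosp phi s ^+ (2 * m + 1) * sinp phi s) _
    (is_derive_cospX_sinp phi (2 * m + 1)).
  rewrite cosp1 sinp1 subrr.
  have bb : bounded_mfun (fun s => 2 * pi * ((2 * m + 2)%:R * cosp phi s ^+ (2 * m.+1)) - 2 * pi * ((2 * m + 1)%:R * cosp phi s ^+ (2 * m))).
    by apply: bounded_mfunB; apply: bounded_mfunZ; exact: bounded_mfunZ.
  have cc : continuous (fun s => 2 * pi * ((2 * m + 2)%:R * cosp phi s ^+ (2 * m.+1)) - 2 * pi * ((2 * m + 1)%:R * cosp phi s ^+ (2 * m))).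
    move=> x; apply: cvgB; (apply: cvgM; first exact: cvg_cst); (apply: cvgM; first exact: cvg_cst);
    exact: (@continuous_cospX phi).
  under eq_fun do rewrite E; move=> /(_ cc bb).
  have b2 a m' : bounded_mfun (fun s => 2 * pi * (a * cosp phi s ^+ m')).
    by do 2 apply: bounded_mfunZ.
  have E2 a m' : expect unit_prob (fun s => 2 * pi * (a * cosp phi s ^+ m')) =
      2 * pi * (a * expect unit_prob (fun s => cosp phi s ^+ m')).
    transitivity (2 * pi * expect unit_prob (fun s => a * cosp phi s ^+ m')).
      exact: (expect_unitZ _ (bounded_mfunZ a (bX m'))).
    by congr (_ * _); exact: (expect_unitZ _ (bX m')).
  have E3 a b m1 m2 : expect unit_prob (fun s => 2 * pi * (a * cosp phi s ^+ m1) - 2 * pi * (b * cosp phi s ^+ m2)) =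
      2 * pi * (a * expect unit_prob (fun s => cosp phi s ^+ m1)) - 2 * pi * (b * expect unit_prob (fun s => cosp phi s ^+ m2)).
    by rewrite -!E2; exact: (expect_unitB (b2 _ _) (b2 _ _)).
  rewrite E3.
  rewrite -/(W m) -/(W m.+1) -mulrBr => /eqP; rewrite mulf_eq0 mulf_eq0 pnatr_eq0/=.
  by rewrite gt_eqF ?pi_gt0//= subr_eq0 => /eqP ->.
rewrite -/(W n); elim: n => [|n IH].
  have -> : W 0%N = 1.
    rewrite /W (_ : (fun s => _) = (fun=> 1)); first exact: expect_cst.
    by apply/funext => s; rewrite muln0 expr0.
  by rewrite muln0 add0n mulr1 expr1n.
have a0 : 0 < (2 * n + 2)%:R :> R by rewrite ltr0n addn2.
have -> : W n.+1 = (2 * n + 1)%:R * W n / (2 * n + 2)%:R.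
  by rewrite rec mulrC mulrA mulVf ?mul1r// gt_eqF.
apply: le_trans IH.
have -> : (2 * n.+1 + 1)%:R = (2 * n + 2)%:R + 1 :> R by rewrite natr1; congr (_%:R); lia.
have -> : (2 * n + 1)%:R = (2 * n + 2)%:R - 1 :> R.
  by apply/eqP; rewrite eq_sym subr_eq natr1; apply/eqP; congr (_%:R); lia.
have a1 : 1 <= (2 * n + 2)%:R :> R by rewrite ler1n addn2.
move: (_%:R) a0 a1 => a a0 a1.
rewrite -subr_ge0 (_ : _ - _ = W n ^+ 2 * (a - 1) / a ^+ 2); last first.
  by field; rewrite gt_eqF.
by rewrite divr_ge0 ?sqr_ge0// mulr_ge0 ?sqr_ge0// subr_ge0.
Qed.

(* [sinp * K = 1 - cosp ^ (2 n)] is close to 1 off a small set, which makes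
   [psi (B cosp)] a derivative up to a small error. *)
Lemma multiplier_exists n : exists M : R, 0 <= M /\ forall phi, exists K k : R -> R,
  [/\ forall s : R, is_derive s 1 K (k s), continuous k, forall s, `|k s| <= M,
      forall s, sinp phi s * K s = 1 - cosp phi s ^+ (2 * n) & K 1 = K 0].
Proof.
elim: n => [|n [M [M0 IH]]].
  exists 0; split=> // phi; exists (fun=> 0), (fun=> 0); split => //.
  - by move=> x; apply: is_derive_cst.
  - exact: cst_continuous.
  - by move=> s; rewrite normr0.
  - by move=> s; rewrite muln0 expr0 mulr0 subrr.
exists (M + 2 * pi * (1 + (2 * n)%:R)).
have p0 : 0 <= 2 * pi :> R by rewrite mulr_ge0 ?pi_ge0.
split; first by rewrite addr_ge0// mulr_ge0// addr_ge0.
move=> phi; have [K [k [dK ck kM SK K1]]] := IH phi.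
exists (fun s => K s + cosp phi s ^+ (2 * n) * sinp phi s).
exists (fun s => k s + 2 * pi * (cosp phi s ^+ (2 * n).+1 - (2 * n)%:R * cosp phi s ^+ (2 * n).-1 * (1 - cosp phi s ^+ 2))).
split.
- move=> s; have := dK s; have := is_derive_cospX_sinp phi (2 * n) s => h1 h2.
  exact: (@is_deriveD _ _ _ K (fun s => cosp phi s ^+ (2 * n) * sinp phi s)).
- move=> x; apply: cvgD; first exact: ck.
  apply: cvgM; first exact: cvg_cst.
  apply: cvgB; first exact: continuous_cospX.
  apply: cvgM; first by (apply: cvgM; [exact: cvg_cst|exact: continuous_cospX]).
  by apply: cvgB; [exact: cvg_cst|exact: continuous_cospX].
- move=> s; rewrite (le_trans (ler_normD _ _))// lerD// normrM ger0_norm// ler_wpM2l//.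
  rewrite (le_trans (ler_normB _ _))// lerD ?cospX_norm//.
  rewrite -sinp2 !normrM normr_nat -[leRHS]mulr1 ler_pM ?mulr_ge0//.
    by rewrite ler_piMr// cospX_norm.
  by rewrite -[leRHS]mulr1 ler_pM// sinp_norm.
- move=> s; rewrite mulrDr SK (mulrC (cosp phi s ^+ _)) mulrA sinp2.
  rewrite (_ : (2 * n.+1)%N = (2 + 2 * n)%N) ?exprD; last by rewrite mulnS.
  by ring.
- by rewrite cosp1 sinp1 K1.
Qed.

(** Let [G] be a primitive of the increment [g] of [psi]; it is bounded by 1 because [h <= 1]. The
    derivative of [G (B cosp) K] is [G (B cosp) k - 2 pi B g (B cosp) (1 - cosp ^+ (2 n))] and
    integrates to 0 over a period, so the average of [g (B cosp) (1 - cosp ^+ (2 n))] is at most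
    [M / (2 pi B)]. The remainder is at most twice the moment of order [2 n]. Only the bound on
    [psi] enters the constants, so [B] depends on [e] alone. *)
Lemma cosine_average (e : R) : 0 < e -> exists B : R, 0 < B /\
  forall (psi : R -> R) (phi h : R), continuous psi -> (forall r, `|psi r| <= 1) ->
    0 <= h <= 1 ->
  `|expect unit_prob (fun s => psi (B * cosp phi s + h) - psi (B * cosp phi s))| <= e.
Proof.
move=> e0.
(* With this [n] the moment of order [2 n] is at most [e / 4]. *)
have [n ne] : exists n : nat, 16 <= e ^+ 2 * (2 * n + 1)%:R.
  have e2 : 0 < e ^+ 2 by rewrite exprn_gt0.
  exists (Num.truncn (16 / e ^+ 2)).+1.
  have := truncnS_gt (16 / e ^+ 2); rewrite ltr_pdivrMr// => /ltW /le_trans; apply.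
  rewrite mulrC ler_wpM2l// ?(ltW e2)// ler_nat.
  by move: (Num.truncn _) => t; lia.
have [M [M0 HM]] := multiplier_exists n.
(* Ensures [M / (2 pi B) <= e / 2]. *)
pose B := (M + 1) / e.
have B0 : 0 < B by rewrite divr_gt0// ltr_wpDl.
exists B; split=> // psi phi h cpsi psi1 /andP[h0 h1].
have [K [k [dK ck kM SK K1]]] := HM phi.
(* The primitive is controlled to the right of [- (B + 1)], which leaves room for all the values
   [B cosp] and [B cosp + h]. *)
have [P dP] := @antiderivative psi (- (B + 1)) cpsi.
pose g r := psi (r + h) - psi r.
pose G r := P (r + h) - P r.
have cg : continuous g.
  move=> x; apply: cvgB; last exact: cpsi.
  apply: (@continuous_comp _ _ _ (fun r : R => r + h) psi); last exact: cpsi.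
  by apply: cvgD; [exact: cvg_id|exact: cvg_cst].
have g2 r : `|g r| <= 2.
  by rewrite (le_trans (ler_normB _ _))// (_ : 2 = 1 + 1 :> R)// lerD.
have dG (r : R) : - (B + 1) < r -> is_derive r 1 G (g r).
  move=> Br.
  have d1 : is_derive r 1 (fun r => P (r + h)) (psi (r + h)).
    apply: (@is_derive_eq _ _ _ _ _ _ _ (psi (r + h) * 1)); last by rewrite mulr1.
    apply: (@is_derive1_comp _ P (fun r => r + h)); first by apply: dP; lra.
    have -> : (fun r : R => r + h) = (fun r : R => 1 * r + h) by apply/funext => x; rewrite mul1r.
    exact: is_derive_affine.
  have d2 : is_derive r 1 P (psi r) by apply: dP.
  exact: (@is_deriveB _ _ _ (fun r => P (r + h)) P).
have G1 r : - (B + 1) < r -> `|G r| <= 1.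
  move=> Br; rewrite /G.
  have rh : r <= r + h by rewrite lerDl.
  have dd x : x \in `]r, r + h[%R -> is_derive x 1 P (psi x).
    by rewrite in_itv/= => /andP[rx _]; apply: dP; lra.
  have cc : {within `[r, r + h], continuous P}.
    apply: derivable_within_continuous => x; rewrite in_itv/= => /andP[rx _].
    by have [] : is_derive x 1 P (psi x) by apply: dP; lra.
  have [c _ ->] := MVT_segment rh dd cc.
  by rewrite normrM -[leRHS]mulr1 ler_pM// addrAC subrr add0r ger0_norm.
have BC s : - (B + 1) < B * cosp phi s.
  have : `|B * cosp phi s| <= B by rewrite normrM gtr0_norm// ler_piMr ?cosp_norm// ltW.
  by rewrite ler_norml => /andP[+ _]; lra.
pose C := cosp phi; pose S := sinp phi.
have cC : continuous (fun s => B * C s).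
  by move=> x; apply: cvgM; [exact: cvg_cst|exact: continuous_cosp].
have cgC : continuous (fun s => g (B * C s)).
  by move=> x; apply: (@continuous_comp _ _ _ (fun s => B * C s) g); [exact: cC|exact: cg].
have dGC (s : R) : is_derive s 1 (fun s => G (B * C s)) (g (B * C s) * (B * (- (2 * pi) * S s))).
  apply: (@is_derive1_comp _ G (fun s => B * C s)); first exact: dG.
  have d := is_derive_cosp phi s.
  exact: (@is_deriveZ _ _ _ (cosp phi) B).
have cGC : continuous (fun s => G (B * C s)) by exact: is_derive_continuous dGC.
have bg : bounded_mfun (fun s => g (B * C s)) by exact: (@continuous_bounded_mfun _ 2).
have bX m : bounded_mfun (fun s => C s ^+ m).
  by apply: (@continuous_bounded_mfun _ 1); [exact: continuous_cospX|move=> x; exact: cospX_norm].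
have bGk : bounded_mfun (fun s => G (B * C s) * k s).
  apply: (@continuous_bounded_mfun _ (1 * M)).
    by move=> x; apply: cvgM; [exact: cGC|exact: ck].
  by move=> s; rewrite normrM ler_pM// G1.
have main : `|expect unit_prob (fun s => g (B * C s) * (1 - C s ^+ (2 * n)))| <= e / 2.
  have bI : bounded_mfun (fun s => g (B * C s) * (1 - C s ^+ (2 * n))).
    by apply: bounded_mfunM => //; apply: bounded_mfunB => //; exact: bounded_mfun_cst.
  have dT (s : R) : is_derive s 1 (fun s => G (B * C s) * K s)
     (G (B * C s) * k s - (2 * pi * B) * (g (B * C s) * (1 - C s ^+ (2 * n)))).
    have h1' := dGC s; have h2 := dK s.
    apply: (@is_derive_eq _ _ _ ((fun s => G (B * C s)) * K) s 1 _ _ (is_deriveM h1' h2)).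
    rewrite /GRing.scale/= -SK -/S; ring.
  have := expect_derivative dT.
  have cT : continuous (fun s => G (B * C s) * k s - 2 * pi * B * (g (B * C s) * (1 - C s ^+ (2 * n)))).
    move=> x; apply: cvgB; first by apply: cvgM; [exact: cGC|exact: ck].
    apply: cvgM; first exact: cvg_cst.
    apply: cvgM; first exact: cgC.
    by apply: cvgB; [exact: cvg_cst|exact: continuous_cospX].
  have bT : bounded_mfun (fun s => G (B * C s) * k s - 2 * pi * B * (g (B * C s) * (1 - C s ^+ (2 * n)))).
    by apply: bounded_mfunB => //; exact: bounded_mfunZ.
  move=> /(_ cT bT); rewrite /C cosp1 K1 subrr -/C.
  rewrite (expect_unitB bGk (bounded_mfunZ _ bI)) (expect_unitZ _ bI) => /eqP.
  rewrite subr_eq0 => /eqP E.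
  have p0 : 0 < 2 * pi * B by apply: mulr_gt0 => //; apply: mulr_gt0 => //; exact: pi_gt0.
  have : `|2 * pi * B * expect unit_prob (fun s => g (B * C s) * (1 - C s ^+ (2 * n)))| <= M.
    rewrite -E; apply: expect_unit_bound => // s.
    by rewrite normrM -[leRHS]mul1r ler_pM// G1.
  rewrite normrM gtr0_norm// mulrC -ler_pdivlMr// => /le_trans; apply.
  rewrite ler_pdivrMr// /B.
  have pi2 : 2 <= pi :> R := @pi_ge2 R.
  rewrite (_ : e / 2 * _ = pi * (M + 1)); last by field; rewrite gt_eqF.
  nra.
have W : expect unit_prob (fun s => C s ^+ (2 * n)) <= e / 4.
  have := cosine_moment phi n; rewrite -/C.
  have : 0 <= expect unit_prob (fun s => C s ^+ (2 * n)).
    by apply: expect_ge0 => x; rewrite exprM exprn_ge0// sqr_ge0.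
  move: (expect _ _) ne => w; move: ((2 * n + 1)%:R) => a ne w0 wa.
  rewrite leNgt; apply/negP => ew.
  have a0 : 0 < a by rewrite -(pmulr_rgt0 a (exprn_gt0 2 e0)) (lt_le_trans _ ne).
  have : (e / 4) ^+ 2 * a < w ^+ 2 * a.
    by rewrite ltr_pM2r// ltr_pXn2r// nnegrE ?divr_ge0 ?(ltW e0).
  rewrite expr_div_n; nra.
have rest : `|expect unit_prob (fun s => g (B * C s) * C s ^+ (2 * n))| <= e / 2.
  have b1 : bounded_mfun (fun s => g (B * C s) * C s ^+ (2 * n)) by exact: bounded_mfunM.
  apply: le_trans (expect_unit_norm b1) _.
  apply: (@le_trans _ _ (expect unit_prob (fun s => 2 * C s ^+ (2 * n)))).
    apply: expect_unit_le; [exact: bounded_mfun_norm|exact: bounded_mfunZ|move=> s].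
    by rewrite normrM [`|C s ^+ _|]ger0_norm ?ler_wpM2r// exprM exprn_ge0// sqr_ge0.
  rewrite (expect_unitZ _ (bX _)); lra.
have b1 : bounded_mfun (fun s => g (B * C s) * C s ^+ (2 * n)) by exact: bounded_mfunM.
have b2 : bounded_mfun (fun s => g (B * C s) * (1 - C s ^+ (2 * n))).
  by apply: bounded_mfunM => //; apply: bounded_mfunB => //; exact: bounded_mfun_cst.
have -> : expect unit_prob (fun s => psi (B * cosp phi s + h) - psi (B * cosp phi s)) =
   expect unit_prob (fun s => g (B * C s) * (1 - C s ^+ (2 * n))) +
   expect unit_prob (fun s => g (B * C s) * C s ^+ (2 * n)).
  rewrite -(expect_unitD b2 b1); congr expect; apply/funext => s.
  by rewrite -mulrDr subrK mulr1.
by rewrite (le_trans (ler_normD _ _))// [leRHS]splitr lerD.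
Qed.

End oscillation.

(** * Mixing by a twist *)

Section test_functions.
Context {R : realType}.
Local Notation R2 := (measurableTypeR R * measurableTypeR R)%type.
Local Notation Esq := (expect (@square_measure R)).

Lemma norm_pairE (x : R * R) : `|x| = Num.max `|x.1| `|x.2|.
Proof. by []. Qed.

Lemma norm_pairP (x : R * R) (c : R) : `|x.1| <= c -> `|x.2| <= c -> `|x| <= c.
Proof. by move=> h1 h2; rewrite [leLHS]/Num.norm/= ge_max h1 h2. Qed.

Lemma norm_pair_fst (x : R * R) : `|x.1| <= `|x|.
Proof. by rewrite [leRHS]/Num.norm/= le_max lexx. Qed.

Lemma norm_pair_snd (x : R * R) : `|x.2| <= `|x|.
Proof. by rewrite [leRHS]/Num.norm/= le_max lexx orbT. Qed.

(** [f] is the supremum of the cones [f p - L |z - p|] over rational points [p], so its superlevel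
    sets are countable unions. *)
Lemma lipschitz_measurable (f : R2 -> R) (L : R) :
  (forall u v : R * R, `|f u - f v| <= L * `|u - v|) -> measurable_fun setT f.
Proof.
move=> fL.
have L0 : 0 <= L.
  have := fL (1, 0) 0; rewrite subr0; have -> : `|(1, 0) : R * R| = 1.
    by rewrite norm_pairE/= normr1 normr0 max_l.
  by rewrite mulr1; exact: le_trans.
move=> mD; apply: (measurability _ (RGenOInfty.measurableE R)) => // /= _ [_ [y ->] <-].
rewrite setTI.
rewrite [X in measurable X](_ : _ = \bigcup_(p in [set: rat * rat])
   [set z : R2 | y < f (ratr p.1, ratr p.2) - L * `|(z : R * R) - (ratr p.1, ratr p.2)|]).
  apply: countable_bigcupT_measurable => // -[p1 p2] /=.
  have mg : measurable_fun setT (fun z : R2 => f (ratr p1, ratr p2) -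
      L * `|(z : R * R) - (ratr p1, ratr p2)|).
    apply: measurable_funB; first exact: measurable_cst.
    apply: measurable_funM; first exact: measurable_cst.
    have -> : (fun z : R2 => `|(z : R * R) - (ratr p1, ratr p2)|) =
      (fun z : R2 => Num.max `|z.1 - ratr p1| `|z.2 - ratr p2|) by [].
    apply: measurable_maxr; apply: measurableT_comp => //; apply: measurable_funB => //.
  have := mg measurableT `]y, +oo[%classic (measurable_itv _).
  by rewrite setTI; congr measurable; apply/seteqP; split => z /=; rewrite in_itv/= andbT.
apply/seteqP; split => z /=; rewrite in_itv/= andbT; last first.
  move=> [p _ /= /lt_le_trans]; apply; rewrite lerBlDr -lerBlDl.
  by apply: le_trans (ler_norm _) _; rewrite distrC; exact: fL.
move=> yf.
have [d d0 hd] : exists2 d, 0 < d & 2 * L * d < f z - y.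
  exists ((f z - y) / (2 * L + 1)); first by rewrite divr_gt0 ?subr_gt0// ltr_wpDl// mulr_ge0.
  rewrite mulrA ltr_pdivrMr; last by rewrite ltr_wpDl// mulr_ge0.
  rewrite mulrC ltr_pM2l ?subr_gt0// ltrDl//.
have [p1] := @rat_in_itvoo R (z.1 - d) (z.1 + d) ltac:(lra).
rewrite in_itv/= => /andP[h1 h2].
have [p2] := @rat_in_itvoo R (z.2 - d) (z.2 + d) ltac:(lra).
rewrite in_itv/= => /andP[h3 h4].
exists (p1, p2) => //=.
have nz : `|(z : R * R) - (ratr p1, ratr p2)| <= d.
  by apply: norm_pairP; rewrite /= ler_norml; apply/andP; split; lra.
have := fL z (ratr p1, ratr p2); rewrite ler_norml => /andP[_ hf].
have : L * `|(z : R * R) - (ratr p1, ratr p2)| <= L * d by rewrite ler_wpM2l.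
lra.
Qed.

(** All observables with the same [L] are controlled at once by one stage of the construction, and
    as [L] grows they approximate every measurable set. *)
Definition test_fun (L : R) (a : R * R -> R) :=
  [/\ lattice_periodic a, forall z, `|a z| <= 1 &
      forall u v : R * R, `|a u - a v| <= L * `|u - v|].

Lemma test_fun_bounded L a : test_fun L a -> bounded_mfun (a : R2 -> R).
Proof.
move=> [_ a1 aL]; split; first exact: lipschitz_measurable aL.
by exists 1.
Qed.

Lemma test_fun_ge0 L a : test_fun L a -> 0 <= L.
Proof.
move=> [_ _ aL]; have := aL (1, 0) 0; rewrite subr0; have -> : `|(1, 0) : R * R| = 1.
  by rewrite norm_pairE/= normr1 normr0 max_l.
by rewrite mulr1; exact: le_trans.
Qed.

Lemma test_fun_periodic L a (z : R * R) (m n : R) : test_fun L a ->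
  m \is a Num.int -> n \is a Num.int -> a (z.1 + m, z.2 + n) = a z.
Proof.
move=> [pa _ _] hm hn; rewrite -[in RHS](pa z (m, n)).
  by congr a.
by rewrite /int_lattice/= hm hn.
Qed.

(** The segment in direction [(k, 1)] is slid along itself by [d / k], with [d] chosen so that its
    first coordinate becomes [w.1 + k w.2] modulo 1. The average along the segment turns into one
    over the whole square, at the price of moving the second coordinate by at most [1 / k]. *)
Lemma direction_average L a (k : nat) (z : R * R) : test_fun L a -> (0 < k)%N ->
  `|Esq (fun w : R2 => a (z.1 + k%:R * w.2, z.2 + w.2)) - Esq (a : R2 -> R)| <= L / k%:R.
Proof.
move=> ta k0; have [pa a1 aL] := ta; have L0 := test_fun_ge0 ta.
have kR : 0 < k%:R :> R by rewrite ltr0n.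
have ki : (k%:R : R) \is a Num.int by exact: natr_int.
pose xi := z.1 - k%:R * z.2.
pose f (w : R2) := a (xi + k%:R * w.2, w.2).
have ma := test_fun_bounded ta.
have m1 : measurable_fun setT (fst : R2 -> _) by exact: measurable_fst.
have m2 : measurable_fun setT (snd : R2 -> _) by exact: measurable_snd.
have mk (c : R) : measurable_fun setT (fun w : R2 => c + k%:R * w.2).
  apply: measurable_funD; first exact: measurable_cst.
  by apply: measurable_funM => //; exact: measurable_cst.
have bf : bounded_mfun f.
  apply: (@bounded_mfun_comp _ _ R2 R2 R a (fun w => (xi + k%:R * w.2, w.2))) => //.
  by apply: measurable_fun_pair; [exact: mk|exact: m2].
have pf : lattice_periodic f.
  move=> w [l1 l2] /andP[/= h1 h2]; rewrite /f /=.
  rewrite -(@test_fun_periodic _ _ (xi + k%:R * w.2, w.2) (k%:R * l2) l2 ta)//=; last exact: rpredM.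
  by congr (a (_, _)); rewrite mulrDr addrA.
have -> : Esq (fun w : R2 => a (z.1 + k%:R * w.2, z.2 + w.2)) = Esq f.
  rewrite -(@square_expect_comp R f (fun w => (w.1, w.2 + z.2)))//.
    congr (Esq _); apply/funext => w; rewrite /f /xi /=; congr (a (_, _)); ring.
  exact: (@square_preserving_vshear R (fun=> z.2)).
(* [xi + d x] equals [x] modulo 1. *)
pose d (x : R) := (x - xi) - (Num.floor (x - xi))%:~R.
have d0 x : 0 <= d x by rewrite subr_ge0; exact: floor_le_tmp.
have d1 x : d x <= 1.
  by rewrite lerBlDl; have := floorD1_gt (x - xi); rewrite intrD => /ltW.
have md : measurable_fun setT (fun x : R => d x / k%:R).
  apply: measurable_funM; last exact: measurable_cst.
  have msub : measurable_fun setT (fun x : R => x - xi).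
    by apply: measurable_funB => //; exact: measurable_cst.
  apply: measurable_funB => //.
  have mfl : measurable_fun setT (fun x : R => (Num.floor x)%:~R : R).
    apply: nondecreasing_measurable => // x y xy.
    by rewrite ler_int; exact: le_floor.
  exact: measurableT_comp mfl msub.
have -> : Esq f = Esq (fun w : R2 => f (w.1, w.2 + d w.1 / k%:R)).
  by rewrite (@square_expect_comp R f (fun w => (w.1, w.2 + d w.1 / k%:R)))//;
    exact: (@square_preserving_vshear R (fun x => d x / k%:R)).
have -> : Esq (a : R2 -> R) = Esq (fun w : R2 => a (w.1 + k%:R * w.2, w.2)).
  rewrite -(@square_expect_comp R a (fun w => (w.1 + k%:R * w.2, w.2)))//.
  apply: (@square_preserving_hshear R (fun y => k%:R * y)).
  by apply: measurable_funM => //; exact: measurable_cst.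
apply: expect_dist.
- apply: (@bounded_mfun_comp _ _ R2 R2 R f (fun w => (w.1, w.2 + d w.1 / k%:R))) => //.
  apply: measurable_fun_pair => //; apply: measurable_funD => //.
  exact: (measurableT_comp md m1).
- apply: (@bounded_mfun_comp _ _ R2 R2 R a (fun w => (w.1 + k%:R * w.2, w.2))) => //.
  apply: measurable_fun_pair => //; apply: measurable_funD => //.
  by apply: measurable_funM => //; exact: measurable_cst.
move=> w; rewrite /f /=.
have -> : a (w.1 + k%:R * w.2, w.2) = a (xi + d w.1 + k%:R * w.2, w.2).
  rewrite -(@test_fun_periodic _ _ (xi + d w.1 + k%:R * w.2, w.2) (Num.floor (w.1 - xi))%:~R 0 ta)//=.
  by rewrite addr0; congr (a (_, _)); rewrite /d; ring.
apply: le_trans (aL _ _) _; rewrite ler_wpM2l//; apply: norm_pairP => /=.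
  rewrite [X in `|X|](_ : _ = 0) ?normr0 ?invr_ge0 ?ler0n//.
  by field; rewrite gt_eqF.
rewrite [X in `|X|](_ : _ = d w.1 / k%:R); last by ring.
by rewrite normrM ger0_norm// ger0_norm ?invr_ge0 ?(ltW kR)// ler_piMl// invr_ge0 ltW.
Qed.

End test_functions.

Section twist_mixing.
Context {R : realType}.
Local Notation R2 := (measurableTypeR R * measurableTypeR R)%type.
Local Notation Esq := (expect (@square_measure R)).

Definition frac (x : R) : R := x - (Num.floor x)%:~R.

Lemma frac_itv x : 0 <= frac x <= 1.
Proof.
apply/andP; split; first by rewrite subr_ge0; exact: floor_le_tmp.
by rewrite lerBlDl; have := floorD1_gt x; rewrite intrD => /ltW.
Qed.

Lemma cosDint (x m : R) : m \is a Num.int -> cos (x + 2 * pi * m) = cos x.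
Proof.
move=> /intrP[[n|n] ->].
  rewrite -[RHS](periodicn (@cosD2pi R) n); congr cos.
  by rewrite -(mulr_natr (pi *+ 2) n) -(mulr_natl pi 2).
rewrite NegzE -[LHS](periodicn (@cosD2pi R) n.+1); congr cos.
by rewrite -(mulr_natr (pi *+ 2) n.+1) -(mulr_natl pi 2) intrN mulrN subrK.
Qed.

Definition along (k : nat) (z : R * R) (r : R) : R * R := (z.1 + k%:R * r, z.2 + r).

Lemma along_norm k (z z' : R * R) r r' : (0 < k)%N ->
  `|along k z r - along k z' r'| <= `|z - z'| + k%:R * `|r - r'|.
Proof.
move=> k0; have k1 : 1 <= k%:R :> R by rewrite ler1n.
have h1 := norm_pair_fst (z - z'); have h2 := norm_pair_snd (z - z').
apply: norm_pairP => /=.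
  rewrite (_ : _ - _ = (z.1 - z'.1) + k%:R * (r - r')); last by ring.
  by rewrite (le_trans (ler_normD _ _))// lerD// normrM normr_nat.
rewrite (_ : _ - _ = (z.2 - z'.2) + (r - r')); last by ring.
by rewrite (le_trans (ler_normD _ _))// lerD// ler_peMl.
Qed.

Lemma test_fun_along_continuous L a k z : test_fun L a -> (0 < k)%N ->
  continuous (fun r => a (along k z r)).
Proof.
move=> ta k0; have L0 := test_fun_ge0 ta; have [_ _ aL] := ta.
have k1 : 1 <= k%:R :> R by rewrite ler1n.
move=> x; apply/cvgrPdist_le => /= e e0.
have M0 : 0 < L * k%:R + 1 by rewrite ltr_wpDl// mulr_ge0.
have d0 : 0 < e / (L * k%:R + 1) by rewrite divr_gt0.
near=> y.
have xy : `|x - y| <= e / (L * k%:R + 1).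
  by near: y; exact: (@cvgr_dist_le _ _ _ _ _ id x cvg_id _ d0).
apply: le_trans (aL _ _) _.
apply: (@le_trans _ _ (L * (k%:R * `|x - y|))).
  by rewrite ler_wpM2l// (le_trans (along_norm _ _ _ _ k0))// subrr normr0 add0r.
apply: (@le_trans _ _ ((L * k%:R + 1) * `|x - y|)).
  by rewrite mulrA ler_wpM2r// lerDl.
by rewrite mulrC -ler_pdivlMr.
Unshelve. all: by end_near. Qed.

Lemma test_fun_along_periodic L a k z r (m : R) : test_fun L a -> m \is a Num.int ->
  a (along k z (r + m)) = a (along k z r).
Proof.
move=> ta mi; have km : k%:R * m \is a Num.int by apply: rpredM => //; exact: natr_int.
rewrite -[RHS](test_fun_periodic _ ta km mi) /along /=.
by congr (a (_, _)); ring.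
Qed.

Lemma measurable_along (a : R2 -> R) k d (X : measurableType d) (z : X -> R2) (r : X -> R) :
  measurable_fun setT a -> measurable_fun setT z -> measurable_fun setT r ->
  measurable_fun setT (fun x => a (along k (z x) (r x))).
Proof.
move=> ma mz mr.
have mz1 : measurable_fun setT (fun x => (z x).1) by apply: (measurableT_comp measurable_fst mz).
have mz2 : measurable_fun setT (fun x => (z x).2) by apply: (measurableT_comp measurable_snd mz).
apply: (measurableT_comp ma); apply: measurable_fun_pair.
  apply: measurable_funD => //; apply: measurable_funM => //.
by apply: measurable_funD.
Qed.

Lemma measurable_cos : measurable_fun [set: R] (@cos R).
Proof. by apply: continuous_measurable_fun; exact: continuous_cos. Qed.

(** The average hardly changes when the displacement [B cosp] is shifted by any [h], as [h] may be
    reduced modulo 1. Averaging over [h] and exchanging the integrals leaves, for each s, an average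
    over a full period in direction [(k, 1)]. *)
Lemma arc_average L a (k : nat) (e B phi : R) z : test_fun L a -> (0 < k)%N ->
  (forall (psi : R -> R) (phi h : R), continuous psi -> (forall r, `|psi r| <= 1) ->
    0 <= h <= 1 ->
    `|expect unit_prob (fun s => psi (B * cosp phi s + h) - psi (B * cosp phi s))| <= e) ->
  `|expect unit_prob (fun s => a (along k z (B * cosp phi s))) - Esq (a : R2 -> R)| <= e + L / k%:R.
Proof.
move=> ta k0 HB; have [_ a1 aL] := ta; have [ma _] := test_fun_bounded ta.
pose psi r := a (along k z r).
have cpsi : continuous psi by exact: test_fun_along_continuous ta k0.
have psi1 r : `|psi r| <= 1 by exact: a1.
have cB h : continuous (fun s => B * cosp phi s + h).
  move=> x; apply: cvgD; last exact: cvg_cst.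
  by apply: cvgM; [exact: cvg_cst|exact: continuous_cosp].
have bJ h : bounded_mfun (fun s => psi (B * cosp phi s + h)).
  apply: (@continuous_bounded_mfun _ _ 1) => // x.
  by apply: (@continuous_comp _ _ _ (fun s => B * cosp phi s + h) psi); [exact: cB|exact: cpsi].
have bJ0 : bounded_mfun (fun s => psi (B * cosp phi s)).
  have := bJ 0; congr bounded_mfun; apply/funext => s; by rewrite addr0.
pose J h := expect unit_prob (fun s => psi (B * cosp phi s + h)).
have HJ h : `|J h - expect unit_prob (fun s => psi (B * cosp phi s))| <= e.
  have -> : J h = J (frac h).
    rewrite /J; congr expect; apply/funext => s; rewrite /psi.
    rewrite -[RHS](@test_fun_along_periodic _ _ k z _ (Num.floor h)%:~R ta (intr_int _ _)).
    by congr (a (along k z _)); rewrite /frac; ring.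
  rewrite /J -(expect_unitB (bJ _) bJ0); apply: HB => //; exact: frac_itv.
have mK : measurable_fun setT (fun p : R2 * measurableTypeR R => psi (B * cosp phi p.2 + p.1.2)).
  rewrite /psi; apply: (@measurable_along a k _ _ (fun=> z)) => //.
  apply: measurable_funD; last exact: (measurableT_comp measurable_snd measurable_fst).
  apply: measurable_funM => //; apply: (measurableT_comp measurable_cos).
  apply: measurable_funD => //; apply: measurable_funM => //; exact: measurable_snd.
have bK : bounded_mfun (fun p : R2 * measurableTypeR R => psi (B * cosp phi p.2 + p.1.2)).
  by split=> //; exists 1.
have F := expect_fubini (@square_measure R) unit_prob bK.
have bE := bounded_mfun_expect1 (@square_measure R) unit_prob bK.
have bE2 := bounded_mfun_expect2 (@square_measure R) unit_prob bK.
have h1 : `|Esq (fun w : R2 => J w.2) - expect unit_prob (fun s => psi (B * cosp phi s))| <= e.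
  rewrite -[X in _ - X](@expect_cst _ _ R (@square_measure R)).
  by apply: expect_dist; [exact: bE|exact: bounded_mfun_cst|move=> w; exact: HJ].
have h2 : `|Esq (fun w : R2 => J w.2) - Esq (a : R2 -> R)| <= L / k%:R.
  rewrite [X in X - _]F -[X in _ - X](@expect_cst _ _ R (@unit_prob R)).
  apply: expect_dist; [exact: bE2|exact: bounded_mfun_cst|move=> s /=].
  have := @direction_average R L a k (along k z (B * cosp phi s)) ta k0.
  apply: le_trans; rewrite le_eqVlt; apply/orP; left; apply/eqP; congr (`| _ - _ |).
  by congr expect; apply/funext => w; rewrite /psi /along /=; congr (a (_, _)); ring.
rewrite -(subrK (Esq (fun w : R2 => J w.2)) (expect unit_prob _)) -addrA.
rewrite (le_trans (ler_normD _ _))// lerD//.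
by rewrite distrC.
Qed.

Definition phase (k : nat) (z : R * R) : R := z.1 - k%:R * z.2.

(** A horizontal translation by [frac s / q] advances the argument of the cosine by [2 pi s] modulo
    [2 pi], while [a] and [b] vary by at most [L / q] each. Averaging over s at fixed z then brings
    in [arc_average], and [a] decouples from [b]. *)
Lemma twist_mixing L a b (k q : nat) (e B phi t : R) : test_fun L a -> test_fun L b ->
  (0 < k)%N -> (0 < q)%N ->
  (forall (psi : R -> R) (phi h : R), continuous psi -> (forall r, `|psi r| <= 1) ->
    0 <= h <= 1 ->
    `|expect unit_prob (fun s => psi (B * cosp phi s + h) - psi (B * cosp phi s))| <= e) ->
  `|Esq (fun z : R2 => a (along k (z.1 + t, z.2) (B * cos (2 * pi * q%:R * phase k z + phi))) * b z)
    - Esq (a : R2 -> R) * Esq (b : R2 -> R)| <= 2 * L / q%:R + (e + L / k%:R).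
Proof.
move=> ta tb k0 q0 HB; have [pa a1 aL] := ta; have [pb b1 bL] := tb.
have ba := test_fun_bounded ta; have bb := test_fun_bounded tb.
have [ma _] := ba; have [mb _] := bb.
have L0 := test_fun_ge0 ta.
have qR : 0 < q%:R :> R by rewrite ltr0n.
pose th (z : R * R) : R := 2 * pi * q%:R * phase k z + phi.
pose G (z : R2) := a (along k (z.1 + t, z.2) (B * cos (th z))) * b z.
pose H (p : R2 * measurableTypeR R) :=
  a (along k (p.1.1 + t, p.1.2) (B * cosp (th p.1) p.2)) * b p.1.
have mth d (X : measurableType d) (z : X -> R2) : measurable_fun setT z ->
    measurable_fun setT (fun x => th (z x)).
  move=> mz.
  have mz1 : measurable_fun setT (fun x => (z x).1) by apply: (measurableT_comp measurable_fst mz).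
  have mz2 : measurable_fun setT (fun x => (z x).2) by apply: (measurableT_comp measurable_snd mz).
  apply: measurable_funD => //; apply: measurable_funM => //.
  by apply: measurable_funB => //; apply: measurable_funM.
have ms d (X : measurableType d) (z : X -> R2) : measurable_fun setT z ->
    measurable_fun setT (fun x => ((z x).1 + t, (z x).2) : R2).
  move=> mz; apply: measurable_fun_pair; last exact: (measurableT_comp measurable_snd mz).
  by apply: measurable_funD => //; exact: (measurableT_comp measurable_fst mz).
have bG : bounded_mfun G.
  apply: bounded_mfunM => //; split; last by exists 1.
  apply: (@measurable_along a k _ _ (fun z : R2 => (z.1 + t, z.2)) (fun z => B * cos (th z))) => //.
    by apply: (ms _ R2 id).
  apply: measurable_funM => //; apply: (measurableT_comp measurable_cos).
  exact: (mth _ R2 id).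
have bH : bounded_mfun H.
  apply: bounded_mfunM; last first.
    apply: (@bounded_mfun_comp _ _ (R2 * measurableTypeR R)%type R2 R b fst) => //.
  split; last by exists 1.
  apply: (@measurable_along a k _ _ (fun p : R2 * measurableTypeR R => (p.1.1 + t, p.1.2) : R2) (fun p => B * cosp (th p.1) p.2)) => //.
    exact: (ms _ _ (fst : R2 * measurableTypeR R -> R2) measurable_fst).
  apply: measurable_funM => //; apply: (measurableT_comp measurable_cos).
  apply: measurable_funD => //; last exact: (mth _ _ (fst : R2 * measurableTypeR R -> R2) measurable_fst).
  by apply: measurable_funM => //; exact: measurable_snd.
have pG : lattice_periodic G.
  move=> z l /andP[l1 l2]; rewrite /G pb; last by apply/andP.
  have -> : cos (th (z + l)) = cos (th z).
    rewrite -[RHS](@cosDint _ (q%:R * (l.1 - k%:R * l.2))).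
      by congr cos; rewrite /th /phase /=; ring.
    apply: rpredM; first exact: natr_int.
    by apply: rpredB => //; apply: rpredM => //; exact: natr_int.
  congr (_ * _); rewrite -[RHS](test_fun_periodic _ ta l1 l2).
  by congr a; rewrite /along /=; congr pair; ring.
pose K s := Esq (fun z : R2 => H (z, s)).
have HK s : `|Esq G - K s| <= 2 * L / q%:R.
  pose c := frac s / q%:R.
  have /andP[fs0 fs1] := frac_itv s.
  have c0 : 0 <= c by rewrite divr_ge0// ltW.
  have cq : c <= q%:R^-1 by rewrite ler_piMl// invr_ge0 ltW.
  have sqc : square_preserving (fun z : R * R => (z.1 + c, z.2)).
    exact: (@square_preserving_hshear R (fun=> c)).
  rewrite -(@square_expect_comp R G _ sqc)//.
  have [msc _] := sqc.
  apply: expect_dist.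
  - exact: (bounded_mfun_comp bG msc).
  - exact: (bounded_mfun_pair2 bH).
  move=> z; rewrite /G /H.
  have -> : cosp (th z) s = cos (th (z.1 + c, z.2)).
    rewrite /cosp -[RHS](@cosDint _ (Num.floor s)%:~R (intr_int _ _)); congr cos.
    rewrite /th /phase /= /c /frac; field; by rewrite gt_eqF.
  have nc : `|((z.1 + c, z.2) : R * R) - z| <= q%:R^-1.
    apply: norm_pairP => /=; last by rewrite subrr normr0 invr_ge0 ltW.
    by rewrite addrAC subrr add0r ger0_norm.
  set u := a _; set v := a _.
  have uv : `|u - v| <= L / q%:R.
    apply: le_trans (aL _ _) _; rewrite ler_wpM2l//.
    apply: le_trans (along_norm _ _ _ _ k0) _; rewrite subrr normr0 mulr0 addr0.
    apply: norm_pairP => /=; last by rewrite subrr normr0 invr_ge0 ltW.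
    rewrite (_ : _ - _ = c); last by ring.
    by rewrite ger0_norm.
  have bbz : `|b (z.1 + c, z.2) - b z| <= L / q%:R.
    by apply: le_trans (bL _ _) _; rewrite ler_wpM2l.
  rewrite (_ : _ - _ = (u - v) * b (z.1 + c, z.2) + v * (b (z.1 + c, z.2) - b z)); last by ring.
  rewrite (_ : 2 * L / q%:R = L / q%:R * 1 + 1 * (L / q%:R)); last by ring.
  rewrite (le_trans (ler_normD _ _))// !normrM.
  by apply: lerD; apply: ler_pM => //; exact: a1.
have h1 : `|Esq G - expect unit_prob K| <= 2 * L / q%:R.
  rewrite -[X in X - _](@expect_cst _ _ R (@unit_prob R)).
  apply: expect_dist; [exact: bounded_mfun_cst| |move=> s; exact: HK].
  exact: (bounded_mfun_expect2 (@square_measure R) unit_prob bH).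
have h2 : `|expect unit_prob K - Esq (a : R2 -> R) * Esq (b : R2 -> R)| <= e + L / k%:R.
  rewrite /K -(expect_fubini (@square_measure R) unit_prob bH).
  have EZ : Esq (a : R2 -> R) * Esq (b : R2 -> R) = Esq (fun z : R2 => Esq (a : R2 -> R) * b z).
    by rewrite expectZ.
  rewrite EZ; apply: expect_dist.
  - exact: (bounded_mfun_expect1 (@square_measure R) unit_prob bH).
  - exact: bounded_mfunZ.
  move=> z.
  have bz : bounded_mfun (fun s : R => a (along k (z.1 + t, z.2) (B * cosp (th z) s))).
    apply: (@continuous_bounded_mfun _ _ 1) => // x.
    apply: (@continuous_comp _ _ _ (fun s => B * cosp (th z) s) (fun r => a (along k (z.1 + t, z.2) r))).
      by apply: cvgM; [exact: cvg_cst|exact: continuous_cosp].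
    exact: test_fun_along_continuous ta k0 _.
  have -> : expect unit_prob (fun s => H (z, s)) =
      b z * expect unit_prob (fun s => a (along k (z.1 + t, z.2) (B * cosp (th z) s))).
    by rewrite -(expect_unitZ _ bz); congr expect; apply/funext => s; rewrite /H /= mulrC.
  rewrite [X in _ - X]mulrC -mulrBr normrM -[leRHS]mul1r ler_pM//.
  exact: arc_average ta k0 HB.
rewrite -(subrK (expect unit_prob K) (Esq _)) -addrA.
by rewrite (le_trans (ler_normD _ _))// lerD.
Qed.

End twist_mixing.

(** * Conjugated rotations *)

Section tame.
Context {R : realType}.
Local Notation R2 := (measurableTypeR R * measurableTypeR R)%type.
Implicit Types (H V F G : R * R -> R * R).

(** Stated for the displacement, since a lift of a torus map homotopic to the identity is itself
    unbounded. *)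
Definition tame H := forall k, exists M : R,
  Ck_bounded k (fun z => (H z).1 - z.1) M /\ Ck_bounded k (fun z => (H z).2 - z.2) M.

Definition equivariant H := forall z l : R * R, int_lattice l -> H (z + l) = H z + l.

Definition rot (t : R) (z : R * R) : R * R := (z.1 + t, z.2).

Lemma Ck_bounded_ext k (F G : R * R -> R) M : F =1 G -> Ck_bounded k F M -> Ck_bounded k G M.
Proof. by move=> FG; have -> : F = G by apply/funext. Qed.

Lemma tame_id : tame id.
Proof.
have H k : Ck_bounded k (fun _ : R * R => 0 : R) 0.
  by have := @Ck_bounded_cst R k 0; rewrite normr0.
move=> k; exists 0; split; apply: Ck_bounded_ext (H k) => z; by rewrite subrr.
Qed.

Lemma tame_rot t : tame (rot t).
Proof.
move=> k; exists `|t|; split.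
  apply: Ck_bounded_ext (@Ck_bounded_cst R k t) => z; rewrite /rot /=; ring.
apply: (@Ck_bounded_le _ _ _ `|0|); first by rewrite normr0.
apply: Ck_bounded_ext (@Ck_bounded_cst R k 0) => z; rewrite /rot /=; ring.
Qed.

Lemma tame_comp F G : tame F -> tame G -> tame (F \o G).
Proof.
move=> tF tG k; have [M [F1 F2]] := tF k; have [N [G1 G2]] := tG k.
have [C [C1 HC]] := @Ck_bounded_comp R k N.
have E z : (z.1 + ((G z).1 - z.1), z.2 + ((G z).2 - z.2)) = G z.
  by apply: injective_projections => /=; ring.
exists (N + C * M); split.
- apply: Ck_bounded_ext (Ck_boundedD G1 (HC _ _ _ _ F1 G1 G2)) => z /=.
  by rewrite !E; ring.
- apply: Ck_bounded_ext (Ck_boundedD G2 (HC _ _ _ _ F2 G1 G2)) => z /=.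
  by rewrite !E; ring.
Qed.

Lemma tame_lipschitz F : tame F -> exists L : R, 1 <= L /\
  forall u v, `|F u - F v| <= L * `|u - v|.
Proof.
move=> tF; have [M [F1 F2]] := tF 1%N; have M0 := Ck_bounded_ge0 F1.
exists (1 + 2 * M); split; first by rewrite lerDl mulr_ge0.
move=> u v; rewrite mulrDl mul1r; apply: norm_pairP => /=.
- rewrite (_ : _ - _ = (u - v).1 + (((F u).1 - u.1) - ((F v).1 - v.1))); last by rewrite /=; ring.
  rewrite (le_trans (ler_normD _ _))// lerD ?norm_pair_fst//.
  exact: (Ck_bounded_lipschitz u v F1).
- rewrite (_ : _ - _ = (u - v).2 + (((F u).2 - u.2) - ((F v).2 - v.2))); last by rewrite /=; ring.
  rewrite (le_trans (ler_normD _ _))// lerD ?norm_pair_snd//.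
  exact: (Ck_bounded_lipschitz u v F2).
Qed.

Lemma equivariant_lattice_map H : equivariant H -> lattice_map H.
Proof. by move=> eH z l hl; rewrite eH// addrC addKr. Qed.

Lemma equivariant_comp F G : equivariant F -> equivariant G -> equivariant (F \o G).
Proof. by move=> eF eG z l hl /=; rewrite eG// eF. Qed.

Lemma equivariant_rot t : equivariant (rot t).
Proof.
by move=> z l _; apply: injective_projections => /=; rewrite ?addr0//; ring.
Qed.

Lemma square_preserving_rot t : square_preserving (rot t).
Proof. by apply: (@square_preserving_hshear R (fun=> t)); exact: measurable_cst. Qed.

Lemma rotD s t z : rot s (rot t z) = rot (t + s) z.
Proof. by rewrite /rot /= addrA. Qed.

Definition twist (k : nat) (b : R) (q : nat) (z : R * R) : R * R :=
  along k z (b * cos (2 * pi * q%:R * phase k z)).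

Lemma phase_along k (z : R * R) r : phase k (along k z r) = phase k z.
Proof. by rewrite /phase /along /=; ring. Qed.

Lemma along_along k (z : R * R) r s : along k (along k z r) s = along k z (r + s).
Proof. by rewrite /along /=; congr pair; ring. Qed.

Lemma twistK k b q : cancel (twist k b q) (twist k (- b) q).
Proof.
move=> z; rewrite /twist phase_along along_along mulNr subrr.
by rewrite /along mulr0 !addr0 -surjective_pairing.
Qed.

Lemma twistNK k b q : cancel (twist k (- b) q) (twist k b q).
Proof. by have := @twistK k (- b) q; rewrite opprK. Qed.

(** [phase k] is constant in direction [(k, 1)], so the two twists combine into a single
    displacement in that direction. *)
Lemma twist_rot k b q t z : twist k b q (rot t (twist k (- b) q z)) =
  along k (rot t z) (b * (cos (2 * pi * q%:R * phase k z + 2 * pi * q%:R * t)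
                          - cos (2 * pi * q%:R * phase k z))).
Proof.
have E r : rot t (along k z r) = along k (rot t z) r by rewrite /rot /along /=; congr pair; ring.
have Ep : phase k (rot t z) = phase k z + t by rewrite /phase /rot /=; ring.
rewrite /twist E phase_along along_along Ep; congr along.
by rewrite [in cos (_ * (_ + t))]mulrDr mulNr addrC -mulrBr.
Qed.

Lemma twist_waveE k b q (z : R * R) : (0 < k)%N ->
  b * cos (2 * pi * q%:R * phase k z) =
  wave b (2 * pi * q%:R) (- (2 * pi * q%:R * k%:R)) 0 z.
Proof. by move=> _; rewrite /wave /phase; congr (_ * cos _); ring. Qed.

Lemma twist_const_ge1 k q : (0 < k)%N -> (0 < q)%N -> 1 <= 2 * pi * q%:R * k%:R :> R.
Proof.
move=> k0 q0; have k1 : 1 <= k%:R :> R by rewrite ler1n.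
have q1 : 1 <= q%:R :> R by rewrite ler1n.
have p2 : 2 <= pi :> R := @pi_ge2 R.
have p1 : 1 <= 2 * pi :> R by lra.
by apply: mulr_ege1 => //; exact: mulr_ege1.
Qed.

Lemma twist_freq1 k q : (0 < k)%N -> `|2 * pi * q%:R : R| <= 2 * pi * q%:R * k%:R.
Proof.
move=> k0; rewrite ger0_norm ?mulr_ge0 ?pi_ge0//.
by rewrite ler_peMr ?mulr_ge0 ?pi_ge0// ler1n.
Qed.

Lemma twist_freq2 k q : `|- (2 * pi * q%:R * k%:R) : R| <= 2 * pi * q%:R * k%:R.
Proof. by rewrite normrN ger0_norm ?mulr_ge0 ?pi_ge0. Qed.

Lemma tame_twist k b q : (0 < k)%N -> (0 < q)%N -> tame (twist k b q).
Proof.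
move=> k0 q0 r; pose C : R := 2 * pi * q%:R * k%:R.
have C1 : 1 <= C by exact: twist_const_ge1.
have W A := @Ck_bounded_wave R r A (2 * pi * q%:R) (- C) 0 C C1 (twist_freq1 q k0) (twist_freq2 k q).
have k1 : 1 <= k%:R :> R by rewrite ler1n.
exists (`|k%:R * b| * C ^+ r); split.
- apply: Ck_bounded_ext (W (k%:R * b)) => z.
  by rewrite /twist/= twist_waveE// /wave; ring.
- apply: (@Ck_bounded_le _ _ _ (`|b| * C ^+ r)).
    rewrite ler_wpM2r ?exprn_ge0 ?(le_trans _ C1)//.
    by rewrite normrM normr_nat ler_peMl.
  apply: Ck_bounded_ext (W b) => z.
  by rewrite /twist/= twist_waveE// /wave; ring.
Qed.

Lemma equivariant_twist k b q : equivariant (twist k b q).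
Proof.
move=> z l /andP[l1 l2]; rewrite /twist.
have -> : cos (2 * pi * q%:R * phase k (z + l)) = cos (2 * pi * q%:R * phase k z).
  rewrite -[RHS](@cosDint _ _ (q%:R * (l.1 - k%:R * l.2))).
    by congr cos; rewrite /phase /=; ring.
  apply: rpredM; first exact: natr_int.
  by apply: rpredB => //; apply: rpredM => //; exact: natr_int.
by apply: injective_projections => /=; ring.
Qed.

(** The shear [A'] turns [phase k] into the first coordinate; in these coordinates the twist is the
    vertical shear [S]. *)
Lemma square_preserving_twist k b q : square_preserving (twist k b q).
Proof.
pose A (z : R * R) : R * R := (z.1 + k%:R * z.2, z.2).
pose A' (z : R * R) : R * R := (z.1 + - k%:R * z.2, z.2).
pose S (z : R * R) : R * R := (z.1, z.2 + b * cos (2 * pi * q%:R * z.1)).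
have mk (c : R) : measurable_fun setT (fun y : R => c * y) by apply: measurable_funM.
have -> : twist k b q = A \o (S \o A').
  apply/funext => z; rewrite /A /S /A' /twist /along /phase /= mulNr.
  by congr pair; ring.
have lA : lattice_map A.
  move=> z l /andP[l1 l2]; apply/andP; rewrite /=; split.
    rewrite (_ : _ - _ = l.1 + k%:R * l.2); last by ring.
    by apply: rpredD => //; apply: rpredM => //; exact: natr_int.
  by rewrite (_ : _ - _ = l.2)//; ring.
have lS : lattice_map S.
  move=> z l /andP[l1 l2]; apply/andP; rewrite /=; split.
    by rewrite (_ : _ - _ = l.1)//; ring.
  rewrite mulrDr (_ : 2 * pi * q%:R * l.1 = 2 * pi * (q%:R * l.1)); last by ring.
  rewrite cosDint; last by apply: rpredM => //; exact: natr_int.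
  by rewrite (_ : _ - _ = l.2)//; ring.
apply: (square_preserving_comp lA); first exact: (@square_preserving_hshear R (fun y => k%:R * y)).
apply: (square_preserving_comp lS); last exact: (@square_preserving_hshear R (fun y => - k%:R * y)).
apply: (@square_preserving_vshear R (fun x => b * cos (2 * pi * q%:R * x))).
by apply: measurable_funM => //; apply: (measurableT_comp (@measurable_cos R)).
Qed.

Definition conj_pair H V :=
  [/\ cancel H V /\ cancel V H, tame H /\ tame V, equivariant H /\ equivariant V &
      square_preserving H /\ square_preserving V].

Lemma conj_pair_id : conj_pair id id.
Proof.
by split; split => //; exact: tame_id.
Qed.

Lemma conj_pair_twist H V k b q : (0 < k)%N -> (0 < q)%N -> conj_pair H V ->
  conj_pair (H \o twist k b q) (twist k (- b) q \o V).
Proof.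
move=> k0 q0 [[HV VH] [tH tV] [eH eV] [sH sV]]; split; split.
- by move=> z /=; rewrite HV twistK.
- by move=> z /=; rewrite twistNK VH.
- by apply: tame_comp => //; exact: tame_twist.
- by apply: tame_comp => //; exact: tame_twist.
- by apply: equivariant_comp => //; exact: equivariant_twist.
- by apply: equivariant_comp => //; exact: equivariant_twist.
- exact: (square_preserving_comp (equivariant_lattice_map eH) sH (square_preserving_twist _ _ _)).
- exact: (square_preserving_comp (equivariant_lattice_map (@equivariant_twist _ _ _))
    (square_preserving_twist _ _ _) sV).
Qed.

End tame.

(** * One conjugation step: smooth closeness and mixing *)

Section conjugation_step.
Context {R : realType}.
Local Notation R2 := (measurableTypeR R * measurableTypeR R)%type.
Local Notation Esq := (expect (@square_measure R)).
Implicit Types (H V F G : R * R -> R * R).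

(** By periodicity of the cosine only the offset [e] of [q t] from an integer remains. *)
Lemma twist_rot_wave k b q t (m e : R) z : (0 < k)%N -> m \is a Num.int -> q%:R * t = m + e ->
  twist k b q (rot t (twist k (- b) q z)) =
  along k (rot t z) (wave b (2 * pi * q%:R) (- (2 * pi * q%:R * k%:R)) (0 + 2 * pi * e) z -
    wave b (2 * pi * q%:R) (- (2 * pi * q%:R * k%:R)) 0 z).
Proof.
move=> k0 mi qt; rewrite twist_rot mulrBr -[_ * _ * t]mulrA qt.
rewrite (_ : _ + 2 * pi * (m + e) = 2 * pi * q%:R * phase k z + 2 * pi * e + 2 * pi * m); last by ring.
rewrite cosDint//; congr along; rewrite /wave /phase.
by congr (_ * cos _ - _ * cos _); ring.
Qed.

Lemma wave_shift_le b c1 c2 e (z : R * R) : `|wave b c1 c2 (0 + e) z - wave b c1 c2 0 z| <= `|b| * `|e|.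
Proof.
rewrite /wave -mulrBr normrM ler_wpM2l// (le_trans (cos_lipschitz _ _))//.
by rewrite le_eqVlt; apply/orP; left; apply/eqP; congr (`| _ |); ring.
Qed.

Lemma twist_rot_close k b q t (m e : R) z : (0 < k)%N -> m \is a Num.int -> q%:R * t = m + e ->
  `|twist k b q (rot t (twist k (- b) q z)) - rot t z| <= k%:R * (`|b| * (2 * pi * `|e|)).
Proof.
move=> k0 mi qt; rewrite (twist_rot_wave _ _ k0 mi qt).
have -> : rot t z = along k (rot t z) 0.
  by rewrite /along mulr0 !addr0 -surjective_pairing.
rewrite {2}/along mulr0 !addr0 -surjective_pairing.
apply: le_trans (along_norm _ _ _ _ k0) _; rewrite subrr normr0 add0r subr0.
rewrite ler_wpM2l//; apply: le_trans (wave_shift_le _ _ _ _ _) _.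
by rewrite ler_wpM2l// normrM ger0_norm// mulr_ge0 ?pi_ge0.
Qed.

(** [C] is fixed before [q]. Each derivative of a wave of frequency [2 pi q k] costs a factor [q],
    and the phase gap [2 pi e] gives the factor [|e|]; composition with [H] and [V] only changes the
    constant. *)
Lemma conj_smooth_close H V (j k : nat) (b t : R) : conj_pair H V -> (0 < k)%N ->
  exists C : R, 0 <= C /\ forall (q : nat) (m e : R), (0 < q)%N -> m \is a Num.int ->
    q%:R * t = m + e -> C * (q%:R ^+ j * `|e|) <= 1 ->
  Ck_bounded j (fun z => (H (twist k b q (rot t (twist k (- b) q (V z))))).1 - (H (rot t (V z))).1)
    (C * (q%:R ^+ j * `|e|)) /\
  Ck_bounded j (fun z => (H (twist k b q (rot t (twist k (- b) q (V z))))).2 - (H (rot t (V z))).2)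
    (C * (q%:R ^+ j * `|e|)).
Proof.
move=> [_ [tH tV] _ _] k0.
have [M [H1 H2]] := tH j.+1; have M0 := Ck_bounded_ge0 H1.
have [N [V1 V2]] := tV j.
have [Cv [Cv1 HCv]] := @Ck_bounded_comp R j N.
have [Ct [Ct1 HCt]] := @Ck_bounded_translate R j t.
have Cv0 : 0 <= Cv by apply: le_trans Cv1.
have Ct0 : 0 <= Ct by apply: le_trans Ct1.
have k1 : 1 <= k%:R :> R by rewrite ler1n.
have p0 : 0 <= 2 * pi :> R by rewrite mulr_ge0 ?pi_ge0.
pose D := k%:R * `|b| * (2 * pi * k%:R) ^+ j * (2 * pi).
have D0 : 0 <= D by rewrite /D !mulr_ge0 ?exprn_ge0 ?mulr_ge0 ?pi_ge0.
exists (Cv * (1 + Ct * M) * D).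
have CM0 : 0 <= Ct * M by rewrite mulr_ge0.
have C1 : 1 <= 1 + Ct * M by rewrite lerDl.
have C10 : 0 <= 1 + Ct * M by apply: le_trans C1.
have CC0 : 0 <= Cv * (1 + Ct * M) by rewrite mulr_ge0.
split; first by rewrite mulr_ge0.
move=> q m e q0 mi qt small.
pose c1 : R := 2 * pi * q%:R; pose c2 : R := - (2 * pi * q%:R * k%:R).
pose A := 2 * pi * q%:R * k%:R : R.
pose u (z : R * R) := wave b c1 c2 (0 + 2 * pi * e) z - wave b c1 c2 0 z.
pose d := D * (q%:R ^+ j * `|e|).
have qe0 : 0 <= q%:R ^+ j * `|e| by rewrite mulr_ge0// exprn_ge0.
have d0 : 0 <= d by rewrite mulr_ge0.
have W B := @Ck_bounded_wave_shift R j B c1 c2 0 (2 * pi * e) A (twist_const_ge1 k0 q0) (twist_freq1 q k0) (twist_freq2 k q).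
have Ad : k%:R * `|b| * A ^+ j * `|2 * pi * e| = d.
  rewrite /d /D /A normrM (ger0_norm p0).
  have -> : 2 * pi * q%:R * k%:R = 2 * pi * k%:R * q%:R :> R by ring.
  rewrite [(_ * q%:R) ^+ j]exprMn; ring.
have Hu2 : Ck_bounded j u d.
  apply: Ck_bounded_le (W b); rewrite -Ad.
  rewrite ler_wpM2r// ler_wpM2r//.
    by rewrite exprn_ge0// /A !mulr_ge0 ?pi_ge0.
  by rewrite ler_peMl.
have Hu1 : Ck_bounded j (fun z => k%:R * u z) d.
  apply: Ck_bounded_le (Ck_bounded_ext _ (W (k%:R * b))).
    by rewrite -Ad normrM normr_nat.
  by move=> z; rewrite /u /wave; ring.
have d1 : d <= 1.
  apply: le_trans small; rewrite -(mulrA (Cv * (1 + Ct * M)) D) -/d ler_peMl//.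
  exact: mulr_ege1.
have E z : twist k b q (rot t (twist k (- b) q (V z))) =
    ((V z).1 + (t + k%:R * u (V z)), (V z).2 + u (V z)).
  rewrite (twist_rot_wave _ _ k0 mi qt) -/c1 -/c2 -/(u (V z)) /along /rot /=.
  by congr pair; ring.
have EV z : (z.1 + ((V z).1 - z.1), z.2 + ((V z).2 - z.2)) = V z.
  by apply: injective_projections => /=; ring.
have S1 := HCt _ _ _ _ _ H1 Hu1 Hu2 d1.
have S2 := HCt _ _ _ _ _ H2 Hu1 Hu2 d1.
(* The identity part of [H] contributes the displacement itself, bounded by [d]; its bounded part
   contributes [Ct * M * d]. *)
have K1 := HCv _ _ _ _ (Ck_boundedD Hu1 S1) V1 V2.
have K2 := HCv _ _ _ _ (Ck_boundedD Hu2 S2) V1 V2.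
have EC : Cv * (d + Ct * M * d) = Cv * (1 + Ct * M) * D * (q%:R ^+ j * `|e|).
  rewrite /d; ring.
rewrite EC in K1 K2.
split.
- by apply: Ck_bounded_ext K1 => z; rewrite !EV E /rot /=; ring.
- by apply: Ck_bounded_ext K2 => z; rewrite !EV E /rot /=; ring.
Qed.

(** When [q t] is near 1/2 modulo 1, the displacement [b (cos (x + 2 pi q t) - cos x)] is close to
    [- 2 b cos x = B cos (x + pi)], whence [b = B / 2]. Then [twist_mixing] applies to the
    observables [a \o H], whose Lipschitz constant [L'] is known before [k] is chosen. *)
Lemma conj_mixing H V (L e : R) : conj_pair H V -> 0 <= L -> 0 < e -> exists (k : nat) (b C : R),
  [/\ (0 < k)%N, 0 <= C & forall (q : nat) (t m e' : R), (0 < q)%N -> m \is a Num.int ->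
   q%:R * t = m + 1 / 2 + e' -> forall a1 a2, test_fun L a1 -> test_fun L a2 ->
   `|Esq (fun z : R2 => a1 (H (twist k b q (rot t (twist k (- b) q (V z))))) * a2 z) -
     Esq (a1 : R2 -> R) * Esq (a2 : R2 -> R)| <= e + C * (q%:R^-1 + `|e'|)].
Proof.
move=> [[HV VH] [tH tV] [eH eV] [sH sV]] L0 e0.
have [La [La1 HLa]] := tame_lipschitz tH.
have La0 : 0 <= La by apply: le_trans La1.
pose L' := L * La.
have L'0 : 0 <= L' by rewrite mulr_ge0.
have e2 : 0 < e / 2 by rewrite divr_gt0.
have [B [B0 HB]] := cosine_average e2.
pose k := (Num.truncn (2 * L' / e)).+1.
have kL : L' / k%:R <= e / 2.
  have := truncnS_gt (2 * L' / e); rewrite -/k => kk.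
  rewrite ler_pdivrMr ?ltr0n//.
  have : 2 * L' / e * e <= k%:R * e by rewrite ler_wpM2r// ltW.
  rewrite divfK ?gt_eqF//; nra.
have k0 : (0 < k)%N by [].
pose b := B / 2.
pose C := 2 * L' + L' * k%:R * `|b| * (2 * pi).
have p0 : 0 <= 2 * pi :> R by rewrite mulr_ge0 ?pi_ge0.
have x0 : 0 <= L' * k%:R * `|b| * (2 * pi) by rewrite !mulr_ge0 ?pi_ge0.
have C0 : 0 <= C by rewrite addr_ge0// mulr_ge0.
exists k, b, C; split=> // q t m e' q0 mi qt a1 a2 ta1 ta2.
have testH a : test_fun L a -> test_fun L' (fun z => a (H z)).
  move=> [pa a11 aL]; split.
  - exact: lattice_periodic_comp pa (equivariant_lattice_map eH).
  - by move=> z.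
  - move=> u v; rewrite (le_trans (aL _ _))// /L' -mulrA ler_wpM2l//.
have th1 := testH _ ta1; have th2 := testH _ ta2.
have bt1 := test_fun_bounded th1; have bt2 := test_fun_bounded th2.
have EH a : test_fun L a -> Esq (a : R2 -> R) = Esq (fun z : R2 => a (H z)).
  by move=> ta; rewrite (@square_expect_comp R a H sH)//;
    [case: ta|exact: test_fun_bounded ta].
rewrite (EH _ ta1) (EH _ ta2).
pose g z := twist k b q (rot t (twist k (- b) q z)).
pose f (z : R2) := a1 (H (g (V z))) * a2 z.
have sg : square_preserving g.
  apply: (square_preserving_comp (equivariant_lattice_map (@equivariant_twist _ _ _ _)) (square_preserving_twist _ _ _)).
  apply: (square_preserving_comp (equivariant_lattice_map (@equivariant_rot _ _)) (square_preserving_rot _)).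
  exact: square_preserving_twist.
have eg : equivariant g.
  apply: (equivariant_comp (@equivariant_twist _ _ _ _)).
  exact: (equivariant_comp (@equivariant_rot _ _) (@equivariant_twist _ _ _ _)).
have bf : bounded_mfun f.
  apply: bounded_mfunM; last exact: test_fun_bounded ta2.
  apply: (@bounded_mfun_comp _ _ R2 R2 R _ (fun z => g (V z)) bt1).
  exact: (measurableT_comp (proj1 sg) (proj1 sV)).
have pf : lattice_periodic f.
  move=> z l hl; rewrite /f eV// eg// eH//.
  by case: ta1 => -> // _ _; case: ta2 => -> //.
(* The change of variables by [H] removes [V] and puts [H] into both observables. *)
have -> : Esq (fun z : R2 => a1 (H (twist k b q (rot t (twist k (- b) q (V z))))) * a2 z) =
    Esq (fun z : R2 => a1 (H (g z)) * a2 (H z)).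
  rewrite -[LHS](@square_expect_comp R f H sH pf bf); congr expect.
  by apply/funext => z; rewrite /f HV.
pose g0 (z : R * R) := along k (rot t z) (B * cos (2 * pi * q%:R * phase k z + pi)).
have gg0 z : `|g z - g0 z| <= k%:R * (`|b| * (2 * pi * `|e'|)).
  rewrite /g twist_rot /g0.
  apply: le_trans (along_norm _ _ _ _ k0) _; rewrite subrr normr0 add0r ler_wpM2l//.
  rewrite -[_ * _ * t]mulrA qt.
  set x := 2 * pi * q%:R * phase k z.
  rewrite (_ : x + 2 * pi * (m + 1 / 2 + e') = x + pi + 2 * pi * e' + 2 * pi * m); last by field.
  rewrite cosDint//.
  have cpi : cos (x + pi) = - cos x by rewrite cosDpi.
  rewrite (_ : _ - _ = b * (cos (x + pi + 2 * pi * e') - cos (x + pi))); last first.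
    by rewrite cpi /b; field.
  rewrite normrM ler_wpM2l// (le_trans (cos_lipschitz _ _))//.
  rewrite [X in `|X| <= _](_ : _ = 2 * pi * e'); last by ring.
  by rewrite normrM ger0_norm.
have M := @twist_mixing R L' _ _ k q (e / 2) B pi t th1 th2 k0 q0 HB.
have m0 : measurable_fun setT (fun z : R2 => a1 (H (g0 z))).
  apply: (@measurable_along R (fun z : R2 => a1 (H z)) k _ _ (rot t)).
  - by case: bt1.
  - by have [] := @square_preserving_rot R t.
  - apply: measurable_funM => //; apply: (measurableT_comp (@measurable_cos R)).
    apply: measurable_funD => //; apply: measurable_funM => //.
    apply: measurable_funB; first exact: measurable_fst.
    by apply: measurable_funM => //; exact: measurable_snd.
have close : `|Esq (fun z : R2 => a1 (H (g z)) * a2 (H z)) - Esq (fun z : R2 => a1 (H (g0 z)) * a2 (H z))|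
     <= L' * (k%:R * (`|b| * (2 * pi * `|e'|))).
  have [_ a11 _] := ta1; have [_ a21 _] := ta2.
  apply: expect_dist.
  - apply: bounded_mfunM => //.
    exact: (@bounded_mfun_comp _ _ R2 R2 R _ g bt1 (proj1 sg)).
  - by apply: bounded_mfunM => //; split => //; exists 1.
  move=> z; rewrite -mulrBl normrM -[leRHS]mulr1 ler_pM//.
  by have [_ _ hL] := th1; rewrite (le_trans (hL _ _))// ler_wpM2l.
rewrite -(subrK (Esq (fun z : R2 => a1 (H (g0 z)) * a2 (H z))) (Esq (fun z : R2 => a1 (H (g z)) * a2 (H z)))) -addrA.
apply: le_trans (ler_normD _ _) _.
apply: le_trans (lerD close M) _.
have q1 : 0 <= q%:R^-1 :> R by rewrite invr_ge0.
have h : L' * k%:R * `|b| * (2 * pi) * `|e'| = L' * (k%:R * (`|b| * (2 * pi * `|e'|))) by ring.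
rewrite -h /C.
have n0 : 0 <= `|e'| by [].
move: x0 q1 n0 kL; rewrite -/(L' / k%:R).
move: (L' * k%:R * `|b| * (2 * pi)) (q%:R^-1) (`|e'|) (L' / k%:R) => x y w v x0 y0 w0 v2.
nra.
Qed.

End conjugation_step.

(** * The rotation number *)

Section arithmetic.
Context {R : realType}.

(** All the other factors are at least 1, the real power included: its base is at least 1 and its
    exponent nonnegative. *)
Lemma phi1_ge n : (0 < n)%N -> 2 ^+ n <= phi1 R n.
Proof.
move=> n0; rewrite /phi1 -!mulrA ler_peMr ?exprn_ge0//.
apply: mulr_ege1; first by rewrite ler1n fact_gt0.
have pi1 : 1 <= 2 * (pi * n%:R) :> R.
  have p2 : 2 <= pi :> R := @pi_ge2 R.
  have n1 : 1 <= n%:R :> R by rewrite ler1n.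
  nra.
apply: mulr_ege1; last exact: exprn_ege1.
have f1 : 1 <= (n.+2)`!%:R :> R by rewrite ler1n fact_gt0.
have e0 : 0 <= (n.+2)%:R ^ (n%:Z - 2) * (n.+1)%:R :> R.
  by apply: mulr_ge0; [apply: exprz_ge0|]; exact: ler0n.
by rewrite -[X in X <= _](powRr0 (n.+2)`!%:R) ler_powR.
Qed.

Lemma growth_pow (q : nat -> nat) (q_gt0 : forall n, (0 < n)%N -> (0 < q n)%N)
    (q_growth : forall n, (0 < n)%N ->
       phi1 R n * (q n)%:R ^+ (2 * (n.+2 * n.+1 ^ n.+1 + 1)) <= (q n.+1)%:R) n :
  (0 < n)%N -> (2 ^ n * q n ^ n <= q n.+1)%N.
Proof.
move=> n0; rewrite -(ler_nat R); apply: le_trans (q_growth n n0).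
rewrite natrM !natrX ler_pM//; first exact: phi1_ge.
apply: ler_weXn2l; first by rewrite ler1n q_gt0.
have : (0 < n.+1 ^ n.+1)%N by rewrite expn_gt0.
move: (n.+1 ^ n.+1)%N => m; nia.
Qed.

Variable q : nat -> nat.
Hypothesis q_gt0 : forall n, (0 < n)%N -> (0 < q n)%N.
Hypothesis q_pow : forall n, (0 < n)%N -> (2 ^ n * q n ^ n <= q n.+1)%N.

Lemma growth_double n : (0 < n)%N -> (2 * q n <= q n.+1)%N.
Proof.
move=> n0; apply: leq_trans (q_pow n0); apply: leq_mul.
  by rewrite -{1}(expn1 2) leq_exp2l.
have q1 := q_gt0 n0; case: n n0 q1 => // n _ q1.
by rewrite expnS leq_pmulr// expn_gt0 q1.
Qed.

Lemma growth_lt m n : (0 < m)%N -> (m < n)%N -> (q m < q n)%N.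
Proof.
move=> m0; elim: n => // n IH; rewrite ltnS leq_eqVlt => /predU1P[<-|mn].
  by have := growth_double m0; have := q_gt0 m0; lia.
have n0 : (0 < n)%N by apply: leq_trans mn.
by have := IH mn; have := growth_double n0; lia.
Qed.

Lemma growth_le m n : (0 < m)%N -> (m <= n)%N -> (q m <= q n)%N.
Proof. by move=> m0; rewrite leq_eqVlt => /predU1P[->//|/(growth_lt m0)/ltnW]. Qed.

Lemma growth_ge n : (n <= q n.+1)%N.
Proof.
by elim: n => // n IH; apply: leq_ltn_trans IH _; exact: growth_lt.
Qed.

(* Adding 2 rather than 1 to the quotient leaves room on both sides: the intervals
   [x n + 1 / q n.+1, x n + 4 / q n.+1] with [x n = num n / q n] are nested. *)
Fixpoint num n : nat :=
  if n is m.+1 then (q m.+1 * num m) %/ q m + 2 else 0.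

Let x n : R := (num n)%:R / (q n)%:R.

Let qR n : (0 < n)%N -> 0 < (q n)%:R :> R.
Proof. by move=> n0; rewrite ltr0n q_gt0. Qed.

Let x_step n : (0 < n)%N -> x n + (q n.+1)%:R^-1 <= x n.+1 <= x n + 2 / (q n.+1)%:R.
Proof.
move=> n0; have q1 := qR n0; have q2 : 0 < (q n.+1)%:R :> R by exact: qR.
set a := (num n)%:R : R; set r : nat := (q n.+1 * num n %/ q n)%N.
have h1 : (r%:R : R) * (q n)%:R <= (q n.+1)%:R * (num n)%:R.
  by rewrite -!natrM ler_nat leq_divM.
have h2 : (q n.+1)%:R * (num n)%:R < ((r%:R : R) + 1) * (q n)%:R.
  by rewrite natr1 -!natrM ltr_nat ltn_ceil// q_gt0.
rewrite /x /= -/r natrD; apply/andP; split.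
  rewrite -(ler_pM2r q2) mulrDl mulVf ?gt_eqF// divfK ?gt_eqF//.
  rewrite -(ler_pM2r q1) mulrDl mulrAC divfK ?gt_eqF//; nra.
rewrite -(ler_pM2r q2) divfK ?gt_eqF// [X in _ <= X]mulrDl divfK ?gt_eqF//.
rewrite -(ler_pM2r q1) [X in _ <= X]mulrDl [X in _ <= X + _]mulrAC divfK ?gt_eqF//; nra.
Qed.

(** [alpha] is the supremum of the left ends of the nested intervals. The right ends decrease
    because the denominators at least double: [2 / q n.+1 + 4 / q n.+2 <= 4 / q n.+1]. *)
Lemma rotation_number : exists alpha : R, forall n, (0 < n)%N ->
  (q n)%:R / (q n.+1)%:R <= (q n)%:R * alpha - (num n)%:R <= 4 * (q n)%:R / (q n.+1)%:R.
Proof.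
pose y n : R := x n + (q n.+1)%:R^-1; pose z n : R := x n + 4 / (q n.+1)%:R.
have dbl n : (0 < n)%N -> (q n.+1)%:R^-1 <= (q n)%:R^-1 / 2 :> R.
  move=> n0; rewrite -invfM lef_pV2 ?posrE ?qR//; last by rewrite mulr_gt0// qR.
  by rewrite mulrC -natrM ler_nat growth_double.
have yinc n : (0 < n)%N -> y n <= y n.+1.
  move=> n0; have /andP[h _] := x_step n0; apply: le_trans h _.
  by rewrite lerDl invr_ge0.
have zdec n : (0 < n)%N -> z n.+1 <= z n.
  move=> n0; have /andP[_ h] := x_step n0; have := dbl n.+1 isT.
  rewrite /z; lra.
have yz n : y n <= z n.
  by rewrite lerD2l ler_peMl ?invr_ge0// ler1n.
have ymono m n : (0 < m)%N -> (m <= n)%N -> y m <= y n.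
  move=> m0; elim: n => [|n IH]; first by rewrite leqn0 => /eqP ->.
  rewrite leq_eqVlt => /predU1P[->//|]; rewrite ltnS => mn.
  by apply: le_trans (IH mn) (yinc _ _); apply: leq_trans mn.
have zmono m n : (0 < m)%N -> (m <= n)%N -> z n <= z m.
  move=> m0; elim: n => [|n IH]; first by rewrite leqn0 => /eqP ->.
  rewrite leq_eqVlt => /predU1P[->//|]; rewrite ltnS => mn.
  by apply: le_trans (zdec _ _) (IH mn); apply: leq_trans mn.
have yzmn m n : (0 < m)%N -> (0 < n)%N -> y m <= z n.
  move=> m0 n0; apply: (@le_trans _ _ (y (maxn m n))); first by rewrite ymono// leq_maxl.
  by apply: le_trans (yz _) _; rewrite zmono// leq_maxr.
pose E : set R := [set y n.+1 | n in [set: nat]].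
have Eub n : (0 < n)%N -> ubound E (z n).
  by move=> n0 _ [m _ <-]; exact: yzmn.
have Ex : has_sup E by split; [exists (y 1%N), 0%N|exists (z 1%N); exact: Eub].
exists (sup E) => n n0; have q1 := qR n0.
have h1 : y n <= sup E.
  by apply: sup_upper_bound => //; case: n n0 q1 => // n _ _; exists n.
have h2 : sup E <= z n by apply: sup_le_ub; [exact: Ex.1|exact: Eub].
have e1 : (q n)%:R * y n = (num n)%:R + (q n)%:R / (q n.+1)%:R.
  by rewrite /y /x mulrDr mulrCA divff ?mulr1// gt_eqF.
have e2 : (q n)%:R * z n = (num n)%:R + 4 * (q n)%:R / (q n.+1)%:R.
  by rewrite /z /x mulrDr mulrCA divff ?mulr1 ?gt_eqF//; congr (_ + _); ring.
rewrite lerBrDl lerBlDl -e1 -e2; apply/andP.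
by split; rewrite ler_pM2l.
Qed.

Variable alpha : R.
Let eps n := (q n)%:R * alpha - (num n)%:R.
Hypothesis eps_bound : forall n, (0 < n)%N ->
  (q n)%:R / (q n.+1)%:R <= eps n <= 4 * (q n)%:R / (q n.+1)%:R.

(** Once [n > K], [q n ^ K eps n <= 4 q n ^ K.+1 / q n.+1 <= 4 / 2 ^ n]: the growing exponent of the
    growth condition overtakes any fixed power. *)
Lemma eps_decay (K : nat) (C d : R) : 0 < d -> exists N, forall n, (N <= n)%N ->
  C * ((q n)%:R ^+ K * eps n) <= d.
Proof.
move=> d0; pose t := Num.truncn (4 * `|C| / d).
exists (maxn K.+1 t.+1) => n; rewrite geq_max => /andP[Kn tn].
have n0 : (0 < n)%N by apply: leq_trans Kn.
have q1 := qR n0; have q2 : 0 < (q n.+1)%:R :> R by exact: qR.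
have /andP[e1 e2] := eps_bound n0.
have e0 : 0 <= eps n by apply: le_trans e1; rewrite divr_ge0.
have p0 : 0 <= (q n)%:R ^+ K * eps n by rewrite mulr_ge0// exprn_ge0.
apply: (@le_trans _ _ (`|C| * ((q n)%:R ^+ K * eps n))).
  by rewrite ler_wpM2r// ler_norm.
have h : (q n)%:R ^+ K * eps n <= 4 / 2 ^+ n.
  apply: (@le_trans _ _ ((q n)%:R ^+ K * (4 * (q n)%:R / (q n.+1)%:R))).
    by rewrite ler_wpM2l// exprn_ge0.
  rewrite (_ : _ * _ = 4 * (q n)%:R ^+ K.+1 / (q n.+1)%:R); last by rewrite exprSr; ring.
  rewrite ler_pdivrMr// mulrAC ler_pdivlMr ?exprn_gt0// -mulrA ler_wpM2l//.
  apply: (@le_trans _ _ ((q n)%:R ^+ n * 2 ^+ n)).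
    rewrite ler_wpM2r ?exprn_ge0//; apply: ler_weXn2l => //.
    by rewrite ler1n q_gt0.
  by rewrite mulrC -!natrX -natrM ler_nat q_pow.
apply: (@le_trans _ _ (`|C| * (4 / 2 ^+ n))); first by rewrite ler_wpM2l.
rewrite mulrCA mulrA ler_pdivrMr ?exprn_gt0//.
have := truncnS_gt (4 * `|C| / d); rewrite ltr_pdivrMr// => /ltW /le_trans; apply.
rewrite mulrC ler_wpM2l ?(ltW d0)//.
by rewrite -natrX ler_nat (leq_trans tn)// ltnW// ltn_expl.
Qed.

Lemma q_large (M : R) : exists N, forall n, (N <= n)%N -> M <= (q n)%:R.
Proof.
exists (Num.truncn M).+2 => n Nn; have := truncnS_gt M => /ltW /le_trans; apply.
rewrite ler_nat; case: n Nn => // n; rewrite ltnS => Nn.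
exact: leq_trans Nn (growth_ge n).
Qed.

Lemma eps_gt0 n : (0 < n)%N -> 0 < eps n.
Proof.
move=> n0; have /andP[h _] := eps_bound n0; apply: lt_le_trans h.
by rewrite divr_gt0// qR.
Qed.

(** Bounds the mixing time, about [1 / (2 eps n)], by the next term of the sequence. *)
Lemma eps_inv n : (0 < n)%N -> (eps n)^-1 <= (q n.+1)%:R.
Proof.
move=> n0; have /andP[h _] := eps_bound n0; have e0 := eps_gt0 n0.
have q2 : 0 < (q n.+1)%:R :> R by exact: qR.
rewrite -[leRHS]invrK lef_pV2 ?posrE ?invr_gt0//; apply: le_trans h.
by rewrite ler_peMl ?invr_ge0// ler1n q_gt0.
Qed.

End arithmetic.

Lemma max_level (a b c d e f g : nat) : exists n,
  [/\ (a < n)%N, (b <= n)%N, (c <= n)%N & [/\ (d <= n)%N, (e <= n)%N, (f <= n)%N & (g <= n)%N]].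
Proof. by exists (a + b + c + d + e + f + g).+1; repeat split; lia. Qed.

(** * Existence of the next conjugacy *)

Section next_stage.
Context {R : realType}.
Local Notation R2 := (measurableTypeR R * measurableTypeR R)%type.
Local Notation Esq := (expect (@square_measure R)).
Notation half := (2^-1 : R).

(** [level] records the index of the last term of [q] used as a frequency, 0 at the start. *)
Record stage := Stage {
  conj_map : R * R -> R * R;
  conj_inv : R * R -> R * R;
  level : nat;
  stageP : conj_pair conj_map conj_inv }.

Definition rotated (s : stage) (t : R) (z : R * R) : R * R :=
  conj_map s (rot t (conj_inv s z)).

Variables (q p : nat -> nat) (alpha : R).
Let eps n := (q n)%:R * alpha - (p n)%:R.
Hypothesis q_gt0 : forall n, (0 < n)%N -> (0 < q n)%N.
Hypothesis q_le : forall m n, (0 < m)%N -> (m <= n)%N -> (q m <= q n)%N.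
Hypothesis decay : forall (K : nat) (C d : R), 0 < d -> exists N, forall n, (N <= n)%N ->
  C * ((q n)%:R ^+ K * eps n) <= d.
Hypothesis large : forall M : R, exists N, forall n, (N <= n)%N -> M <= (q n)%:R.
Hypothesis eps_gt0 : forall n, (0 < n)%N -> 0 < eps n.
Hypothesis eps_inv : forall n, (0 < n)%N -> (eps n)^-1 <= (q n.+1)%:R.

(* The last four clauses give the smooth convergence, the control of the iterates up
   to the next level, the rigidity beyond it, and the mixing at one time. *)
Definition next_stage (j : nat) (s s' : stage) : Prop :=
  [/\ (level s < level s')%N,
      forall t, t = alpha \/ t = - alpha ->
        Ck_bounded j (fun z => (rotated s' t z).1 - (rotated s t z).1) (half ^+ j) /\
        Ck_bounded j (fun z => (rotated s' t z).2 - (rotated s t z).2) (half ^+ j),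
      forall (m : nat) z, (m <= q (level s'))%N ->
        `|rotated s' (m%:R * alpha) z - rotated s (m%:R * alpha) z| <= half ^+ j,
      forall n z, (level s' <= n)%N -> `|rotated s' (eps n) z - z| <= half ^+ j &
      exists m : nat, (m <= q (level s').+1)%N /\
        forall a b, test_fun j%:R a -> test_fun j%:R b ->
        `|Esq (fun z : R2 => a (rotated s' (m%:R * alpha) z) * b z) -
          Esq (a : R2 -> R) * Esq (b : R2 -> R)| <= half ^+ j].

(** [k], [b] and all the constants come from the given stage and from [j]. Six thresholds are thus
    known when [n] is chosen beyond them and beyond the previous level. *)
Lemma next_stage_exists j s : exists s', next_stage j s s'.
Proof.
case: s => H V n0 HV.
have h0 : 0 < half ^+ j by rewrite exprn_gt0// invr_gt0.
have h1 : half ^+ j <= 1 by rewrite exprn_ile1// ?invr_ge0// invf_le1// ler1n.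
have h2 : 0 < half ^+ j / 2 by rewrite divr_gt0.
have h4 : 0 < half ^+ j / 4 by rewrite divr_gt0.
have [k [b [C4 [k0 C40 HC4]]]] := conj_mixing HV (ler0n R j) h2.
have [C1 [C10 HC1]] := conj_smooth_close j b alpha HV k0.
have [C2 [C20 HC2]] := conj_smooth_close j b (- alpha) HV k0.
have [La [La1 HLa]] : exists L : R, 1 <= L /\ forall u v, `|H u - H v| <= L * `|u - v|.
  by case: HV => _ [tH _] _ _; exact: tame_lipschitz.
have La0 : 0 <= La by apply: le_trans La1.
have p0 : 0 <= 2 * pi :> R by rewrite mulr_ge0 ?pi_ge0.
pose kb := k%:R * `|b| * (2 * pi).
have kb0 : 0 <= kb by rewrite /kb !mulr_ge0 ?pi_ge0.
have [N1 HN1] := decay j C1 h0.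
have [N2 HN2] := decay j C2 h0.
have [N3 HN3] := decay 1 (La * kb) h0.
have [N4 HN4] := decay 1 (La * (1 + kb)) h0.
have [N5 HN5] := decay 0 C4 h4.
have [N6 HN6] := large (C4 / (half ^+ j / 4)).
have [n [n0n N1n N2n [N3n N4n N5n N6n]]] := max_level n0 N1 N2 N3 N4 N5 N6.
have n_gt0 : (0 < n)%N by apply: leq_ltn_trans n0n.
have qn0 : (0 < q n)%N by exact: q_gt0.
have qnR : 0 < (q n)%:R :> R by rewrite ltr0n.
have e0 : 0 < eps n by exact: eps_gt0.
have qa : (q n)%:R * alpha = (p n)%:R + eps n by rewrite /eps; ring.
exists (@Stage _ _ n (conj_pair_twist b k0 qn0 HV)).
have [[HVK VHK] _ _ _] := HV.
have [[HVK' VHK'] _ _ _] := conj_pair_twist b k0 qn0 HV.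
split; rewrite /rotated /=.
- exact: n0n.
- have HN1n : C1 * ((q n)%:R ^+ j * `|eps n|) <= half ^+ j.
    by rewrite gtr0_norm//; exact: HN1.
  have HN2n : C2 * ((q n)%:R ^+ j * `|- eps n|) <= half ^+ j.
    by rewrite normrN gtr0_norm//; exact: HN2.
  move=> t [->|->].
  + have [K1 K2] := HC1 (q n) (p n)%:R (eps n) qn0 (natr_int _ _) qa (le_trans HN1n h1).
    by split; [exact: Ck_bounded_le HN1n K1|exact: Ck_bounded_le HN1n K2].
  + have qa' : (q n)%:R * - alpha = - (p n)%:R + - eps n by rewrite mulrN qa opprD.
    have pint : - (p n)%:R \is a @Num.int R by rewrite rpredN natr_int.
    have [K1 K2] := HC2 (q n) (- (p n)%:R) (- eps n) qn0 pint qa' (le_trans HN2n h1).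
    by split; [exact: Ck_bounded_le HN2n K1|exact: Ck_bounded_le HN2n K2].
(* The offset of the m-th iterate is [m * eps n], at most [q n * eps n]. *)
- move=> m z mq; apply: le_trans (HLa _ _) _.
  have qm : (q n)%:R * (m%:R * alpha) = (m * p n)%:R + m%:R * eps n.
    by rewrite mulrCA qa natrM mulrDr.
  have := @twist_rot_close R k b (q n) (m%:R * alpha) (m * p n)%:R (m%:R * eps n) (V z) k0 (natr_int _ _) qm.
  move=> /(ler_wpM2l La0) /le_trans; apply.
  apply: le_trans (HN3 n N3n).
  rewrite normrM normr_nat (gtr0_norm e0) expr1.
  rewrite [X in X <= _](_ : _ = La * kb * (m%:R * eps n)); last by rewrite /kb; ring.
  apply: ler_wpM2l; first by rewrite mulr_ge0.
  by apply: ler_wpM2r; [exact: ltW|rewrite ler_nat].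
- move=> n' z nn'; have n'0 : (0 < n')%N by apply: leq_trans nn'.
  have e'0 : 0 < eps n' by exact: eps_gt0.
  (* Written at [y], the point and its image come from two points at distance [eps n'] under one
     map, [H] after the twist, whose Lipschitz constant is of order [q n <= q n']. *)
  set y := twist k (- b) (q n) (V z).
  have zE : z = H (twist k b (q n) y) by rewrite /y twistNK VHK.
  rewrite [X in _ - X]zE.
  apply: le_trans (HLa _ _) _.
  apply: le_trans (HN4 n' (leq_trans N4n nn')).
  rewrite -mulrA ler_wpM2l// expr1.
  apply: le_trans (along_norm _ _ _ _ k0) _.
  have -> : `|rot (eps n') y - y| = eps n'.
    rewrite /rot norm_pairE /= subrr normr0 addrAC subrr add0r gtr0_norm//.
    by rewrite max_l// ltW.
  have c1 : `|b * cos (2 * pi * (q n)%:R * phase k (rot (eps n') y)) - b * cos (2 * pi * (q n)%:R * phase k y)|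
      <= `|b| * (2 * pi * (q n')%:R * eps n').
    rewrite -mulrBr normrM ler_wpM2l// (le_trans (cos_lipschitz _ _))//.
    rewrite [X in `|X|](_ : _ = 2 * pi * (q n)%:R * eps n'); last by rewrite /phase /rot /=; ring.
    rewrite ger0_norm; last by rewrite !mulr_ge0 ?pi_ge0// ltW.
    by rewrite ler_wpM2r ?(ltW e'0)// ler_wpM2l// ler_nat q_le.
  apply: (@le_trans _ _ (eps n' + k%:R * (`|b| * (2 * pi * (q n')%:R * eps n')))).
    by rewrite lerD2l ler_wpM2l.
  have q'1 : 1 <= (q n')%:R :> R by rewrite ler1n q_gt0.
  rewrite (_ : (1 + kb) * _ = (q n')%:R * eps n' + k%:R * (`|b| * (2 * pi * (q n')%:R * eps n'))).
    by rewrite lerD2r ler_peMl// ltW.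
  by rewrite /kb; ring.
(* The largest time with [m * eps n <= 1 / 2]; the offset misses 1/2 by at most [eps n]. *)
- pose m := Num.truncn (1 / (2 * eps n)).
  have i0 : 0 <= 1 / (2 * eps n) by rewrite divr_ge0// mulr_ge0// ltW.
  have /andP[t1 t2] := truncn_itv i0.
  rewrite -/m in t1 t2.
  have me1 : m%:R * eps n <= 1 / 2.
    have := ler_wpM2r (ltW e0) t1; rewrite (_ : 1 / (2 * eps n) * eps n = 1 / 2)//.
    by field; rewrite gt_eqF.
  have me2 : 1 / 2 < m%:R * eps n + eps n.
    have : 1 / (2 * eps n) * eps n < m.+1%:R * eps n by rewrite ltr_pM2r.
    rewrite (_ : 1 / (2 * eps n) * eps n = 1 / 2); last by field; rewrite gt_eqF.
    by rewrite -[m.+1%:R]natr1 mulrDl [1 * eps n]mul1r.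
  have ee : `|m%:R * eps n - 1 / 2| <= eps n by rewrite ler_norml; apply/andP; split; lra.
  exists m; split.
    rewrite -(ler_nat R); apply: le_trans t1 _; apply: le_trans (eps_inv n_gt0).
    by rewrite div1r invfM ler_piMl ?invr_ge0 ?(ltW e0)// invf_le1// ler1n.
  move=> a1 a2 ta1 ta2.
  have qm : (q n)%:R * (m%:R * alpha) = (m * p n)%:R + 1 / 2 + (m%:R * eps n - 1 / 2).
    by rewrite mulrCA qa natrM mulrDr; ring.
  have := HC4 (q n) (m%:R * alpha) (m * p n)%:R _ qn0 (natr_int _ _) qm a1 a2 ta1 ta2.
  move=> /le_trans; apply.
  have f1 : C4 * (q n)%:R^-1 <= half ^+ j / 4.
    have : C4 / (half ^+ j / 4) <= (q n)%:R by exact: HN6.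
    by rewrite ler_pdivrMr// ler_pdivrMr// mulrC.
  have f2 : C4 * `|m%:R * eps n - 1 / 2| <= half ^+ j / 4.
    have : C4 * ((q n)%:R ^+ 0 * eps n) <= half ^+ j / 4 by exact: HN5.
    by rewrite expr0 mul1r; apply: le_trans; rewrite ler_wpM2l.
  by rewrite mulrDr; lra.
Qed.

End next_stage.

(** * The limit map *)

Section limit.
Context {R : realType}.
Local Notation R2 := (measurableTypeR R * measurableTypeR R)%type.
Local Notation Esq := (expect (@square_measure R)).
Notation half := (2^-1 : R).

Variables (q p : nat -> nat) (alpha : R).
Let eps n := (q n)%:R * alpha - (p n)%:R.
Hypothesis q_le : forall m n, (0 < m)%N -> (m <= n)%N -> (q m <= q n)%N.
Variable S : nat -> @stage R.
Hypothesis HS : forall j, next_stage q p alpha j (S j) (S j.+1).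

Let lev j := level (S j).
Let F j t := rotated (S j) t.

Lemma level_lt i j : (i < j)%N -> (lev i < lev j)%N.
Proof.
elim: j => // j IH; rewrite ltnS leq_eqVlt => /predU1P[->|/IH h].
  by have [] := HS j.
by apply: ltn_trans h _; have [] := HS j.
Qed.

Lemma level_le i j : (i <= j)%N -> (lev i <= lev j)%N.
Proof. by rewrite leq_eqVlt => /predU1P[->//|/level_lt/ltnW]. Qed.

Lemma level_ge j : (j <= lev j)%N.
Proof. by elim: j => // j IH; apply: leq_ltn_trans IH _; exact: level_lt. Qed.

(** Both signs are followed because the limit for [- alpha] is the inverse map. *)
Definition pm_alpha t := t = alpha \/ t = - alpha.

Lemma rotated0 s (z : R * R) : rotated s 0 z = z.
Proof.
have [[_ K] _ _ _] := stageP s; rewrite /rotated (_ : rot 0 _ = conj_inv s z) ?K//.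
by rewrite /rot addr0 -surjective_pairing.
Qed.

Lemma rotatedD s t u (z : R * R) : rotated s t (rotated s u z) = rotated s (u + t) z.
Proof. by have [[K _] _ _ _] := stageP s; rewrite /rotated K rotD. Qed.

Lemma rotated_equivariant (s : @stage R) t : equivariant (rotated s t).
Proof.
have [_ _ [eH eV] _] := stageP s.
exact: (equivariant_comp eH (equivariant_comp (@equivariant_rot _ t) eV)).
Qed.

Lemma rotated_tame (s : @stage R) t : tame (rotated s t).
Proof.
have [_ [tH tV] _ _] := stageP s.
exact: (tame_comp tH (tame_comp (@tame_rot _ t) tV)).
Qed.

Lemma rotated_square_preserving (s : @stage R) t : square_preserving (rotated s t).
Proof.
have [_ _ [eH eV] [sH sV]] := stageP s.
apply: (square_preserving_comp (equivariant_lattice_map eH) sH).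
exact: (square_preserving_comp (equivariant_lattice_map (@equivariant_rot _ t))
  (square_preserving_rot t) sV).
Qed.

Lemma F_step t j z : pm_alpha t -> `|F j.+1 t z - F j t z| <= half ^+ j.
Proof.
move=> ht; have [_ /(_ t ht) [H1 H2] _ _ _] := HS j.
by apply: norm_pairP; [exact: (Ck_bounded_sup z H1)|exact: (Ck_bounded_sup z H2)].
Qed.

Definition limF t (z : R * R) : R * R :=
  (lim ((F j t z).1 @[j --> \oo]), lim ((F j t z).2 @[j --> \oo])).

Lemma F_cvg1 t z : pm_alpha t -> (F j t z).1 @[j --> \oo] --> (limF t z).1.
Proof.
move=> ht; apply: geometric_cvg => j; apply: le_trans (F_step j z ht).
exact: (norm_pair_fst (F j.+1 t z - F j t z)).
Qed.

Lemma F_cvg2 t z : pm_alpha t -> (F j t z).2 @[j --> \oo] --> (limF t z).2.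
Proof.
move=> ht; apply: geometric_cvg => j; apply: le_trans (F_step j z ht).
exact: (norm_pair_snd (F j.+1 t z - F j t z)).
Qed.

Lemma F_close t j z : pm_alpha t -> `|limF t z - F j t z| <= 2 * half ^+ j.
Proof.
move=> ht; apply: norm_pairP => /=.
- apply: (@geometric_tail_lim _ (fun j => (F j t z).1)); last exact: F_cvg1.
  by move=> i; apply: le_trans (F_step i z ht); exact: (norm_pair_fst (F i.+1 t z - F i t z)).
- apply: (@geometric_tail_lim _ (fun j => (F j t z).2)); last exact: F_cvg2.
  by move=> i; apply: le_trans (F_step i z ht); exact: (norm_pair_snd (F i.+1 t z - F i t z)).
Qed.

(** Step j is controlled to order j only, so the sequence is started at stage [k.+1]. *)
Lemma limF_Ck t k : pm_alpha t -> Ck k (fun z => (limF t z).1) /\ Ck k (fun z => (limF t z).2).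
Proof.
move=> ht.
have hk j : half ^+ (j + k.+1) <= half ^+ j.
  by rewrite exprD ler_piMr ?exprn_ge0 ?invr_ge0// exprn_ile1 ?invr_ge0// invf_le1// ler1n.
have [M [M1 M2]] := rotated_tame (S k.+1) t k.+1.
split.
- have -> : (fun z => (limF t z).1) = (fun z => ((limF t z).1 - z.1) + z.1).
    by apply/funext => z; rewrite subrK.
  apply: CkD (Ck_fst _).
  apply: (@Ck_limit _ k (fun j z => (F (j + k.+1) t z).1 - z.1) _ M) => //.
  + move=> j; have [_ /(_ t ht) [H1 _] _ _ _] := HS (j + k.+1).
    apply: Ck_bounded_ext (Ck_bounded_leq (leq_addl j k.+1) (Ck_bounded_le (hk j) H1)) => z.
    by rewrite addSn; ring.
  + move=> z; apply: cvgB; last exact: cvg_cst.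
    by rewrite (cvg_shiftn k.+1 (fun j => (F j t z).1)); exact: F_cvg1.
- have -> : (fun z => (limF t z).2) = (fun z => ((limF t z).2 - z.2) + z.2).
    by apply/funext => z; rewrite subrK.
  apply: CkD (Ck_snd _).
  apply: (@Ck_limit _ k (fun j z => (F (j + k.+1) t z).2 - z.2) _ M) => //.
  + move=> j; have [_ /(_ t ht) [_ H1] _ _ _] := HS (j + k.+1).
    apply: Ck_bounded_ext (Ck_bounded_leq (leq_addl j k.+1) (Ck_bounded_le (hk j) H1)) => z.
    by rewrite addSn; ring.
  + move=> z; apply: cvgB; last exact: cvg_cst.
    by rewrite (cvg_shiftn k.+1 (fun j => (F j t z).2)); exact: F_cvg2.
Qed.

Lemma limF_equivariant t : pm_alpha t -> equivariant (limF t).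
Proof.
move=> ht z l hl; apply: injective_projections => /=.
- apply: cvg_lim => //.
  have -> : (fun j => (F j t (z + l)).1) = (fun j => (F j t z).1 + l.1).
    by apply/funext => j; rewrite /F rotated_equivariant.
  by apply: cvgD; [exact: F_cvg1|exact: cvg_cst].
- apply: cvg_lim => //.
  have -> : (fun j => (F j t (z + l)).2) = (fun j => (F j t z).2 + l.2).
    by apply/funext => j; rewrite /F rotated_equivariant.
  by apply: cvgD; [exact: F_cvg2|exact: cvg_cst].
Qed.

Lemma limF_continuous t : pm_alpha t -> continuous (limF t).
Proof.
move=> ht z; have [c1 c2] := limF_Ck 0 ht.
have -> : limF t = (fun z => ((limF t z).1, (limF t z).2)).
  by apply/funext => w; rewrite -surjective_pairing.
exact: (cvg_pair (c1 z) (c2 z)).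
Qed.

(** Uniform convergence to a continuous limit permits moving arguments, as needed to pass to the
    limit in iterates and in the inverse relation. *)
Lemma F_cvg_comp t (z : R * R) (w : nat -> R * R) : pm_alpha t ->
  w j @[j --> \oo] --> z -> F j t (w j) @[j --> \oo] --> limF t z.
Proof.
move=> ht wz.
have h1 : limF t (w j) @[j --> \oo] --> limF t z.
  exact: (continuous_cvg _ (@limF_continuous _ ht z) wz).
apply/cvgrPdist_le => /= e e0; have e2 : 0 < e / 2 by rewrite divr_gt0.
have /cvgrPdist_le /(_ _ e2) H1 := h1.
have /cvgrPdist_le /(_ _ e2) H2 := @half_cvg0 R.
near=> j.
rewrite (_ : _ - _ = (limF t z - limF t (w j)) + (limF t (w j) - F j t (w j))); last by rewrite addrA subrK.
rewrite (le_trans (ler_normD _ _))// [leRHS]splitr lerD//; first by near: j.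
apply: le_trans (F_close j (w j) ht) _.
have : `|0 - 2 * half ^+ j| <= e / 2 by near: j.
by rewrite sub0r normrN; apply: le_trans; exact: ler_norm.
Unshelve. all: by end_near. Qed.

Lemma F_cvg t z : pm_alpha t -> F j t z @[j --> \oo] --> limF t z.
Proof. by move=> ht; apply: (@F_cvg_comp t z (fun=> z)) => //; exact: cvg_cst. Qed.

Lemma limF_cancel t : pm_alpha t -> pm_alpha (- t) -> cancel (limF t) (limF (- t)).
Proof.
move=> ht hnt z.
have h : F j (- t) (F j t z) @[j --> \oo] --> limF (- t) (limF t z).
  by apply: F_cvg_comp => //; exact: F_cvg.
have E : (fun j => F j (- t) (F j t z)) = (fun=> z).
  by apply/funext => j; rewrite /F rotatedD subrr rotated0.
rewrite E in h; apply: (@cvg_unique _ _ _ _ _ _ h); last exact: cvg_cst.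
exact: norm_hausdorff.
Qed.

Let alphaP : pm_alpha alpha. Proof. by left. Qed.

Lemma F_iter_cvg m z : F j (m%:R * alpha) z @[j --> \oo] --> iter m (limF alpha) z.
Proof.
elim: m => [|m IH].
  have -> : (fun j => F j (0%:R * alpha) z) = (fun=> z).
    by apply/funext => j; rewrite mul0r /F rotated0.
  exact: cvg_cst.
have -> : (fun j => F j (m.+1%:R * alpha) z) = (fun j => F j alpha (F j (m%:R * alpha) z)).
  by apply/funext => j; rewrite /F rotatedD -natr1 mulrDl mul1r.
exact: F_cvg_comp.
Qed.

(** From stage j on, [m] is below the term of every new level, so step i moves the m-th iterate by
    at most [half ^+ i]. *)
Lemma F_iter_close m j z : (m <= q (lev j.+1))%N ->
  `|iter m (limF alpha) z - F j (m%:R * alpha) z| <= 2 * half ^+ j.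
Proof.
move=> mj.
(* Frozen at stage j for [i < j], so that the geometric step bound holds from [i = 0] on. *)
pose v i := F (maxn i j) (m%:R * alpha) z.
have vs i : `|v i.+1 - v i| <= half ^+ i.
  rewrite /v; have [ij|ji] := ltnP i j.
    have -> : maxn i.+1 j = j by apply/maxn_idPr.
    by rewrite subrr normr0 exprn_ge0// invr_ge0.
  have -> : maxn i.+1 j = i.+1 by apply/maxn_idPl; exact: leqW.
  have [_ _ /(_ m z) H _ _] := HS i; apply: H; apply: leq_trans mj _.
  apply: q_le; first exact: leq_trans (level_ge j.+1).
  by apply: level_le; rewrite ltnS.
have vE i : v (i + j)%N = F (i + j) (m%:R * alpha) z.
  by rewrite /v (maxn_idPl (leq_addl _ _)).
have vc1 : (v i).1 @[i --> \oo] --> (iter m (limF alpha) z).1.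
  have h : (F i (m%:R * alpha) z).1 @[i --> \oo] --> (iter m (limF alpha) z).1.
    apply/cvgrPdist_le => /= e e0.
    have /cvgrPdist_le/(_ _ e0) := @F_iter_cvg m z; apply: filterS => i; apply: le_trans.
    exact: (norm_pair_fst (iter m (limF alpha) z - F i (m%:R * alpha) z)).
  rewrite -(cvg_shiftn j (fun i => (F i (m%:R * alpha) z).1)) in h.
  rewrite -(cvg_shiftn j (fun i => (v i).1)).
  by rewrite (_ : (fun i => (v (i + j)%N).1) = (fun i => (F (i + j) (m%:R * alpha) z).1))//;
    apply/funext => i; rewrite vE.
have vc2 : (v i).2 @[i --> \oo] --> (iter m (limF alpha) z).2.
  have h : (F i (m%:R * alpha) z).2 @[i --> \oo] --> (iter m (limF alpha) z).2.
    apply/cvgrPdist_le => /= e e0.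
    have /cvgrPdist_le/(_ _ e0) := @F_iter_cvg m z; apply: filterS => i; apply: le_trans.
    exact: (norm_pair_snd (iter m (limF alpha) z - F i (m%:R * alpha) z)).
  rewrite -(cvg_shiftn j (fun i => (F i (m%:R * alpha) z).2)) in h.
  rewrite -(cvg_shiftn j (fun i => (v i).2)).
  by rewrite (_ : (fun i => (v (i + j)%N).2) = (fun i => (F (i + j) (m%:R * alpha) z).2))//;
    apply/funext => i; rewrite vE.
have -> : F j (m%:R * alpha) z = v j by rewrite /v maxnn.
apply: norm_pairP => /=.
- apply: (@geometric_tail_lim _ (fun i => (v i).1)) => // i.
  by apply: le_trans (vs i); exact: (norm_pair_fst (v i.+1 - v i)).
- apply: (@geometric_tail_lim _ (fun i => (v i).2)) => // i.
  by apply: le_trans (vs i); exact: (norm_pair_snd (v i.+1 - v i)).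
Qed.

Lemma limF_measurable t : pm_alpha t -> measurable_fun [set: R2] (limF t : R2 -> R2).
Proof.
move=> ht.
have -> : limF t = (fun z => ((limF t z).1, (limF t z).2)).
  by apply/funext => w; rewrite -surjective_pairing.
have mF j : measurable_fun [set: R2] (F j t : R2 -> R2).
  by have [] := rotated_square_preserving (S j) t.
apply: measurable_fun_pair.
- apply: (@measurable_fun_cvg _ R2 R setT (fun j z => (F j t z).1)).
    by move=> j; exact: (measurableT_comp measurable_fst (mF j)).
  by move=> z _; exact: F_cvg1.
- apply: (@measurable_fun_cvg _ R2 R setT (fun j z => (F j t z).2)).
    by move=> j; exact: (measurableT_comp measurable_snd (mF j)).
  by move=> z _; exact: F_cvg2.
Qed.

Lemma small_le (x C : R) : 0 <= C -> (forall j, x <= C * half ^+ j) -> x <= 0.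
Proof.
move=> C0 H; apply: (@cvgr_to_ge _ \oo _ _ (fun j => C * half ^+ j)); last by exists 0%N => // j _; exact: H.
rewrite -[X in _ --> X](mulr0 C); apply: cvgM; first exact: cvg_cst.
by apply: cvg_expr; rewrite ger0_norm ?invr_ge0// invf_lt1// ltr1n.
Qed.

(** Uniform convergence passes to the limit for Lipschitz observables; measurable sets are reached
    later by approximation. *)
Lemma limF_expect t L a : pm_alpha t -> test_fun L a ->
  Esq (fun z : R2 => a (limF t z)) = Esq (a : R2 -> R).
Proof.
move=> ht ta; have L0 := test_fun_ge0 ta; have ba := test_fun_bounded ta.
apply/eqP; rewrite -subr_eq0 -normr_le0.
apply: (@small_le _ (L * 2)) => [|j]; first by rewrite mulr_ge0.
have [mF _] := rotated_square_preserving (S j) t.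
rewrite -(@square_expect_comp R a _ (rotated_square_preserving (S j) t)) //; last by case: ta.
apply: expect_dist.
- exact: (bounded_mfun_comp ba (limF_measurable ht)).
- exact: (bounded_mfun_comp ba mF).
move=> z; have [_ _ aL] := ta; rewrite (le_trans (aL _ _))// -mulrA ler_wpM2l//.
exact: F_close.
Qed.

(** The mixing time of step j is at most [q (lev j.+1).+1 <= q (lev j.+2)], hence short enough for
    [F j.+1] to follow the limit. The times are chosen before the observables. *)
Lemma limF_mixing : exists m : nat -> nat, forall L a b, test_fun L a -> test_fun L b ->
  forall e, 0 < e -> exists N, forall j, (N <= j)%N ->
  `|Esq (fun z : R2 => a (iter (m j) (limF alpha) z) * b z) -
    Esq (a : R2 -> R) * Esq (b : R2 -> R)| <= e.
Proof.
have H j : exists m, (m <= q (lev j.+1).+1)%N /\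
    forall a b, test_fun j%:R a -> test_fun j%:R b ->
      `|Esq (fun z : R2 => a (F j.+1 (m%:R * alpha) z) * b z) -
          Esq (a : R2 -> R) * Esq (b : R2 -> R)| <= half ^+ j.
  by have [_ _ _ _ h] := HS j.
have [m Hm] := choice H; clear H.
exists m => L a b ta tb.
have L0 := test_fun_ge0 ta.
have miter k : measurable_fun [set: R2] (iter k (limF alpha) : R2 -> R2).
  elim: k => [|k IH]; first exact: measurable_id.
  exact: (measurableT_comp (limF_measurable alphaP) IH).
have ba := test_fun_bounded ta; have bb := test_fun_bounded tb.
have key j : L <= j%:R -> `|Esq (fun z : R2 => a (iter (m j) (limF alpha) z) * b z) -
     Esq (a : R2 -> R) * Esq (b : R2 -> R)| <= (L + 1) * (2 * half ^+ j).
  move=> Lj; have [mj H] := Hm j.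
  have up c : test_fun L c -> test_fun j%:R c.
    by move=> [pc c1 cL]; split => // u v; apply: le_trans (cL _ _) _; rewrite ler_wpM2r.
  have := H a b (up _ ta) (up _ tb) => {}H.
  have [mF _] := rotated_square_preserving (S j.+1) ((m j)%:R * alpha).
  have C : `|Esq (fun z : R2 => a (iter (m j) (limF alpha) z) * b z) -
     Esq (fun z : R2 => a (F j.+1 ((m j)%:R * alpha) z) * b z)| <= L * (2 * half ^+ j).
    apply: expect_dist.
    - by apply: bounded_mfunM => //; exact: (bounded_mfun_comp ba (miter _)).
    - by apply: bounded_mfunM => //; exact: (bounded_mfun_comp ba mF).
    move=> z; rewrite -mulrBl normrM -[leRHS]mulr1.
    have [_ _ aL] := ta; have [_ b1 _] := tb.
    apply: ler_pM => //; rewrite (le_trans (aL _ _))// ler_wpM2l//.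
    have h : (m j <= q (lev j.+2))%N.
      by apply: leq_trans mj _; apply: q_le => //; exact: level_lt.
    apply: le_trans (F_iter_close z h) _.
    by rewrite ler_wpM2l// exprS ler_piMl ?exprn_ge0 ?invr_ge0// invf_le1// ler1n.
  rewrite -(subrK (Esq (fun z : R2 => a (F j.+1 ((m j)%:R * alpha) z) * b z))
    (Esq (fun z : R2 => a (iter (m j) (limF alpha) z) * b z))) -addrA.
  apply: le_trans (ler_normD _ _) _; rewrite mulrDl mul1r lerD//.
  by apply: le_trans H _; rewrite ler_peMl ?exprn_ge0 ?invr_ge0// ler1n.
move=> e e0.
have L1 : 0 < L + 1 by rewrite ltr_wpDl.
have e1 : 0 < e / (L + 1) by rewrite divr_gt0.
have /cvgrPdist_le /(_ _ e1) [J _ HJ] := @half_cvg0 R.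
exists (maxn J (Num.truncn L).+1) => j; rewrite geq_max => /andP[Jj Lj].
apply: le_trans (key j _) _.
  by have := truncnS_gt L => /ltW /le_trans; apply; rewrite ler_nat.
rewrite mulrC -ler_pdivlMr//.
by have := HJ j Jj; rewrite /= sub0r normrN; apply: le_trans; exact: ler_norm.
Qed.

Lemma level_bracket J n : (lev J <= n)%N -> exists j, (J <= j)%N /\ (lev j <= n < lev j.+1)%N.
Proof.
move=> Jn; elim: n Jn => [|n IH].
  rewrite leqn0 => /eqP h; exists J; split => //.
  by rewrite h /= (leq_ltn_trans (leq0n (lev J)))// level_lt.
rewrite leq_eqVlt => /predU1P[h|].
  by exists J; split => //; rewrite -h leqnn /= level_lt.
rewrite ltnS => /IH [j [Jj /andP[h1 h2]]].
move: h2; rewrite leq_eqVlt => /predU1P[h|h].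
  by exists j.+1; split; [exact: leqW|rewrite -h leqnn /= h level_lt].
by exists j; split => //; rewrite (leqW h1).
Qed.

(** Every large n lies between two consecutive levels. There the iterate [q n] still follows
    [F j.+1], for which rotation by [q n * alpha] is rotation by [eps n] up to the integer [p n],
    and the rigidity clause of [next_stage] applies. *)
Lemma limF_rigid (e : R) : 0 < e -> exists N, forall n, (N <= n)%N ->
  forall z, `|iter (q n) (limF alpha) z - (z + ((p n)%:R, 0))| <= e.
Proof.
move=> e0; have e2 : 0 < e / 2 by rewrite divr_gt0.
have /cvgrPdist_le /(_ _ e2) [J _ HJ] := @half_cvg0 R.
exists (lev J.+1) => n Jn z.
have [j [Jj /andP[h1 h2]]] := level_bracket Jn.
case: j Jj h1 h2 => // j; rewrite ltnS => Jj h1 h2.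
have n0 : (0 < n)%N by apply: leq_trans h1; apply: leq_trans (level_ge j.+1).
have hj : 2 * half ^+ j <= e / 2.
  have := HJ j Jj; rewrite /= sub0r normrN; apply: le_trans; exact: ler_norm.
have hj1 : half ^+ j.+1 <= half ^+ j.
  by rewrite exprS ler_piMl ?exprn_ge0 ?invr_ge0// invf_le1// ler1n.
have hp : 0 <= half ^+ j by rewrite exprn_ge0// invr_ge0.
have C1 : `|iter (q n) (limF alpha) z - F j.+1 ((q n)%:R * alpha) z| <= 2 * half ^+ j.+1.
  by apply: F_iter_close; apply: q_le => //; exact: ltnW.
have E : F j.+1 ((q n)%:R * alpha) z = F j.+1 (eps n) z + ((p n)%:R, 0).
  rewrite /F /rotated (_ : rot _ _ = rot (eps n) (conj_inv (S j.+1) z) + ((p n)%:R, 0)).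
    have [_ _ [eH _] _] := stageP (S j.+1).
    by rewrite eH// /int_lattice /= natr_int rpred0.
  by rewrite /rot /eps; apply: injective_projections => /=; ring.
have [_ _ _ /(_ n z h1) C2 _] := HS j.
rewrite (_ : _ - _ = (iter (q n) (limF alpha) z - F j.+1 ((q n)%:R * alpha) z) + (F j.+1 (eps n) z - z)).
  apply: le_trans (ler_normD _ _) _; apply: le_trans (lerD C1 C2) _; lra.
rewrite E; move: (iter _ _ _) (F _ _ _) => x y; rewrite !opprD !addrA.
by apply: injective_projections => /=; ring.
Qed.

End limit.

(** * Weak mixing from mixing along a sequence of times *)

Section cesaro.
Context {R : realType}.

Lemma sum_succ (v : nat -> R) N :
  \sum_(1 <= n < N.+1) v n + v N.+1 = v 1%N + \sum_(1 <= n < N.+1) v n.+1.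
Proof.
elim: N => [|N IH]; first by rewrite !big_geq// addrC.
by rewrite big_nat_recr//= IH [in RHS]big_nat_recr//= addrA.
Qed.

(** Each unit shift of the window drops one term, at most 1, and gains a nonnegative one. *)
Lemma sum_shift_le (u : nat -> R) (k N : nat) : (forall n, 0 <= u n <= 1) ->
  \sum_(1 <= n < N.+1) u n <= \sum_(1 <= n < N.+1) u (n + k)%N + k%:R.
Proof.
move=> u1; elim: k => [|k IH].
  by rewrite addr0; under [leRHS]eq_bigr do rewrite addn0.
apply: le_trans IH _; rewrite -[k.+1%:R]natr1 addrA [leRHS]addrAC lerD2r.
have := sum_succ (fun n => u (n + k)%N) N.
under [X in _ = _ + X]eq_bigr do rewrite addSnnS.
have /andP[h1 h2] := u1 (1 + k)%N; have /andP[h3 h4] := u1 (N.+1 + k)%N.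
move: (\sum_(1 <= n < N.+1) u (n + k)%N) => x; lra.
Qed.

(* Averaging the hypothesis over n bounds the mean of [c n ^ 2] by [2 / L]. *)
Lemma cesaro_abs_cvg0 (c : nat -> R) : (forall n, `|c n| <= 1) ->
  (forall L, (0 < L)%N -> exists k : nat -> nat, forall n, \sum_(i < L) c (n + k i)%N ^+ 2 <= 2) ->
  N%:R^-1 * \sum_(1 <= n < N.+1) `|c n| @[N --> \oo] --> (0 : R).
Proof.
move=> c1 H; apply/cvgrPdist_le => /= e e0.
(* One third of [e] pays for the small terms, two thirds for the mean square, through
   [2 / L <= eta ^+ 2] and [K <= N eta ^+ 2] for large [N]. *)
pose eta := e / 3; have eta0 : 0 < eta by rewrite divr_gt0.
pose L := (Num.truncn (2 / (eta * eta))).+1.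
have LR : 0 < L%:R :> R by rewrite ltr0n.
have L2 : 2 <= L%:R * (eta * eta).
  have := truncnS_gt (2 / (eta * eta)); rewrite -/L ltr_pdivrMr ?mulr_gt0//.
  by move/ltW.
have [k Hk] := H L isT.
pose K := (\sum_(i < L) k i)%N.
pose u n := c n ^+ 2.
have u1 n : 0 <= u n <= 1.
  by rewrite /u sqr_ge0 -real_normK ?num_real//= exprn_ile1.
have key N : L%:R * (\sum_(1 <= n < N.+1) u n) <= 2 * N%:R + L%:R * K%:R.
  have -> : L%:R * (\sum_(1 <= n < N.+1) u n) = \sum_(i < L) \sum_(1 <= n < N.+1) u n.
    by rewrite sumr_const card_ord mulr_natl.
  apply: (@le_trans _ _ (\sum_(i < L) (\sum_(1 <= n < N.+1) u (n + k i)%N + K%:R))).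
    apply: ler_sum => i _; apply: le_trans (sum_shift_le (k i) N u1) _.
    by rewrite lerD2l ler_nat /K (bigD1 i)//= leq_addr.
  rewrite big_split /= sumr_const card_ord -[X in _ + X <= _]mulr_natl lerD2r exchange_big /=.
  apply: (@le_trans _ _ (\sum_(1 <= n < N.+1) 2)); first by apply: ler_sum => n _; exact: Hk.
  by rewrite sumr_const_nat subSS subn0 mulr_natr.
(* Where [|c n|] exceeds [eta] it is at most [c n ^+ 2 / eta], so the mean square controls the
   mean. *)
have absle n : `|c n| <= eta + u n / eta.
  have [h|h] := leP `|c n| eta.
    by rewrite (le_trans h)// lerDl divr_ge0// ?(ltW eta0)//; have /andP[] := u1 n.
  rewrite -[leLHS]add0r lerD// ?(ltW eta0)// ler_pdivlMr// /u -real_normK ?num_real// expr2.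
  by rewrite ler_wpM2l// ltW.
near=> N.
have N0 : 0 < N%:R :> R by rewrite ltr0n; near: N; exists 1%N.
have NK : K%:R / (eta * eta) <= N%:R.
  near: N; exists (Num.truncn (K%:R / (eta * eta) : R)).+1 => // N /= hN.
  have := truncnS_gt (K%:R / (eta * eta) : R) => /ltW /le_trans; apply.
  by rewrite ler_nat.
have s0 : 0 <= \sum_(1 <= n < N.+1) `|c n| by apply: sumr_ge0.
rewrite sub0r normrN ger0_norm; last by rewrite mulr_ge0// invr_ge0 ltW.
rewrite mulrC ler_pdivrMr//.
have h1 : \sum_(1 <= n < N.+1) `|c n| <= N%:R * eta + (\sum_(1 <= n < N.+1) u n) / eta.
  apply: (@le_trans _ _ (\sum_(1 <= n < N.+1) (eta + u n / eta))).
    by apply: ler_sum => n _; exact: absle.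
  by rewrite big_split /= sumr_const_nat subSS subn0 mulr_natl mulr_suml.
apply: le_trans h1 _.
have h2 : \sum_(1 <= n < N.+1) u n <= 2 / L%:R * N%:R + K%:R.
  have := key N; rewrite -ler_pdivlMl// mulrDr mulKf ?gt_eqF//.
  by rewrite mulrA [_^-1 * 2]mulrC.
have h3 : (\sum_(1 <= n < N.+1) u n) / eta <= 2 * eta * N%:R.
  rewrite ler_pdivrMr//; apply: le_trans h2 _.
  have a1 : 2 / L%:R <= eta * eta by rewrite ler_pdivrMr// mulrC.
  have a2 : K%:R <= N%:R * (eta * eta) by rewrite -ler_pdivrMr// mulr_gt0.
  have a3 : 2 / L%:R * N%:R <= eta * eta * N%:R by rewrite ler_wpM2r// ltW.
  have : 2 * eta * N%:R * eta = eta * eta * N%:R + N%:R * (eta * eta) by ring.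
  lra.
have ee : e = 3 * eta by rewrite /eta mulrC divfK.
apply: le_trans (lerD (lexx _) h3) _; rewrite ee; lra.
Unshelve. all: by end_near. Qed.

End cesaro.

(** * A Bessel inequality for almost orthogonal families *)

Section bessel.
Context d (X : measurableType d) (R : realType) (P : probability X R).

Lemma expect_sum2 L (f : nat -> nat -> X -> R) : (forall i j, bounded_mfun (f i j)) ->
  expect P (fun x => \sum_(i < L) \sum_(j < L) f i j x) =
  \sum_(i < L) \sum_(j < L) expect P (f i j).
Proof.
move=> bf; rewrite (@expect_sum _ _ _ P L (fun i x => \sum_(j < L) f i j x)).
  by apply: eq_bigr => i _; exact: expect_sum.
by move=> i; exact: bounded_mfun_sum.
Qed.

(* Expand [(M x - y) ^ 2] with [y] the sum of the [<x, e i> e i]. *)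
Lemma bessel_bound L (x : X -> R) (e : nat -> X -> R) (M : R) : bounded_mfun x ->
  (forall i, bounded_mfun (e i)) -> expect P (fun z => x z ^+ 2) <= 1 -> 0 < M ->
  (forall i, (i < L)%N -> \sum_(j < L) `|expect P (fun z => e i z * e j z)| <= M) ->
  \sum_(i < L) expect P (fun z => x z * e i z) ^+ 2 <= M.
Proof.
move=> bx be x1 M0 HM.
pose a i := expect P (fun z => x z * e i z).
pose g i j := expect P (fun z => e i z * e j z).
pose s := \sum_(i < L) a i ^+ 2.
pose y z := \sum_(i < L) a i * e i z.
have by_ : bounded_mfun y.
  by apply: (@bounded_mfun_sum _ _ _ L (fun i z => a i * e i z)) => i; exact: bounded_mfunZ.
have Exy : expect P (fun z => x z * y z) = s.
  have -> : (fun z => x z * y z) = (fun z => \sum_(i < L) a i * (x z * e i z)).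
    by apply/funext => z; rewrite mulr_sumr; apply: eq_bigr => i _; ring.
  rewrite (@expect_sum _ _ _ P L (fun i z => a i * (x z * e i z))).
    by apply: eq_bigr => i _; rewrite expectZ ?expr2//; exact: bounded_mfunM.
  by move=> i; apply: bounded_mfunZ; exact: bounded_mfunM.
have Eyy : expect P (fun z => y z * y z) = \sum_(i < L) \sum_(j < L) (a i * a j) * g i j.
  have -> : (fun z => y z * y z) = (fun z => \sum_(i < L) \sum_(j < L) (a i * a j) * (e i z * e j z)).
    apply/funext => z; rewrite mulr_suml; apply: eq_bigr => i _.
    by rewrite mulr_sumr; apply: eq_bigr => j _; ring.
  rewrite (@expect_sum2 L (fun i j z => (a i * a j) * (e i z * e j z))).
    apply: eq_bigr => i _; apply: eq_bigr => j _; rewrite expectZ//.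
    exact: bounded_mfunM.
  by move=> i j; apply: bounded_mfunZ; exact: bounded_mfunM.
have gC i j : g i j = g j i.
  by rewrite /g; congr expect; apply/funext => z; rewrite mulrC.
have Eyy_le : expect P (fun z => y z * y z) <= M * s.
  rewrite Eyy.
  (* Schur test: the weight of a pair is split between its two indices, so that bounds on the row
     sums of the Gram matrix suffice. *)
  have hij i j : a i * a j * g i j <= (a i ^+ 2 * `|g i j| + a j ^+ 2 * `|g j i|) / 2.
    rewrite (gC j i) -mulrDl [leRHS]mulrAC.
    apply: (@le_trans _ _ (`|a i * a j| * `|g i j|)); first by rewrite -normrM ler_norm.
    rewrite ler_wpM2r// normrM.
    rewrite -[a i ^+ 2]real_normK ?num_real// -[a j ^+ 2]real_normK ?num_real//.
    have := sqr_ge0 (`|a i| - `|a j|); move: `|a i| `|a j| => u v; nra.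
  apply: (@le_trans _ _ (\sum_(i < L) \sum_(j < L) (a i ^+ 2 * `|g i j| + a j ^+ 2 * `|g j i|) / 2)).
    by apply: ler_sum => i _; apply: ler_sum => j _; exact: hij.
  have -> : \sum_(i < L) \sum_(j < L) (a i ^+ 2 * `|g i j| + a j ^+ 2 * `|g j i|) / 2 =
      \sum_(i < L) \sum_(j < L) a i ^+ 2 * `|g i j|.
    have E : \sum_(i < L) \sum_(j < L) (a i ^+ 2 * `|g i j| + a j ^+ 2 * `|g j i|) =
        2 * \sum_(i < L) \sum_(j < L) a i ^+ 2 * `|g i j|.
      under eq_bigr do rewrite big_split/=.
      rewrite big_split /= [X in _ + X]exchange_big /=; ring.
    under eq_bigr do rewrite -mulr_suml.
    by rewrite -mulr_suml E; field.
  rewrite /s mulr_sumr; apply: ler_sum => i _.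
  by rewrite -mulr_sumr mulrC ler_wpM2r ?sqr_ge0// HM.
have sq : 0 <= expect P (fun z => (M * x z - y z) ^+ 2) by apply: expect_ge0 => z; exact: sqr_ge0.
have bxx : bounded_mfun (fun z => x z ^+ 2) by apply: bounded_mfunM.
have byy : bounded_mfun (fun z => y z * y z) by apply: bounded_mfunM.
have bxy : bounded_mfun (fun z => x z * y z) by apply: bounded_mfunM.
have Esq : expect P (fun z => (M * x z - y z) ^+ 2) =
    M ^+ 2 * expect P (fun z => x z ^+ 2) + ((- 2 * M) * s + expect P (fun z => y z * y z)).
  rewrite -Exy -!expectZ// -expectD//; last exact: bounded_mfunZ.
  rewrite -expectD//; [|exact: bounded_mfunZ|by apply: bounded_mfunD => //; exact: bounded_mfunZ].
  by congr expect; apply/funext => z; ring.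
(* Nonnegativity of the expanded square gives [0 <= M ^+ 2 - 2 M s + M s]. *)
have : M * s <= M * M.
  have : M ^+ 2 * expect P (fun z => x z ^+ 2) <= M ^+ 2 by rewrite ler_piMr// sqr_ge0.
  move: sq; rewrite Esq; move: (expect P _) Eyy_le => ee he; lra.
by rewrite ler_pM2l.
Qed.

End bessel.

Section weak_mixing_times.
Context d (X : measurableType d) (R : realType) (P : probability X R).
Variables (f g : X -> X).
Hypothesis fK : cancel f g.
Hypothesis gK : cancel g f.
Hypothesis mg : measurable_fun [set: X] g.
Hypothesis pf : measure_preserving P f.

Let pr A : R := fine (P A).

Lemma iter_measurable n : measurable_fun [set: X] (iter n f).
Proof.
elim: n => [|n IH]; first exact: measurable_id.
exact: (measurableT_comp pf.1 IH).
Qed.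

Lemma iter_preimage n A : measurable A -> measurable (iter n f @^-1` A).
Proof. by move=> mA; rewrite -[X in measurable X]setTI; exact: iter_measurable. Qed.

Lemma iter_preserving n A : measurable A -> P (iter n f @^-1` A) = P A.
Proof.
move=> mA; elim: n => // n IH; rewrite -IH.
rewrite -[RHS](pf.2 _ (iter_preimage n mA)); congr (P _).
by apply/seteqP; split => x /=; rewrite -iterSr.
Qed.

Lemma expect_iter n (u : X -> R) : bounded_mfun u ->
  expect P (fun x => u (iter n f x)) = expect P u.
Proof.
move=> bu; apply: (@expect_comp _ _ X X R P P (iter n f)) => //.
  exact: iter_measurable.
by move=> A mA; exact: iter_preserving.
Qed.

Let phi A (x : X) : R := \1_A x - pr A.

Let bphi A : measurable A -> bounded_mfun (phi A).
Proof.
by move=> mA; apply: bounded_mfunB; [exact: bounded_mfun_indic|exact: bounded_mfun_cst].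
Qed.

Let bphin n A : measurable A -> bounded_mfun (fun x => phi A (iter n f x)).
Proof. by move=> mA; exact: (bounded_mfun_comp (bphi mA) (iter_measurable n)). Qed.

Let phi0 A : measurable A -> expect P (phi A) = 0.
Proof.
move=> mA; rewrite /phi expectB; [|exact: bounded_mfun_indic|exact: bounded_mfun_cst].
by rewrite expect_indic// expect_cst subrr.
Qed.

Let phi_pair A B : measurable A -> measurable B ->
  expect P (fun x => phi A x * phi B x) = pr (A `&` B) - pr A * pr B.
Proof.
move=> mA mB.
have bA := bounded_mfun_indic R mA; have bB := bounded_mfun_indic R mB.
have -> : (fun x => phi A x * phi B x) =
  (fun x => \1_(A `&` B) x - (pr B * \1_A x + pr A * phi B x)).
  by apply/funext => x; rewrite /phi indicI /=; ring.
rewrite expectB; [|exact: bounded_mfun_indic (measurableI _ _ mA mB)|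
  by apply: bounded_mfunD; apply: bounded_mfunZ => //; exact: bphi].
rewrite expectD; [|exact: bounded_mfunZ|by apply: bounded_mfunZ; exact: bphi].
rewrite !expectZ//; last exact: bphi.
rewrite phi0// mulr0 addr0 !expect_indic//; last exact: measurableI.
by rewrite mulrC.
Qed.

Let prI n A : measurable A -> pr (iter n f @^-1` A) = pr A.
Proof. by move=> mA; rewrite /pr iter_preserving. Qed.

Let phi_le1 A x : measurable A -> `|phi A x| <= 1.
Proof.
move=> mA.
have a0 : 0 <= pr A by exact: fine_ge0.
have a1 : pr A <= 1.
  rewrite -lee_fin /pr fineK; first exact: probability_le1.
  exact: fin_num_measure.
by rewrite /phi indicE; case: (x \in A) => /=; rewrite ler_norml; apply/andP; split; lra.
Qed.

Let phi_sq A : measurable A -> expect P (fun x => phi A x ^+ 2) <= 1.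
Proof.
move=> mA; have h1 x : `|phi A x| <= 1 by exact: phi_le1.
apply: le_trans (ler_norm _) _; apply: expect_bound.
  by apply: bounded_mfunM; exact: bphi.
by move=> x; rewrite normrX exprn_ile1.
Qed.

Variable m : nat -> nat.
Hypothesis mix : forall A B, measurable A -> measurable B -> forall e : R, 0 < e ->
  exists N, forall j, (N <= j)%N -> `|pr ((iter (m j) f @^-1` A) `&` B) - pr A * pr B| <= e.

(* The times are chosen one after another, each decorrelating from the earlier ones. *)
Lemma decorrelated_times B (L : nat) (e : R) : measurable B -> 0 < e ->
  exists k : nat -> nat, forall i j, (i < j)%N -> (j < L)%N ->
   `|expect P (fun x => phi B (iter (k i) f x) * phi B (iter (k j) f x))| <= e.
Proof.
move=> mB e0; elim: L => [|L [k Hk]]; first by exists (fun=> 0%N).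
have [N HN] : exists N, forall i j, (i < L)%N -> (N <= j)%N ->
    `|pr ((iter (m j) f @^-1` B) `&` (iter (k i) f @^-1` B)) - pr B * pr B| <= e.
  elim: (L) => [|l [N HN]]; first by exists 0%N.
  have [N' HN'] := mix mB (iter_preimage (k l) mB) e0.
  exists (maxn N N') => i j; rewrite ltnS leq_eqVlt geq_max => /predU1P[->|il] /andP[h1 h2].
    by have := HN' j h2; rewrite prI.
  exact: HN.
exists (fun i => if i == L then m N else k i) => i j ij.
rewrite ltnS leq_eqVlt => /predU1P[jL|jL].
  rewrite jL eqxx; have iL : (i < L)%N by rewrite -jL.
  rewrite (ltn_eqF iL).
  have E : expect P (fun x => phi B (iter (k i) f x) * phi B (iter (m N) f x)) =
      pr ((iter (m N) f @^-1` B) `&` (iter (k i) f @^-1` B)) - pr B * pr B.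
    transitivity (expect P (fun x => phi (iter (k i) f @^-1` B) x * phi (iter (m N) f @^-1` B) x)).
      by congr expect; apply/funext => x; rewrite /phi !prI.
    rewrite (phi_pair (iter_preimage (k i) mB) (iter_preimage (m N) mB)).
    by rewrite (prI (k i) mB) (prI (m N) mB) setIC.
  by rewrite E; exact: HN.
rewrite (ltn_eqF jL) (ltn_eqF (ltn_trans ij jL)); exact: Hk.
Qed.

(** Bessel's inequality is applied to the centred indicator of [A] against the translates of that of
    [B] at the times [n + k i]. By invariance their Gram matrix does not depend on [n]; its diagonal
    is at most 1 and its other entries at most [1 / L], so the row sums are at most 2. *)
Lemma weak_mixing_of_times : weak_mixing P f.
Proof.
split=> // A B mA mB.
pose c n : R := expect P (fun x => phi A x * phi B (iter n f x)).
(* Weak mixing is stated with forward images; as f is invertible and preserves the measure, these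
   are traded for preimages of [B], and measurability of the image comes from the iterates of
   [g]. *)
have cE n : fine (P ((iter n f @` A) `&` B)) - fine (P A) * fine (P B) = c n.
  have iK : cancel (iter n f) (iter n g).
    by elim: n => // n IH x; rewrite [iter n.+1 g _]iterSr iterS fK IH.
  have mI : measurable (iter n f @` A).
    rewrite (_ : _ @` _ = iter n g @^-1` A).
      have mgn : measurable_fun [set: X] (iter n g).
        elim: (n) => [|k IH]; first exact: measurable_id.
        exact: (measurableT_comp mg IH).
      by rewrite -[X in measurable X]setTI; exact: mgn.
    apply/seteqP; split => x /=; first by move=> [y Ay <-]; rewrite iK.
    move=> Ax; exists (iter n g x) => //; clear - gK.
    by elim: n x => // n IH x; rewrite iterS [iter n.+1 g x]iterSr IH gK.
  have -> : c n = pr (A `&` (iter n f @^-1` B)) - pr A * pr B.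
    transitivity (expect P (fun x => phi A x * phi (iter n f @^-1` B) x)).
      by rewrite /c; congr expect; apply/funext => x; rewrite /phi !prI.
    by rewrite (phi_pair mA (iter_preimage n mB)) (prI n mB).
  congr (_ - _); congr fine.
  rewrite -(iter_preserving n (measurableI _ _ mI mB)).
  congr (P _); apply/seteqP; split => x /=.
    by move=> [[y Ay /(can_inj iK) <-]].
  by move=> [Ax Bx]; split => //; exists x.
under eq_fun do under eq_bigr do rewrite cE.
apply: cesaro_abs_cvg0.
- move=> n; rewrite /c; apply: expect_bound.
    by apply: bounded_mfunM; [exact: bphi|exact: bphin].
  by move=> x; rewrite normrM mulr_ile1// phi_le1.
move=> L L0; have LR : 0 < L%:R :> R by rewrite ltr0n.
have [k Hk] := @decorrelated_times B L L%:R^-1 mB ltac:(by rewrite invr_gt0).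
exists k => n.
apply: (@bessel_bound _ _ _ P L (phi A) (fun i x => phi B (iter (n + k i) f x)) 2) => //.
- exact: bphi.
- by move=> i; exact: bphin.
- exact: phi_sq.
move=> i iL.
have E j : expect P (fun z => phi B (iter (n + k i) f z) * phi B (iter (n + k j) f z)) =
   expect P (fun z => phi B (iter (k i) f z) * phi B (iter (k j) f z)).
  rewrite -(@expect_iter n (fun z => phi B (iter (k i) f z) * phi B (iter (k j) f z))).
    by congr expect; apply/funext => x; rewrite -!iterD ![(n + _)%N]addnC.
  by apply: bounded_mfunM; exact: bphin.
rewrite (bigD1 (Ordinal iL))//= (_ : 2 = 1 + 1 :> R)//; apply: lerD.
  rewrite E ger0_norm; last by apply: expect_ge0 => x; rewrite -expr2 sqr_ge0.
  rewrite (@expect_iter (k i) (fun z => phi B z * phi B z)); last by apply: bounded_mfunM; exact: bphi.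
  exact: phi_sq.
apply: (@le_trans _ _ (\sum_(j < L) L%:R^-1)); last first.
  by rewrite sumr_const card_ord -[leLHS]mulr_natl divff// gt_eqF.
rewrite [leRHS](bigD1 (Ordinal iL))//= -[leLHS]add0r lerD ?invr_ge0//.
apply: ler_sum => j ji; rewrite E.
have [h|h|h] := ltngtP i j.
- exact: Hk.
- rewrite (_ : (fun z => _) = fun z => phi B (iter (k j) f z) * phi B (iter (k i) f z)); first exact: Hk.
  by apply/funext => z; rewrite mulrC.
- by move: ji; rewrite -(inj_eq val_inj)/= h eqxx.
Qed.

End weak_mixing_times.

(** * Approximation of measurable sets by Lipschitz functions *)

Section approximation.
Context {R : realType}.
Local Notation R2 := (measurableTypeR R * measurableTypeR R)%type.
Local Notation proj := (@torus_proj R).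

Definition torus_test (L : R) (a : torus R -> R) := test_fun L (fun z => a (proj z)).

Lemma torus_proj_periodic (z l : R * R) : int_lattice l -> proj (z + l) = proj z.
Proof. by move=> hl; apply/torus_projP; rewrite addrC addKr. Qed.

Lemma torus_preimage_periodic T (a : torus R -> T) : lattice_periodic (fun z => a (proj z)).
Proof. by move=> z l hl; rewrite torus_proj_periodic. Qed.

Lemma torus_test_bounded L a : torus_test L a -> bounded_mfun a.
Proof.
move=> ta; have [mf [M fM]] := test_fun_bounded ta; split.
  by move=> _ A mA; rewrite setTI; have := mf measurableT _ mA; rewrite setTI.
by exists M => x; have [z <-] := torus_repr x; exact: fM.
Qed.

Lemma torus_test_norm L a x : torus_test L a -> `|a x| <= 1.
Proof. by move=> [_ a1 _]; have [z <-] := torus_repr x; exact: a1. Qed.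

Lemma torus_testP L a : 0 <= L -> (forall x, 0 <= a x <= 1) ->
  (forall u v : R * R, `|a (proj u) - a (proj v)| <= L * `|u - v|) -> torus_test L a.
Proof.
move=> L0 a01 aL; split => //; first exact: torus_preimage_periodic.
by move=> z; have /andP[h1 h2] := a01 (proj z); rewrite ger0_norm.
Qed.

Lemma torus_test_compl L a : torus_test L a -> (forall x, 0 <= a x <= 1) ->
  torus_test L (fun x => 1 - a x).
Proof.
move=> ta a01; have [_ _ aL] := ta; apply: torus_testP; first exact: test_fun_ge0 ta.
  by move=> x; have /andP[h1 h2] := a01 x; apply/andP; split; lra.
move=> u v; rewrite (_ : 1 - _ - _ = a (proj v) - a (proj u)); last by ring.
by rewrite distrC.
Qed.

Lemma max_dist (a b c d : R) : `|Num.max a b - Num.max c d| <= Num.max `|a - c| `|b - d|.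
Proof.
have half (x y z w M : R) : `|x - z| <= M -> `|y - w| <= M ->
    Num.max x y - Num.max z w <= M.
  move=> /ler_normlP[_ h1] /ler_normlP[_ h2]; rewrite lerBlDr.
  have z1 : z <= Num.max z w by rewrite le_max lexx.
  have w1 : w <= Num.max z w by rewrite le_max lexx orbT.
  by rewrite ge_max; apply/andP; split; lra.
have h1 : `|a - c| <= Num.max `|a - c| `|b - d| by rewrite le_max lexx.
have h2 : `|b - d| <= Num.max `|a - c| `|b - d| by rewrite le_max lexx orbT.
apply/ler_normlP; split; last exact: half.
by rewrite opprB; apply: half; rewrite distrC.
Qed.

Lemma torus_test_max L M a b : torus_test L a -> torus_test M b ->
  (forall x, 0 <= a x <= 1) -> (forall x, 0 <= b x <= 1) ->
  torus_test (Num.max L M) (fun x => Num.max (a x) (b x)).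
Proof.
move=> ta tb a01 b01; apply: torus_testP.
- by rewrite le_max (test_fun_ge0 ta).
- move=> x; have /andP[h1 h2] := a01 x; have /andP[h3 h4] := b01 x.
  by rewrite le_max h1 ge_max h2 h4.
move=> u v; apply: le_trans (max_dist _ _ _ _) _.
have [_ _ aL] := ta; have [_ _ bL] := tb.
rewrite ge_max; apply/andP; split.
  by apply: le_trans (aL u v) _; rewrite ler_wpM2r// le_max lexx.
by apply: le_trans (bL u v) _; rewrite ler_wpM2r// le_max lexx orbT.
Qed.

Lemma exhaustion (P : probability (torus R) R) (B : nat -> set (torus R)) (e : R) :
  (forall n, measurable (B n)) -> (forall n m, (n <= m)%N -> B n `<=` B m) -> 0 < e ->
  exists N, forall n, (N <= n)%N -> fine (P ((\bigcup_n B n) `\` B n)) <= e.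
Proof.
move=> mB ndB e0; set A := \bigcup_n B n.
have mA : measurable A by exact: bigcup_measurable.
have cv : (P (B n)) @[n --> \oo] --> P A.
  apply: (@nondecreasing_cvg_mu _ _ _ P B) => //.
  by move=> n m nm; apply/subsetPset; exact: ndB.
have cvf : (fine (P (B n))) @[n --> \oo] --> fine (P A).
  by apply: fine_cvg; rewrite fineK//; exact: fin_num_measure.
move/cvgrPdist_le : cvf => /(_ _ e0) [N _ HN]; exists N => n Nn.
have /(le_trans (ler_norm _)) := HN n Nn.
rewrite -fineB; [|exact: fin_num_measure|exact: fin_num_measure].
rewrite measureD//; last by rewrite -ge0_fin_numE//; exact: fin_num_measure.
by rewrite setIidr//; exact: bigcup_sup.
Qed.

Variables P1 P2 : probability (torus R) R.

(** One function serves both measures: in [descend_preserving] they are [torus_measure] and its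
    image, known to agree only on Lipschitz observables. *)
Definition approximable (A : set (torus R)) :=
  measurable A /\ forall e : R, 0 < e -> exists L a,
    [/\ torus_test L a, forall x, 0 <= a x <= 1,
        expect P1 (fun x => `|\1_A x - a x|) <= e &
        expect P2 (fun x => `|\1_A x - a x|) <= e].

Lemma approximable0 : approximable set0.
Proof.
split=> // e e0; exists 0, (fun=> 0); split.
- by apply: torus_testP => // [x|u v]; rewrite ?lexx ?ler01// subrr normr0 mul0r.
- by move=> x; rewrite lexx ler01.
- rewrite (_ : (fun x => _) = fun=> 0); first by rewrite expect_cst ltW.
  by apply/funext => x; rewrite indic0 subrr normr0.
- rewrite (_ : (fun x => _) = fun=> 0); first by rewrite expect_cst ltW.
  by apply/funext => x; rewrite indic0 subrr normr0.
Qed.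

Lemma approximableC A : approximable A -> approximable (~` A).
Proof.
move=> [mA HA]; split; first exact: measurableC.
move=> e e0; have [L [a [ta a01 h1 h2]]] := HA e e0.
exists L, (fun x => 1 - a x).
have E : (fun x => `|\1_(~` A) x - (1 - a x)|) = (fun x => `|\1_A x - a x|) :> (torus R -> R).
  by apply/funext => x; rewrite -normrN !indicE in_setC; congr (`|_|); case: (x \in A) => /=; ring.
rewrite E; split => //; first exact: torus_test_compl.
by move=> x; have /andP[k1 k2] := a01 x; apply/andP; split; lra.
Qed.

Lemma bounded_indic_dist A L a : measurable A -> torus_test L a ->
  bounded_mfun (fun x => `|\1_A x - a x|).
Proof.
move=> mA ta; apply: bounded_mfun_norm; apply: bounded_mfunB.
  exact: bounded_mfun_indic.
exact: torus_test_bounded ta.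
Qed.

Lemma indic_max_dist (A B : set (torus R)) (a b : R) x : 0 <= a <= 1 -> 0 <= b <= 1 ->
  `|\1_(A `|` B) x - Num.max a b| <= `|\1_A x - a| + `|\1_B x - b|.
Proof.
move=> a01 b01; have -> : \1_(A `|` B) x = Num.max (\1_A x) (\1_B x) :> R.
  rewrite !indicE in_setU; case: (x \in A); case: (x \in B) => /=.
  - by rewrite max_l.
  - by rewrite max_l.
  - by rewrite max_r.
  - by rewrite max_l.
apply: le_trans (max_dist _ _ _ _) _.
by rewrite ge_max lerDl lerDr !normr_ge0.
Qed.

Lemma approximableU A B : approximable A -> approximable B -> approximable (A `|` B).
Proof.
move=> [mA HA] [mB HB]; split; first exact: measurableU.
move=> e e0; have e2 : 0 < e / 2 by rewrite divr_gt0.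
have [L [a [ta a01 h1 h2]]] := HA _ e2.
have [M [b [tb b01 k1 k2]]] := HB _ e2.
have mU := measurableU _ _ mA mB.
have tab := torus_test_max ta tb a01 b01.
have key (P : probability (torus R) R) : expect P (fun x => `|\1_A x - a x|) <= e / 2 ->
    expect P (fun x => `|\1_B x - b x|) <= e / 2 ->
    expect P (fun x => `|\1_(A `|` B) x - Num.max (a x) (b x)|) <= e.
  move=> q1 q2; apply: (@le_trans _ _ (expect P (fun x => `|\1_A x - a x| + `|\1_B x - b x|))).
    apply: expect_le; first exact: bounded_indic_dist mU tab.
      by apply: bounded_mfunD; [exact: bounded_indic_dist mA ta|exact: bounded_indic_dist mB tb].
    by move=> x; exact: indic_max_dist.
  rewrite expectD; [|exact: bounded_indic_dist mA ta|exact: bounded_indic_dist mB tb].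
  lra.
exists (Num.max L M), (fun x => Num.max (a x) (b x)); split => //.
- move=> x; have /andP[p1 p2] := a01 x; have /andP[p3 p4] := b01 x.
  by rewrite le_max p1 ge_max p2 p4.
- exact: key.
- exact: key.
Qed.

Lemma exhaustion2 (B : nat -> set (torus R)) (e : R) :
  (forall n, measurable (B n)) -> (forall n m, (n <= m)%N -> B n `<=` B m) -> 0 < e ->
  exists n, fine (P1 ((\bigcup_n B n) `\` B n)) <= e /\ fine (P2 ((\bigcup_n B n) `\` B n)) <= e.
Proof.
move=> mB ndB e0; have [N1 H1] := exhaustion P1 mB ndB e0.
have [N2 H2] := exhaustion P2 mB ndB e0.
by exists (maxn N1 N2); split; [apply: H1; rewrite leq_maxl|apply: H2; rewrite leq_maxr].
Qed.

(** Finite unions are approximable and exhaust the countable one for both measures at a common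
    index. *)
Lemma approximable_bigcup (F : (set (torus R))^nat) :
  (forall i, approximable (F i)) -> approximable (\bigcup_i F i).
Proof.
move=> HF; pose B n := \big[setU/set0]_(i < n) F i.
have HB n : approximable (B n).
  rewrite /B; elim: n => [|n IH]; first by rewrite big_ord0; exact: approximable0.
  by rewrite big_ord_recr/=; exact: approximableU.
have BE n : B n = \bigcup_(i < n) F i by rewrite /B -bigcup_mkord.
have AE : \bigcup_i F i = \bigcup_n B n.
  apply/seteqP; split => x.
    by move=> [i _ Fx]; exists i.+1 => //; rewrite BE; exists i => /=.
  by move=> [n _]; rewrite BE => -[i _ Fx]; exists i.
have ndB n m : (n <= m)%N -> B n `<=` B m.
  by move=> nm; rewrite !BE => x [i /= ij Fx]; exists i => //=; exact: leq_trans nm.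
rewrite AE; have mA : measurable (\bigcup_n B n).
  by apply: bigcup_measurable => n _; exact: (HB n).1.
split => // e e0; have e2 : 0 < e / 2 by rewrite divr_gt0.
have [n [q1 q2]] := exhaustion2 (fun n => (HB n).1) ndB e2.
have [L [a [ta a01 h1 h2]]] := (HB n).2 _ e2.
have mB := (HB n).1.
have key (P : probability (torus R) R) : expect P (fun x => `|\1_(B n) x - a x|) <= e / 2 ->
    fine (P ((\bigcup_n B n) `\` B n)) <= e / 2 ->
    expect P (fun x => `|\1_(\bigcup_n B n) x - a x|) <= e.
  move=> k1 k2; have mD := measurableD mA mB.
  apply: (@le_trans _ _ (expect P (fun x => \1_((\bigcup_n B n) `\` B n) x + `|\1_(B n) x - a x|))).
    apply: expect_le; first exact: bounded_indic_dist mA ta.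
      by apply: bounded_mfunD; [exact: bounded_mfun_indic|exact: bounded_indic_dist mB ta].
    move=> x; rewrite (_ : \1_(\bigcup_n B n) x = \1_((\bigcup_n B n) `\` B n) x + \1_(B n) x :> R).
      rewrite -addrA (le_trans (ler_normD _ _))// lerD2r ger0_norm//.
    rewrite !indicE in_setD; have [xB|xB] := boolP (x \in B n); last by rewrite andbT addr0.
    rewrite andbF add0r (_ : x \in _)//; apply/mem_set; exists n => //; exact: set_mem.
  rewrite expectD; [|exact: bounded_mfun_indic|exact: bounded_indic_dist mB ta].
  rewrite expect_indic//; lra.
by exists L, a; split => //; exact: key.
Qed.

Lemma frac_lt1 (x : R) : frac x < 1.
Proof. by rewrite ltrBlDl; have := floorD1_gt x; rewrite intrD. Qed.

Lemma frac_shift (x m : R) : m \is a Num.int -> frac (x + m) = frac x.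
Proof. by move=> /intrP[n ->]; rewrite /frac floorDrz ?intr_int// intrKfloor intrD; ring. Qed.

Lemma measurable_frac : measurable_fun [set: measurableTypeR R] (frac : measurableTypeR R -> R).
Proof.
apply: measurable_funB; first exact: measurable_id.
by apply: nondecreasing_measurable => // x y xy; rewrite ler_int; exact: le_floor.
Qed.

(** Vanishing at both ends makes [a] continuous on the circle: for points in different unit cells,
    the distances to the ends add up to at most [|u - v|]. *)
Lemma frac_lipschitz (a : R -> R) (L : R) : (forall u v, `|a u - a v| <= L * `|u - v|) ->
  a 0 = 0 -> a 1 = 0 -> forall u v, `|a (frac u) - a (frac v)| <= L * `|u - v|.
Proof.
move=> aL a0 a1.
have L0 : 0 <= L by have := aL 1 0; rewrite subr0 normr1 mulr1; exact: le_trans.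
have key u v : u <= v -> `|a (frac u) - a (frac v)| <= L * `|u - v|.
  move=> uv; have := le_floor uv; rewrite le_eqVlt => /predU1P[E|fl].
    apply: le_trans (aL _ _) _; rewrite /frac E ler_wpM2l//.
    by rewrite (_ : u - _ - _ = u - v)//; ring.
  have {}fl : (Num.floor u)%:~R + 1 <= (Num.floor v)%:~R :> R.
    by rewrite -[1]/(1%:~R) -intrD ler_int lezD1.
  have h1 := aL (frac u) 1; have h2 := aL 0 (frac v).
  have /andP[fu0 fu1] := frac_itv u; have /andP[fv0 fv1] := frac_itv v.
  rewrite a1 subr0 distrC [`|1 - _|]ger0_norm ?subr_ge0// in h1.
  rewrite a0 sub0r normrN distrC subr0 [`|frac v|]ger0_norm// in h2.
  apply: le_trans (ler_normB _ _) _; apply: le_trans (lerD h1 h2) _.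
  rewrite -mulrDr ler_wpM2l// distrC ger0_norm ?subr_ge0//.
  by rewrite /frac; lra.
move=> u v; have [h|/ltW h] := leP u v; first exact: key.
by rewrite distrC [`|u - v|]distrC; exact: key.
Qed.

(** The descent to 0 at 1 makes the profile continuous on the circle; for [0 <= y < 1] it increases
    with n to the indicator of []y, 1[]. *)
Definition ramp (y : R) (n : nat) (t : R) : R :=
  Num.max 0 (Num.min 1 (Num.min (n%:R * (t - y)) (n%:R * (1 - t)))).

Lemma ramp_itv y n t : 0 <= ramp y n t <= 1.
Proof. by rewrite /ramp le_max lexx/= ge_max ler01/= ge_min lexx. Qed.

Lemma min_dist (a b c d : R) : `|Num.min a b - Num.min c d| <= Num.max `|a - c| `|b - d|.
Proof.
have N (x y : R) : `|- x - - y| = `|x - y| by rewrite -opprD normrN.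
by have := max_dist (- a) (- b) (- c) (- d); rewrite -!oppr_min !N.
Qed.

Lemma ramp_lipschitz y n u v : `|ramp y n u - ramp y n v| <= n%:R * `|u - v|.
Proof.
have h0 : 0 <= n%:R * `|u - v| by rewrite mulr_ge0.
apply: le_trans (max_dist _ _ _ _) _; rewrite subrr normr0 ge_max h0/=.
apply: le_trans (min_dist _ _ _ _) _; rewrite subrr normr0 ge_max h0/=.
apply: le_trans (min_dist _ _ _ _) _; rewrite -!mulrBr !normrM [`|n%:R|]ger0_norm//.
rewrite (_ : u - y - (v - y) = u - v); last by ring.
rewrite (_ : 1 - u - (1 - v) = v - u); last by ring.
by rewrite [`|v - u|]distrC maxxx.
Qed.

Section ray.
Variable c : R2 -> R.
Hypothesis c_lipschitz : forall u v : R * R, `|c u - c v| <= `|u - v|.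
Hypothesis c_lattice : forall u l : R * R, int_lattice l -> c (u + l) - c u \is a Num.int.
Hypothesis mc : measurable_fun [set: R2] c.

(** A coordinate modulo 1; by [c_lattice] it does not depend on the representative. *)
Let kappa (x : torus R) : R := frac (c (repr x)).

Let kappaE (z : R * R) : kappa (proj z) = frac (c z).
Proof.
rewrite /kappa -[repr _](subrK z) addrC; set l := _ - z.
have hl : int_lattice l by apply/torus_projP; exact: reprK.
by rewrite -[c (z + l)](subrK (c z)) addrC frac_shift//; exact: c_lattice.
Qed.

Let measurable_kappa (S : set R) : measurable S -> measurable (kappa @^-1` S).
Proof.
move=> mS; rewrite /measurable/= /torus_measurable/=.
rewrite (_ : _ @^-1` _ = (frac \o c) @^-1` S).
  rewrite -[X in measurable X]setTI.
  by apply: (measurableT_comp measurable_frac mc).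
by apply/seteqP; split => z /=; rewrite kappaE.
Qed.

Lemma approximable_ray y : approximable [set x | y < kappa x].
Proof.
have mA : measurable [set x | y < kappa x].
  have := measurable_kappa (measurable_itv `]y, +oo[); congr measurable.
  by apply/seteqP; split => x /=; rewrite in_itv/= andbT.
split=> // e e0.
have [y0|y0] := ltP y 0.
  have -> : [set x | y < kappa x] = ~` set0.
    apply/seteqP; split => x /=; first by move=> _ [].
    move=> _; apply: lt_le_trans y0 _; rewrite /kappa.
    by have /andP[] := frac_itv (c (repr x)).
  exact: (approximableC approximable0).2.
have [y1|y1] := leP 1 y.
  have -> : [set x | y < kappa x] = set0.
    rewrite -subset0 => x /= /lt_trans /(_ (frac_lt1 _)).
    by rewrite ltNge y1.
  exact: approximable0.2.
(* [B n] is where the profile has reached 1, so the error is at most the indicator of what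
   remains. *)
pose B (n : nat) := [set x | 1 <= n%:R * (kappa x - y) /\ 1 <= n%:R * (1 - kappa x)].
have mB n : measurable (B n).
  have mk : measurable_fun [set: torus R] kappa.
    by move=> _ S mS; rewrite setTI; exact: measurable_kappa.
  have mge (f : torus R -> R) : measurable_fun [set: torus R] f -> measurable [set x | 1 <= f x].
    move=> mf; have := mf measurableT `[1, +oo[%classic (measurable_itv _).
    by rewrite setTI; congr measurable; apply/seteqP; split => x /=; rewrite in_itv/= andbT.
  by apply: measurableI; apply: mge; apply: measurable_funM => //; apply: measurable_funB.
have AE : [set x | y < kappa x] = \bigcup_n B n.
  apply/seteqP; split => x /=.
    move=> yk; have k1 := frac_lt1 (c (repr x)).
    pose d := Num.min (kappa x - y) (1 - kappa x).
    have d0 : 0 < d by rewrite lt_min !subr_gt0 yk.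
    exists (Num.truncn d^-1).+1 => //.
    have h : 1 <= (Num.truncn d^-1).+1%:R * d.
      by rewrite -ler_pdivrMr// div1r ltW// truncnS_gt.
    split; apply: le_trans h _; rewrite ler_wpM2l// /d.
      by rewrite ge_min lexx.
    by rewrite ge_min lexx orbT.
  move=> [n _ [h _]]; rewrite -subr_gt0 ltNge; apply/negP => h'.
  have : n%:R * (kappa x - y) <= 0 by rewrite mulr_ge0_le0.
  lra.
have ndB n m : (n <= m)%N -> B n `<=` B m.
  move=> nm x [h1 h2].
  have k1 : 0 <= kappa x - y.
    rewrite leNgt; apply/negP => h'.
    have : n%:R * (kappa x - y) <= 0 by rewrite mulr_ge0_le0// ltW.
    lra.
  have k2 : 0 <= 1 - kappa x by rewrite subr_ge0; exact/ltW/frac_lt1.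
  by split; [apply: le_trans h1 _|apply: le_trans h2 _]; rewrite ler_wpM2r// ler_nat.
have [n [q1 q2]] := exhaustion2 mB ndB e0.
have ta : torus_test n%:R (fun x => ramp y n (kappa x)).
  apply: torus_testP => //; first by move=> x; exact: ramp_itv.
  move=> u v; rewrite !kappaE.
  have r0 : ramp y n 0 = 0.
    rewrite /ramp max_l// ge_min; apply/orP; right; rewrite ge_min; apply/orP; left.
    by rewrite sub0r mulrN oppr_le0 mulr_ge0.
  have r1 : ramp y n 1 = 0.
    rewrite /ramp max_l// ge_min; apply/orP; right; rewrite ge_min; apply/orP; right.
    by rewrite subrr mulr0.
  apply: le_trans (frac_lipschitz (@ramp_lipschitz y n) r0 r1 _ _) _.
  by rewrite ler_wpM2l.
have dist x : `|\1_[set x | y < kappa x] x - ramp y n (kappa x)| <= \1_((\bigcup_n B n) `\` B n) x.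
  have /andP[r0 r1] := ramp_itv y n (kappa x).
  rewrite -AE !indicE in_setD; have [xA|xA] := boolP (x \in [set x | y < kappa x]) => /=.
    have [xB|xB] := boolP (x \in B n) => /=; last by rewrite ger0_norm; lra.
    move/set_mem : xB => [h1 h2].
    by rewrite /ramp (min_l (y := Num.min _ _)) ?le_min ?h1// max_r// subrr normr0.
  rewrite sub0r normrN (_ : ramp _ _ _ = 0) ?normr0//.
  have h : kappa x <= y by rewrite leNgt; apply/negP => h; move/negP : xA; apply; exact: mem_set.
  rewrite /ramp max_l// ge_min; apply/orP; right; rewrite ge_min; apply/orP; left.
  by rewrite mulr_ge0_le0// subr_le0.
have key (P : probability (torus R) R) : fine (P ((\bigcup_n B n) `\` B n)) <= e ->
    expect P (fun x => `|\1_[set x | y < kappa x] x - ramp y n (kappa x)|) <= e.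
  have mD : measurable ((\bigcup_n B n) `\` B n) by apply: measurableD => //; rewrite -AE.
  move=> h; rewrite -(expect_indic P mD) in h; apply: le_trans h.
  apply: expect_le => //; first exact: bounded_indic_dist mA ta.
  exact: bounded_mfun_indic.
exists n%:R, (fun x => ramp y n (kappa x)); split => //; [|exact: key|exact: key].
by move=> x; exact: ramp_itv.
Qed.

Lemma approximable_coordinate (S : set (measurableTypeR R)) : measurable S ->
  approximable ((fun x : torus R => frac (c (repr x))) @^-1` S).
Proof.
move=> mS.
have : (@RGenOInfty.G R).-sigma.-measurable S by rewrite -RGenOInfty.measurableE.
apply: (@smallest_sub _ _ _
  [set S | approximable ((fun x : torus R => frac (c (repr x))) @^-1` S)]).
  split => /=; first by rewrite preimage_set0; exact: approximable0.
    by move=> A HA; rewrite setTD preimage_setC; exact: approximableC.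
  by move=> F HF; rewrite preimage_bigcup; exact: approximable_bigcup.
move=> _ [y ->] /=.
rewrite (_ : _ @^-1` _ = [set x | y < kappa x]); first exact: approximable_ray.
by apply/seteqP; split => x /=; rewrite in_itv/= andbT.
Qed.

End ray.

(* A set of the torus is a preimage under the pair of fractional parts, and the
   approximable sets form a sigma-algebra containing the preimages of rays. *)
Lemma measurable_approximable A : measurable A -> approximable A.
Proof.
move=> mA.
pose kappa (x : torus R) : R * R := (frac (repr x).1, frac (repr x).2).
have projK x : proj (kappa x) = x.
  rewrite -[RHS]reprK; apply/torus_projP.
  by rewrite /int_lattice /kappa /frac /=; apply/andP; split;
    rewrite addrAC subrr sub0r rpredN intr_int.
have -> : A = kappa @^-1` (proj @^-1` A).
  by apply/seteqP; split => x /=; rewrite projK.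
have mE : measurable (proj @^-1` A : set R2) by [].
move: (proj @^-1` A) mE => E.
apply: (@smallest_sub _ _ _ [set E | approximable (kappa @^-1` E)]).
  split => /=; first by rewrite preimage_set0; exact: approximable0.
    by move=> B HB; rewrite setTD preimage_setC; exact: approximableC.
  by move=> F HF; rewrite preimage_bigcup; exact: approximable_bigcup.
have latP (l : R * R) : int_lattice l -> l.1 \is a Num.int /\ l.2 \is a Num.int by move=> /andP.
move=> _ [[S mS <-]|[S mS <-]] /=; rewrite setTI.
  apply: (@approximable_coordinate fst) => //.
  - by move=> u v; exact: (norm_pair_fst (u - v)).
  - by move=> u l /latP[h _]; rewrite /= addrC addKr.
apply: (@approximable_coordinate snd) => //.
- by move=> u v; exact: (norm_pair_snd (u - v)).
- by move=> u l /latP[_ h]; rewrite /= addrC addKr.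
Qed.

End approximation.

(** * Descent to the torus *)

Section self_bij.
Context {T : Type} (f g : T -> T) (fK : cancel f g) (gK : cancel g f).

(* A copy of [f] that carries the bijection structure with inverse [g]. *)
Definition self_bij of cancel f g & cancel g f : T -> T := f.

HB.instance Definition _ := @Can2.Build T T setT setT (self_bij fK gK) g
  (fun _ _ => I) (fun _ _ => I) (fun x _ => fK x) (fun x _ => gK x).

End self_bij.

Section descent.
Context {R : realType}.
Local Notation R2 := (measurableTypeR R * measurableTypeR R)%type.
Local Notation Esq := (expect (@square_measure R)).
Local Notation proj := (@torus_proj R).

Lemma derivable_pair (F : R * R -> R * R) (x v : R * R) :
  derivable (fun z => (F z).1) x v -> derivable (fun z => (F z).2) x v ->
  derivable F x v /\ 'D_v F x = ('D_v (fun z => (F z).1) x, 'D_v (fun z => (F z).2) x).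
Proof.
move=> d1 d2.
have cv : h^-1 *: (F (h *: v + x) - F x) @[h --> 0^'] -->
    ('D_v (fun z => (F z).1) x, 'D_v (fun z => (F z).2) x).
  exact: (cvg_pair d1 d2).
by split; [apply/cvg_ex; eexists; exact: cv|exact: cvg_lim].
Qed.

Lemma Ck_continuously_differentiable k (F : R * R -> R * R) :
  Ck k (fun z => (F z).1) -> Ck k (fun z => (F z).2) -> continuously_differentiable k setT F.
Proof.
elim: k F => [|k IH] F H1 H2.
  move=> x _; have -> : F = (fun z => ((F z).1, (F z).2)).
    by apply/funext => w; rewrite -surjective_pairing.
  exact: (cvg_pair (H1 x) (H2 x)).
move=> v ev; have [d1 C1] := H1 v ev; have [d2 C2] := H2 v ev.
split; first by move=> x _; have [] := derivable_pair (d1 x) (d2 x).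
apply: IH.
- have -> : (fun z => ('D_v F z).1) = 'D_v (fun z => (F z).1).
    by apply/funext => x; have [_ ->] := derivable_pair (d1 x) (d2 x).
  exact: C1.
- have -> : (fun z => ('D_v F z).2) = 'D_v (fun z => (F z).2).
    by apply/funext => x; have [_ ->] := derivable_pair (d1 x) (d2 x).
  exact: C2.
Qed.

Definition descend (F : R * R -> R * R) (x : torus R) : torus R := proj (F (repr x)).

Lemma descendE F z : equivariant F -> descend F (proj z) = proj (F z).
Proof.
move=> eF; rewrite /descend -[repr _](subrK z) addrC; set l := _ - z.
have hl : int_lattice l by apply/torus_projP; exact: reprK.
by rewrite eF// torus_proj_periodic.
Qed.

Lemma iter_descendE F n z : equivariant F -> iter n (descend F) (proj z) = proj (iter n F z).
Proof. by move=> eF; elim: n => //= n ->; exact: descendE. Qed.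

Lemma descendK F G : equivariant F -> equivariant G -> cancel F G ->
  cancel (descend F) (descend G).
Proof. by move=> eF eG FK x; have [z <-] := torus_repr x; rewrite !descendE// FK. Qed.

Lemma descend_smooth F : equivariant F ->
  (forall k, Ck k (fun z => (F z).1) /\ Ck k (fun z => (F z).2)) -> torus_smooth (descend F).
Proof.
move=> eF CF a; exists setT, F; split => //; first exact: openT.
  by move=> k; have [h1 h2] := CF k; exact: Ck_continuously_differentiable.
by move=> x _; rewrite descendE.
Qed.

Lemma descend_measurable F : equivariant F -> measurable_fun [set: R2] (F : R2 -> R2) ->
  measurable_fun [set: torus R] (descend F).
Proof.
move=> eF mF _ A mA; rewrite setTI /measurable/= /torus_measurable/=.
rewrite (_ : _ @^-1` _ = F @^-1` (proj @^-1` A)).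
  by have := mF measurableT _ mA; rewrite setTI.
by apply/seteqP; split => z /=; rewrite descendE.
Qed.

Lemma expect_torus (a : torus R -> R) : bounded_mfun a ->
  expect (@torus_measure R) a = Esq (fun z : R2 => a (proj z)).
Proof.
move=> ba; apply/esym.
apply: (@expect_comp _ _ _ _ _ (@square_measure R) (@torus_measure R) proj) => //.
by move=> _ A mA; rewrite setTI.
Qed.

(** [P] and its image [Q] have the same integrals of test functions. If they differed by [d] on [A],
    a test function within [d / 3] of the indicator for both measures would give [d <= 2 d / 3]. *)
Lemma descend_preserving F : equivariant F -> measurable_fun [set: R2] (F : R2 -> R2) ->
  (forall L a, test_fun L a -> Esq (fun z : R2 => a (F z)) = Esq (a : R2 -> R)) ->
  measure_preserving (@torus_measure R) (descend F).
Proof.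
move=> eF mF HF; have mf := descend_measurable eF mF; split; first exact: mf.
move=> A mA; have mB : measurable (descend F @^-1` A).
  by have := mf measurableT _ mA; rewrite setTI.
pose fM := isMeasurableFun.Build _ _ _ _ _ mf.
pose f : {mfun torus R >-> torus R} := HB.pack (descend F) fM.
pose P := @torus_measure R; pose Q := distribution P f.
have bA := bounded_mfun_indic R mA.
suff : fine (Q A) = fine (P A).
  move=> E; have {}E : fine (P (descend F @^-1` A)) = fine (P A) by [].
  rewrite -[LHS]fineK; last exact: fin_num_measure.
  by rewrite E fineK//; exact: fin_num_measure.
apply/eqP; rewrite -subr_eq0 -normr_le0 leNgt; apply/negP => d0.
set d := `|_| in d0.
have d3 : 0 < d / 3 by rewrite divr_gt0.
have [_ /(_ _ d3) [L [a [ta _ h1 h2]]]] := measurable_approximable P Q mA.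
have ba := torus_test_bounded ta.
have E : expect Q a = expect P a.
  rewrite -(@expect_comp _ _ _ _ _ P Q (descend F) a mf)//.
  rewrite !expect_torus//; last exact: bounded_mfun_comp ba mf.
  rewrite -(HF L (fun z => a (proj z)))//; congr expect.
  by apply/funext => z; rewrite descendE.
have close (M : probability (torus R) R) (c : R) :
    expect M (fun x => `|\1_A x - a x|) <= c -> `|fine (M A) - expect M a| <= c.
  have <- : expect M (fun x => \1_A x - a x) = fine (M A) - expect M a.
    by rewrite (expectB M bA ba) (expect_indic M mA).
  exact: (le_trans (expect_norm M (bounded_mfunB bA ba))).
have c1 := close _ _ h1; have c2 := close _ _ h2; clear close h1 h2.
rewrite E in c2.
have : d <= `|fine (Q A) - expect P a| + `|fine (P A) - expect P a|.
  rewrite /d (_ : fine (Q A) - fine (P A) = (fine (Q A) - expect P a) - (fine (P A) - expect P a)).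
    exact: ler_normB.
  by ring.
move: (`|fine (Q A) - expect P a|) (`|fine (P A) - expect P a|) c1 c2 => u v; clear -d0; lra.
Qed.

End descent.

(** * Mixing and rigidity on the torus *)

Section descent_dynamics.
Context {R : realType}.
Local Notation R2 := (measurableTypeR R * measurableTypeR R)%type.
Local Notation Esq := (expect (@square_measure R)).
Local Notation proj := (@torus_proj R).
Local Notation mu := (@torus_measure R).

Lemma test_fun_le (L M : R) (a : R * R -> R) : L <= M -> test_fun L a -> test_fun M a.
Proof.
move=> LM [h1 h2 h3]; split; [exact: h1|exact: h2|move=> u v].
by apply: le_trans (h3 u v) _; rewrite ler_wpM2r.
Qed.

Lemma product_dist (x y a b : R) : `|y| <= 1 -> `|a| <= 1 ->
  `|x * y - a * b| <= `|x - a| + `|y - b|.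
Proof.
move=> y1 a1; rewrite (_ : x * y - a * b = (x - a) * y + a * (y - b)); last by ring.
apply: le_trans (ler_normD _ _) _; rewrite !normrM lerD//.
  by rewrite ler_piMr.
by rewrite ler_piMl.
Qed.

Lemma descend_mixing F (m : nat -> nat) : equivariant F ->
  measure_preserving mu (descend F) ->
  (forall L a b, test_fun L a -> test_fun L b -> forall e : R, 0 < e ->
    exists N, forall j, (N <= j)%N ->
    `|Esq (fun z : R2 => a (iter (m j) F z) * b z) - Esq (a : R2 -> R) * Esq (b : R2 -> R)| <= e) ->
  forall A B, measurable A -> measurable B -> forall e : R, 0 < e ->
    exists N, forall j, (N <= j)%N ->
    `|fine (mu ((iter (m j) (descend F) @^-1` A) `&` B)) - fine (mu A) * fine (mu B)| <= e.
Proof.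
move=> eF pf HF A B mA mB e e0.
(* Five errors: two from replacing the indicators in the correlation, one from mixing, two from
   replacing the means. *)
have e5 : 0 < e / 5 by rewrite divr_gt0.
have [_ /(_ _ e5) [L [a [ta _ ha _]]]] := measurable_approximable mu mu mA.
have [_ /(_ _ e5) [M [b [tb _ hb _]]]] := measurable_approximable mu mu mB.
have ba := torus_test_bounded ta; have bb := torus_test_bounded tb.
have iA := bounded_mfun_indic R mA; have iB := bounded_mfun_indic R mB.
have tLa : test_fun (Num.max L M) (fun z => a (proj z)).
  by apply: (test_fun_le _ ta); rewrite le_max lexx.
have tMb : test_fun (Num.max L M) (fun z => b (proj z)).
  by apply: (test_fun_le _ tb); rewrite le_max lexx orbT.
have [N HN] := HF _ _ _ tLa tMb _ e5.
exists N => j Nj; have {HN} := HN j Nj.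
set f := iter (m j) (descend F).
have mf : measurable_fun [set: torus R] f by exact: iter_measurable pf _.
have baf : bounded_mfun (fun x => a (f x)) by exact: bounded_mfun_comp ba mf.
have iAf : bounded_mfun (fun x => \1_A (f x) : R) by exact: bounded_mfun_comp iA mf.
have E1 : Esq (fun z : R2 => a (proj (iter (m j) F z)) * b (proj z)) =
    expect mu (fun x => a (f x) * b x).
  rewrite (expect_torus (bounded_mfunM baf bb)); congr expect.
  by apply/funext => z; rewrite /f iter_descendE.
have E2 : Esq (fun z : R2 => a (proj z)) = expect mu a by rewrite (expect_torus ba).
have E3 : Esq (fun z : R2 => b (proj z)) = expect mu b by rewrite (expect_torus bb).
rewrite E1 E2 E3 => mix.
have E4 : fine (mu ((f @^-1` A) `&` B)) = expect mu (fun x => \1_A (f x) * \1_B x).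
  have mI : measurable ((f @^-1` A) `&` B).
    by apply: measurableI => //; have := mf measurableT _ mA; rewrite setTI.
  rewrite -(expect_indic mu mI); congr expect; apply/funext => x.
  by rewrite indicI.
have bM : bounded_mfun (fun x => \1_A (f x) * \1_B x - a (f x) * b x).
  by apply: bounded_mfunB; apply: bounded_mfunM.
have h1 : `|expect mu (fun x => \1_A (f x) * \1_B x) - expect mu (fun x => a (f x) * b x)| <= e / 5 + e / 5.
  rewrite -(expectB mu (bounded_mfunM iAf iB) (bounded_mfunM baf bb)).
  apply: (le_trans (expect_norm mu bM)).
  have b1 := bounded_mfun_norm (bounded_mfunB iA ba).
  have b1f := bounded_mfun_norm (bounded_mfunB iAf baf).
  have b2 := bounded_mfun_norm (bounded_mfunB iB bb).
  apply: (@le_trans _ _ (expect mu (fun x => `|\1_A (f x) - a (f x)| + `|\1_B x - b x|))).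
    apply: (expect_le mu (bounded_mfun_norm bM) (bounded_mfunD b1f b2)) => x.
    apply: product_dist; last exact: torus_test_norm ta.
    by rewrite indicE; case: (x \in B); rewrite /= ?normr1 ?normr0 ?ler01.
  rewrite (expectD mu b1f b2); apply: lerD hb.
  by rewrite (@expect_iter _ _ _ mu _ pf (m j) (fun x => `|\1_A x - a x|) b1).
have hA : `|fine (mu A) - expect mu a| <= e / 5.
  rewrite -(expect_indic mu mA) -(expectB mu iA ba).
  exact: (le_trans (expect_norm mu (bounded_mfunB iA ba)) ha).
have hB : `|fine (mu B) - expect mu b| <= e / 5.
  rewrite -(expect_indic mu mB) -(expectB mu iB bb).
  exact: (le_trans (expect_norm mu (bounded_mfunB iB bb)) hb).
have hB1 : `|fine (mu B)| <= 1.
  rewrite -(expect_indic mu mB); apply: (expect_bound mu iB) => x.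
  by rewrite indicE; case: (x \in B); rewrite /= ?normr1 ?normr0 ?ler01.
have ha1 : `|expect mu a| <= 1.
  by apply: (expect_bound mu ba) => x; exact: torus_test_norm ta.
have h2 := product_dist (fine (mu A)) (expect mu b) hB1 ha1.
rewrite E4.
move: (expect mu (fun x => \1_A (f x) * \1_B x)) (expect mu (fun x => a (f x) * b x)) (fine (mu A) * fine (mu B)) (expect mu a * expect mu b)
  (`|fine (mu A) - expect mu a|) (`|fine (mu B) - expect mu b|) h1 mix h2 hA hB.
clear -e0 => s t u v x y h1 mix h2 hA hB.
rewrite (_ : s - u = (s - t) + (t - v) - (u - v)); last by ring.
apply: le_trans (ler_normB _ _) _.
have := ler_normD (s - t) (t - v); lra.
Qed.

(** The metric is Euclidean and the norm on pairs is the maximum; 2 bounds the factor [sqrt 2]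
    between them. *)
Lemma torus_dist_bound (x y : torus R) (a b : R * R) : proj a = x -> proj b = y ->
  0 <= torus_dist x y <= 2 * `|a - b|.
Proof.
move=> ax bY; rewrite /torus_dist.
apply/andP; split.
  apply: lb_le_inf; first by eexists; exists a, b.
  by move=> _ [u [v [_ _ ->]]]; exact: sqrtr_ge0.
apply: (@le_trans _ _ (Num.sqrt ((a.1 - b.1) ^+ 2 + (a.2 - b.2) ^+ 2))).
  apply: ge_inf; last by exists a, b.
  by exists 0 => _ [u [v [_ _ ->]]]; exact: sqrtr_ge0.
have h1 : `|a.1 - b.1| <= `|a - b| := norm_pair_fst (a - b).
have h2 : `|a.2 - b.2| <= `|a - b| := norm_pair_snd (a - b).
rewrite -[leRHS]ger0_norm ?mulr_ge0// -sqrtr_sqr ler_wsqrtr//.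
rewrite -[(a.1 - b.1) ^+ 2]real_normK ?num_real// -[(a.2 - b.2) ^+ 2]real_normK ?num_real//.
have := normr_ge0 (a.1 - b.1); have := normr_ge0 (a.2 - b.2).
move: (`|a.1 - b.1|) (`|a.2 - b.2|) (`|a - b|) h1 h2; clear => u v w; nra.
Qed.

Lemma sup_dist_bound (f g : torus R -> torus R) (c : R) :
  (forall x, 0 <= torus_dist (f x) (g x) <= c) ->
  0 <= sup (range (fun x => torus_dist (f x) (g x))) <= c.
Proof.
move=> H; have ub : ubound (range (fun x => torus_dist (f x) (g x))) c.
  by move=> _ [x _ <-]; have /andP[] := H x.
have ne : range (fun x => torus_dist (f x) (g x)) !=set0 by exists (torus_dist (f 0) (g 0)), 0.
apply/andP; split; last exact: ge_sup.
have /andP[h _] := H 0; apply: (le_trans h).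
by apply: ub_le_sup; [exists c|exists 0].
Qed.

Lemma descend_rigid F G (fK : cancel (descend F) (descend G))
    (gK : cancel (descend G) (descend F)) (q : nat -> nat) (p : nat -> nat) :
  equivariant F ->
  (forall e : R, 0 < e -> exists N, forall n, (N <= n)%N ->
    forall z : R * R, `|iter (q n) F z - (z + ((p n)%:R, 0))| <= e) ->
  uniform_dist (iter (q n) (self_bij fK gK)) idfun @[n --> \oo] --> (0 : R).
Proof.
move=> eF HF; apply/cvgrPdist_le => /= e e0.
have e4 : 0 < e / 4 by rewrite divr_gt0.
have [N HN] := HF _ e4.
exists N => // n /= Nn; rewrite sub0r normrN.
have close x : forall y, (y = (x, iter (q n) (descend F) x) \/ y = (iter (q n) (descend F) x, x)) ->
    0 <= torus_dist y.1 y.2 <= e / 2.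
  have [z <-] := torus_repr x; have {HN} := HN n Nn z.
  rewrite iter_descendE// => h.
  have pz : proj (z + ((p n)%:R, 0)) = proj z.
    by apply: torus_proj_periodic; rewrite /int_lattice/= rpred0 natr_int.
  have e2 : 2 * (e / 4) = e / 2 by field.
  move=> _ [->|->] /=.
    have /andP[-> h2] := torus_dist_bound pz (erefl (proj (iter (q n) F z))).
    by apply: (le_trans h2); rewrite -e2 ler_wpM2l// distrC.
  have /andP[-> h2] := torus_dist_bound (erefl (proj (iter (q n) F z))) pz.
  by apply: (le_trans h2); rewrite -e2 ler_wpM2l.
have H1 x : 0 <= torus_dist (iter (q n) (descend F) x) x <= e / 2.
  exact: (close x (_, _) (or_intror erefl)).
have H2 x : 0 <= torus_dist (iter (q n) (descend G) x) x <= e / 2.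
  (* The inverse is handled by the forward estimate taken at the inverse iterate of [x]. *)
  have E : iter (q n) (descend F) (iter (q n) (descend G) x) = x.
    by elim: (q n) x => // k IH x; rewrite [iter _ (descend F) _]iterSr [iter _ (descend G) _]iterS gK IH.
  have := close (iter (q n) (descend G) x) (_, _) (or_introl erefl).
  by rewrite E.
have /andP[a0 a1] := sup_dist_bound H1; have /andP[b0 b1] := sup_dist_bound H2.
(* The inverse carried by the iterate of [self_bij] is, by computation, the iterate of
   [descend G]. *)
rewrite [uniform_dist _ _](_ : _ =
  sup (range (fun x => torus_dist (iter (q n) (descend F) x) x)) +
  sup (range (fun x => torus_dist (iter (q n) (descend G) x) x)))//.
rewrite ger0_norm ?addr_ge0//.
apply: le_trans (lerD a1 b1) _; clear; lra.
Qed.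

End descent_dynamics.

Theorem theorem1 (R : realType) (q : nat -> nat)
    (q_gt0 : forall n, (0 < n)%N -> (0 < q n)%N)
    (q_growth : forall n, (0 < n)%N ->
       phi1 R n * (q n)%:R ^+ (2 * (n.+2 * n.+1 ^ n.+1 + 1)) <= (q n.+1)%:R) :
  exists f : {splitbij [set: torus R] >-> [set: torus R]},
    [/\ torus_Cinfty_diffeomorphism f,
        weak_mixing (@torus_measure R) f &
        uniformly_rigid q f].
Proof.
have q_pow n : (0 < n)%N -> (2 ^ n * q n ^ n <= q n.+1)%N by exact: (growth_pow q_gt0 q_growth).
have [alpha Halpha] := @rotation_number R q q_gt0 q_pow.
have q_le m n := @growth_le q q_gt0 q_pow m n.
have [S HS] : exists S : nat -> @stage R, forall j, next_stage q (num q) alpha j (S j) (S j.+1).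
  have H j (s : @stage R) : {s' | next_stage q (num q) alpha j s s'}.
    apply: cid; apply: (next_stage_exists q_gt0 q_le).
    - exact: (eps_decay q_gt0 q_pow Halpha).
    - exact: (q_large q_gt0 q_pow).
    - exact: (eps_gt0 q_gt0 Halpha).
    - exact: (eps_inv q_gt0 Halpha).
  pose S := fix S j := if j is j'.+1 then sval (H j' (S j')) else @Stage R id id 0 conj_pair_id.
  by exists S => j; exact: (svalP (H j (S j))).
have pa : pm_alpha alpha alpha by left.
have na : pm_alpha alpha (- alpha) by right.
have nna : pm_alpha alpha (- - alpha) by rewrite opprK; left.
pose F := limF S alpha; pose G := limF S (- alpha).
have eF : equivariant F by exact: (limF_equivariant HS pa).
have eG : equivariant G by exact: (limF_equivariant HS na).
have FK : cancel F G by exact: (limF_cancel HS pa na).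
have GK : cancel G F.
  have := limF_cancel HS na nna; rewrite opprK; exact.
have fK := descendK eF eG FK; have gK := descendK eG eF GK.
have mF := limF_measurable HS pa.
have pf : measure_preserving (@torus_measure R) (descend F).
  apply: (descend_preserving eF mF) => L a ta.
  exact: (limF_expect HS pa ta).
have mg := descend_measurable eG (limF_measurable HS na).
exists (self_bij fK gK); split.
- split.
    by apply: (descend_smooth eF) => k; exact: (limF_Ck HS k pa).
  by apply: (descend_smooth eG) => k; exact: (limF_Ck HS k na).
- have [m Hm] := limF_mixing q_le HS.
  apply: (weak_mixing_of_times fK gK mg pf (m := m)).
  exact: (descend_mixing eF pf Hm).
- split; first exact: pf.
    exact: (growth_lt q_gt0 q_pow).
  apply: (@descend_rigid R F G fK gK q (num q) eF).
  exact: (limF_rigid q_le HS).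
Qed.
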